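(* Let $(\mathcal{G}\rightrightarrows M,\omega+\eta)$ be a 1-shifted symplectic groupoid with corresponding Dirac structure $\mathbf{L}=(\mathtt{a}_{\mathcal{G}},\lambda_\omega)(A_{\mathcal{G}})\subset\mathbb{T}_\eta M$. (a) If $(\mathcal{H},\Phi,\sigma)$, $\mathcal{H}\rightrightarrows N$, is a lagrangian morphism into $(\mathcal{G},\omega+\eta)$, then $(N,\phi,\sigma)$, with $\phi=\Phi|_N$, is an infinitesimal lagrangian morphism into $\mathbf{L}$. (b) If $(N,\phi,\sigma)$ is an infinitesimal lagrangian morphism into $\mathbf{L}$ and $\mathcal{H}$ is a source-simply-connected Lie groupoid integrating $R_{\phi,\sigma}\cap(TN\times\mathbf{L})$, then $(\mathcal{H},\Phi,\sigma)$ is a lagrangian morphism into $(\mathcal{G},\omega+\eta)$, where $\Phi:\mathcal{H}\to\mathcal{G}$ is the integration of the Lie algebroid morphism $R_{\phi,\sigma}\cap(TN\times\mathbf{L})\to\mathbf{L}$ given by the natural projection.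
   Context: Everything is real and $C^\infty$. For a Lie groupoid $\mathcal{G}\rightrightarrows M$: source $\mathtt{s}$, target $\mathtt{t}$, multiplication $\mathtt{m}$ (defined when $\mathtt{s}(g)=\mathtt{t}(h)$); $A_{\mathcal{G}}=\ker(T\mathtt{s})|_M$, anchor $\mathtt{a}_{\mathcal{G}}=T\mathtt{t}$, bracket by right-invariant vector fields. A 1-shifted symplectic (= quasi-symplectic) groupoid $(\mathcal{G}\rightrightarrows M,\omega+\eta)$: $\omega\in\Omega^2(\mathcal{G})$, $\eta\in\Omega^3(M)$ with $\mathtt{m}^*\omega=\mathrm{pr}_1^*\omega+\mathrm{pr}_2^*\omega$, $d\omega=\mathtt{s}^*\eta-\mathtt{t}^*\eta$, $d\eta=0$, $\dim\mathcal{G}=2\dim M$ and $\ker(T\mathtt{s})_x\cap\ker(\omega)_x\cap\ker(T\mathtt{t})_x=0$ for $x\in M$. $\lambda_\omega(u)=(i_u\omega)|_{TM}$ for $u\in A_{\mathcal{G}}$. Then $(\mathtt{a}_{\mathcal{G}},\lambda_\omega)$ identifies $A_{\mathcal{G}}$, as a Lie algebroid, with the Dirac structure $\mathbf{L}$ in $\mathbb{T}_\eta M$ (the bundle $TM\oplus T^*M$ with canonical pairing and bracket $[X,Y]+\mathcal{L}_X\beta-i_Yd\alpha+i_Yi_X\eta$ of $X+\alpha$, $Y+\beta$). An isotropic morphism $(\mathcal{H},\Phi,\sigma)$: a Lie groupoid morphism $\Phi:(\mathcal{H}\rightrightarrows N)\to\mathcal{G}$ with $\sigma\in\Omega^2(N)$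 such that $\mathtt{s}^*\sigma-\mathtt{t}^*\sigma=\Phi^*\omega$ and $d\sigma=\phi^*\eta$. It is lagrangian if the sequence of vector bundles over $N$ $$0\to A_{\mathcal{H}}\to TN\oplus\phi^*A_{\mathcal{G}}\to\phi^*TM\oplus T^*N\to A_{\mathcal{H}}^*\to0$$ with maps $w\mapsto(\mathtt{a}_{\mathcal{H}}(w),\mathrm{Lie}(\Phi)(w))$, $(Y,u)\mapsto(T\phi(Y)-\mathtt{a}_{\mathcal{G}}(u),\ \sigma^\flat(Y)+T^*\phi(\lambda_\omega(u)))$, $(X,\alpha)\mapsto-\mathrm{Lie}(\Phi)^*(\lambda_\omega^*(X))+\mathtt{a}_{\mathcal{H}}^*(\alpha)$ is exact. For $\phi:N\to M$ and $\sigma\in\Omega^2(N)$ with $d\sigma=\phi^*\eta$, $R_{\phi,\sigma}=\{((Y,\beta),(X,\alpha)):Y\in T_xN,\ X=T\phi(Y),\ \alpha\in T^*_{\phi(x)}M,\ \beta=(T\phi)^*\alpha+i_Y\sigma,\ x\in N\}$. $TN\times\mathbf{L}$ denotes the pairs $((Y,0),(X,\alpha))$ with $(X,\alpha)\in\mathbf{L}$; the intersection $R_{\phi,\sigma}\cap(TN\times\mathbf{L})$ is taken over $\mathrm{Graph}(\phi)\cong N$, and when it has constant rank it is a Lie subalgebroid of the product Lie algebroid $TN\times\mathbf{L}$ with base $\mathrm{Graph}(\phi)$. An infinitesimal lagrangian morphism into $\mathbf{L}\subset\mathbb{T}_\eta M$ is a triple $(N,\phi,\sigma)$ with $\phi:N\to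 M$ smooth and $\sigma\in\Omega^2(N)$ such that $d\sigma=\phi^*\eta$ and $R_{\phi,\sigma}\cap(TN\times\mathbf{L})$ has constant rank. *)

(* Defs.v *)
From HB Require Import structures.
From mathcomp Require Import all_boot all_order all_algebra.
From mathcomp Require Import all_classical all_reals all_analysis.

Set Implicit Arguments.
Unset Strict Implicit.
Unset Printing Implicit Defensive.

Import Order.TTheory GRing.Theory Num.Theory numFieldNormedType.Exports.
Local Open Scope classical_set_scope.
Local Open Scope ring_scope.

Section LinearAlgebra.
Variable R : realType.

(* The dual of a linear subspace S of V: functionals defined on S, extended
   by 0 outside S so that equality of functionals is Leibniz equality. *)
Definition lin_dual (V : lmodType R) (S : set V) : set (V -> R) :=
  [set a | (forall (c : R) v w, S v -> S w -> a (c *: v + w) = c * a v + a w)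
           /\ (forall v, ~ S v -> a v = 0)].

Definition restr (V : lmodType R) (S : set V) (a : V -> R) : V -> R :=
  patch (fun=> 0) S a.

Definition has_dim (V : lmodType R) (S : set V) (k : nat) : Prop :=
  exists b : 'I_k -> V,
    (forall c : 'I_k -> R, \sum_i c i *: b i = 0 -> forall i, c i = 0) /\
    S = [set v | exists c : 'I_k -> R, v = \sum_i c i *: b i].

Definition constant_rank (T : Type) (V : lmodType R) (E : T -> set V) : Prop :=
  exists k, forall x, has_dim (E x) k.

(* Exactness of 0 -> A -f-> B -g-> C -h-> D -> 0, where A, B, C, D are linear
   subspaces of U, V, W, Z. *)
Definition exact5 (U V W Z : lmodType R)
    (A : set U) (B : set V) (C : set W) (D : set Z)
    (f : U -> V) (g : V -> W) (h : W -> Z) : Prop :=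
  [/\ [set u | A u /\ f u = 0] = [set 0],
      [set v | B v /\ g v = 0] = f @` A,
      [set w | C w /\ h w = 0] = g @` B
    & h @` C = D].

End LinearAlgebra.

Section Manifolds.
Variable R : realType.

Fixpoint Ck n (k : nat) (f : 'rV[R]_n -> R) (x : 'rV[R]_n) : Prop :=
  match k with
  | 0 => \forall y \near x, {for y, continuous f}
  | k'.+1 => (\forall y \near x, differentiable f y) /\
             (forall v, Ck k' (fun y => 'D_v f y) x)
  end.

(* f is C^infty on some neighbourhood of x (the same one for all orders). *)
Definition smooth_near n (f : 'rV[R]_n -> R) (x : 'rV[R]_n) : Prop :=
  \forall y \near x, forall k, Ck k f y.

Record chart (T : topologicalType) (n : nat) := Chart {
  cdom : set T;
  cmap : T -> 'rV[R]_n;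
  cinv : 'rV[R]_n -> T;
  cdom_open : open cdom;
  cim_open : open (cmap @` cdom);
  cmapK : forall x, cdom x -> cinv (cmap x) = x;
  cmap_cont : forall x, cdom x -> {for x, continuous cmap};
  cinv_cont : forall u, (cmap @` cdom) u -> {for u, continuous cinv}
}.

(* Not assumed to be Hausdorff or second countable: this is imposed where
   needed in lie_groupoid. *)
Record manifold := Manifold {
  carrier :> topologicalType;
  dim : nat;
  atlas : set (chart carrier dim);
  atlas_cover : forall x, exists2 c, atlas c & cdom c x;
  atlas_compat : forall c c' x, atlas c -> atlas c' -> cdom c x -> cdom c' x ->
    forall i, smooth_near (fun u => cmap c' (cinv c u) 0 i) (cmap c x)
}.

Definition smooth_at (M : manifold) (f : M -> R) (x : M) : Prop :=
  forall c, @atlas M c -> cdom c x -> smooth_near (f \o cinv c) (cmap c x).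

Definition smooth_map (M N : manifold) (f : M -> N) : Prop :=
  forall x, {for x, continuous f} /\
    forall c c', @atlas M c -> @atlas N c' -> cdom c x -> cdom c' (f x) ->
      forall i, smooth_near (fun u => cmap c' (f (cinv c u)) 0 i) (cmap c x).

(* Tangent vectors at x are derivations of the germs at x of smooth functions.
   A derivation is encoded as a functional on all functions M -> R which is
   zero on the functions that are not smooth near x; it follows from the
   Leibniz rule that it depends only on germs. *)
Definition vec (M : manifold) := (M -> R) -> R.
Definition covec (M : manifold) := vec M -> R.

Definition tangent (M : manifold) (x : M) : set (vec M) :=
  [set v | [/\ forall f, ~ smooth_at f x -> v f = 0,
     forall (c : R) f g, smooth_at f x -> smooth_at g x ->
       v (fun y => c * f y + g y) = c * v f + v g
   & forall f g, smooth_at f x -> smooth_at g x ->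
       v (fun y => f y * g y) = v f * g x + f x * v g]].

Definition cotangent (M : manifold) (x : M) : set (covec M) :=
  lin_dual (tangent x).

Definition Tmap (M N : manifold) (f : M -> N) (x : M) (v : vec M) : vec N :=
  fun h => if `[< smooth_at h (f x) >] then v (h \o f) else 0.

Definition cTmap (M N : manifold) (f : M -> N) (x : M) (a : covec N) : covec M :=
  restr (tangent x) (fun v => a (Tmap f x v)).

Definition submersion (M N : manifold) (f : M -> N) : Prop :=
  smooth_map f /\
  forall x w, tangent (f x) w -> exists2 v, tangent x v & Tmap f x v = w.

(* Smooth sections, defined near x, of f^*TN and of f^*(T^*N). *)
Definition smooth_along (M N : manifold) (f : M -> N) (X : M -> vec N) (x : M)
    : Prop :=
  \forall y \near x, tangent (f y) (X y) /\
    forall h, smooth_at h (f y) -> smooth_at (fun z => X z h) y.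

Definition smooth_vf (M : manifold) (X : M -> vec M) (x : M) : Prop :=
  smooth_along id X x.

Definition smooth_coalong (M N : manifold) (f : M -> N) (a : M -> covec N)
    (x : M) : Prop :=
  \forall y \near x, cotangent (f y) (a y) /\
    forall Z, smooth_vf Z (f y) -> smooth_at (fun z => a z (Z (f z))) y.

Definition lie (M : manifold) (X Y : M -> vec M) (x : M) : vec M :=
  fun f => if `[< smooth_at f x >]
           then X x (fun y => Y y f) - Y x (fun y => X y f) else 0.

(* Only the values of forms on tangent vectors are meaningful. *)
Definition form2 (M : manifold) := M -> vec M -> vec M -> R.
Definition form3 (M : manifold) := M -> vec M -> vec M -> vec M -> R.

Definition is_form2 (M : manifold) (w : form2 M) : Prop :=
  [/\ forall x (c : R) u u' v, tangent x u -> tangent x u' -> tangent x v ->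
        w x (c *: u + u') v = c * w x u v + w x u' v,
      forall x u v, tangent x u -> tangent x v -> w x u v = - w x v u
    & forall x X Y, smooth_vf X x -> smooth_vf Y x ->
        smooth_at (fun y => w y (X y) (Y y)) x].

Definition is_form3 (M : manifold) (e : form3 M) : Prop :=
  [/\ forall x (c : R) u u' v v', tangent x u -> tangent x u' ->
        tangent x v -> tangent x v' ->
        e x (c *: u + u') v v' = c * e x u v v' + e x u' v v',
      forall x u v v', tangent x u -> tangent x v -> tangent x v' ->
        e x u v v' = - e x v u v',
      forall x u v v', tangent x u -> tangent x v -> tangent x v' ->
        e x u v v' = - e x u v' v
    & forall x X Y Z, smooth_vf X x -> smooth_vf Y x -> smooth_vf Z x ->
        smooth_at (fun y => e y (X y) (Y y) (Z y)) x].

Definition pull2 (M N : manifold) (f : M -> N) (w : form2 N) : form2 M :=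
  fun x u v => w (f x) (Tmap f x u) (Tmap f x v).

Definition pull3 (M N : manifold) (f : M -> N) (e : form3 N) : form3 M :=
  fun x u v v' => e (f x) (Tmap f x u) (Tmap f x v) (Tmap f x v').

Definition eq2 (M : manifold) (w w' : form2 M) : Prop :=
  forall x u v, tangent x u -> tangent x v -> w x u v = w' x u v.

(* Exterior derivatives by the invariant formula, on vector fields. *)
Definition d1 (M : manifold) (a : M -> covec M) (X Y : M -> vec M) (x : M) : R :=
  X x (fun y => a y (Y y)) - Y x (fun y => a y (X y)) - a x (lie X Y x).

Definition d2 (M : manifold) (w : form2 M) (X Y Z : M -> vec M) (x : M) : R :=
  X x (fun y => w y (Y y) (Z y)) - Y x (fun y => w y (X y) (Z y))
  + Z x (fun y => w y (X y) (Y y))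
  - w x (lie X Y x) (Z x) + w x (lie X Z x) (Y x) - w x (lie Y Z x) (X x).

Definition d3 (M : manifold) (e : form3 M) (W X Y Z : M -> vec M) (x : M) : R :=
  W x (fun y => e y (X y) (Y y) (Z y)) - X x (fun y => e y (W y) (Y y) (Z y))
  + Y x (fun y => e y (W y) (X y) (Z y)) - Z x (fun y => e y (W y) (X y) (Y y))
  - e x (lie W X x) (Y x) (Z x) + e x (lie W Y x) (X x) (Z x)
  - e x (lie W Z x) (X x) (Y x) - e x (lie X Y x) (W x) (Z x)
  + e x (lie X Z x) (W x) (Y x) - e x (lie Y Z x) (W x) (X x).

Definition is_d2 (M : manifold) (w : form2 M) (e : form3 M) : Prop :=
  forall x X Y Z, smooth_vf X x -> smooth_vf Y x -> smooth_vf Z x ->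
    d2 w X Y Z x = e x (X x) (Y x) (Z x).

Definition closed3 (M : manifold) (e : form3 M) : Prop :=
  forall x W X Y Z,
    smooth_vf W x -> smooth_vf X x -> smooth_vf Y x -> smooth_vf Z x ->
    d3 e W X Y Z x = 0.

(* The 1-form i_Y w at x. *)
Definition flat (M : manifold) (w : form2 M) (x : M) (Y : vec M) : covec M :=
  restr (tangent x) (w x Y).

(* (L_X b)(Z) *)
Definition lieD1 (M : manifold) (X : M -> vec M) (b : M -> covec M)
    (Z : M -> vec M) (x : M) : R :=
  X x (fun y => b y (Z y)) - b x (lie X Z x).

(* e is the value at x of the bracket [X, Y] + L_X b - i_Y da + i_Y i_X eta of
   the sections e1 = X + a and e2 = Y + b of TM + T^*M. *)
Definition courant_bracket (M : manifold) (eta : form3 M)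
    (e1 e2 : M -> vec M * covec M) (x : M) (e : vec M * covec M) : Prop :=
  let X y := (e1 y).1 in let a y := (e1 y).2 in
  let Y y := (e2 y).1 in let b y := (e2 y).2 in
  [/\ e.1 = lie X Y x, cotangent x e.2
    & forall Z, smooth_vf Z x ->
        e.2 (Z x) = lieD1 X b Z x - d1 a Y Z x + eta x (X x) (Y x) (Z x)].

End Manifolds.

Section SimplyConnected.
Variables (R : realType) (T : topologicalType).

Definition path_in (S : set T) (g : R -> T) : Prop :=
  {within `[0, 1]%classic, continuous g} /\
  (forall r, `[0, 1]%classic r -> S (g r)).

Definition simply_connected (S : set T) : Prop :=
  [/\ S !=set0,
      forall a b, S a -> S b -> exists g, [/\ path_in S g, g 0 = a & g 1 = b]
    & forall g a, path_in S g -> g 0 = a -> g 1 = a ->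
      exists h : R * R -> T,
        [/\ {within `[0, 1]%classic `*` `[0, 1]%classic, continuous h},
            forall p, (`[0, 1]%classic `*` `[0, 1]%classic) p -> S (h p),
            forall r, `[0, 1]%classic r -> h (0, r) = g r /\ h (1, r) = a
          & forall r, `[0, 1]%classic r -> h (r, 0) = a /\ h (r, 1) = a]].

End SimplyConnected.

Section Groupoids.
Variable R : realType.

(* P, with p1 and p2, is the fibre product of f and g in the category of
   manifolds. *)
Definition is_fibre_product (A B M P : manifold R) (f : A -> M) (g : B -> M)
    (p1 : P -> A) (p2 : P -> B) : Prop :=
  [/\ smooth_map p1, smooth_map p2, (forall z, f (p1 z) = g (p2 z))
    & forall (Q : manifold R) (q1 : Q -> A) (q2 : Q -> B),
        smooth_map q1 -> smooth_map q2 -> (forall z, f (q1 z) = g (q2 z)) ->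
        exists! r : Q -> P,
          [/\ smooth_map r, (forall z, p1 (r z) = q1 z)
            & forall z, p2 (r z) = q2 z]].

(* Lie groupoids with base M. As is customary, the manifold of arrows is not
   required to be Hausdorff. pairs is the manifold of composable pairs, with
   its projections; mul g h is meaningful only if src g = tgt h. *)
Record lie_groupoid (M : manifold R) := LieGroupoid {
  arr :> manifold R;
  pairs : manifold R;
  src : arr -> M;
  tgt : arr -> M;
  unit : M -> arr;
  inv : arr -> arr;
  mul : arr -> arr -> arr;
  pr1 : pairs -> arr;
  pr2 : pairs -> arr;
  base_hausdorff : hausdorff_space M;
  base_countable : @second_countable M;
  arr_countable : @second_countable arr;
  src_submersion : submersion src;
  tgt_submersion : submersion tgt;
  unit_smooth : smooth_map unit;
  inv_smooth : smooth_map inv;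
  pairs_fibre_product : is_fibre_product src tgt pr1 pr2;
  mul_smooth : smooth_map (fun z => mul (pr1 z) (pr2 z));
  src_unit : forall x, src (unit x) = x;
  tgt_unit : forall x, tgt (unit x) = x;
  src_mul : forall g h, src g = tgt h -> src (mul g h) = src h;
  tgt_mul : forall g h, src g = tgt h -> tgt (mul g h) = tgt g;
  mulA : forall g h k, src g = tgt h -> src h = tgt k ->
    mul g (mul h k) = mul (mul g h) k;
  mul_unitl : forall g, mul (unit (tgt g)) g = g;
  mul_unitr : forall g, mul g (unit (src g)) = g;
  src_inv : forall g, src (inv g) = tgt g;
  tgt_inv : forall g, tgt (inv g) = src g;
  mulgV : forall g, mul g (inv g) = unit (tgt g);
  mulVg : forall g, mul (inv g) g = unit (src g)
}.

Section OneGroupoid.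
Variables (M : manifold R) (G : lie_groupoid M).

Definition mult (z : pairs G) : arr G := mul (pr1 z) (pr2 z).

Definition algd (x : M) : set (vec G) :=
  [set u | tangent (unit G x) u /\ Tmap (@src _ G) (unit G x) u = 0].

Definition anchor (x : M) (u : vec G) : vec M :=
  Tmap (@tgt _ G) (unit G x) u.

Definition algd_section (w : M -> vec G) (x : M) : Prop :=
  (\forall y \near x, algd y (w y)) /\ smooth_along (unit G) w x.

(* Near the unit at x, W is the right-invariant vector field extending w:
   W_g = Tm(w_{t(g)}, 0_g). *)
Definition right_inv_ext (w : M -> vec G) (W : G -> vec G) (x : M) : Prop :=
  smooth_vf W (unit G x) /\
  \forall g \near unit G x, exists (z : pairs G) (V : vec (pairs G)),
    [/\ pr1 z = unit G (tgt g) /\ pr2 z = g, tangent z V,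
        Tmap (@pr1 _ G) z V = w (tgt g), Tmap (@pr2 _ G) z V = 0
      & W g = Tmap mult z V].

Definition algd_bracket (w w' : M -> vec G) (x : M) (r : vec G) : Prop :=
  exists W W' : G -> vec G,
    [/\ right_inv_ext w W x, right_inv_ext w' W' x
      & r = lie W W' (unit G x)].

Definition source_simply_connected : Prop :=
  forall x : M, simply_connected R [set g : G | src g = x].

Definition shifted_symplectic1 (omega : form2 G) (eta : form3 M) : Prop :=
  [/\ is_form2 omega /\ is_form3 eta,
      eq2 (pull2 mult omega)
          (fun z u v => pull2 (@pr1 _ G) omega z u v
                        + pull2 (@pr2 _ G) omega z u v),
      is_d2 omega (fun g u v w => pull3 (@src _ G) eta g u v w
                                  - pull3 (@tgt _ G) eta g u v w) /\
      closed3 eta,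
      dim G = (2 * dim M)%N
    & forall (x : M) (u : vec G), tangent (unit G x) u ->
        Tmap (@src _ G) (unit G x) u = 0 ->
        (forall v, tangent (unit G x) v -> omega (unit G x) u v = 0) ->
        Tmap (@tgt _ G) (unit G x) u = 0 -> u = 0].

Definition lambda (omega : form2 G) (x : M) (u : vec G) : covec M :=
  restr (tangent x) (fun X => omega (unit G x) u (Tmap (unit G) x X)).

Definition groupoid_dirac (omega : form2 G) (x : M) : set (vec M * covec M) :=
  [set (anchor x u, lambda omega x u) | u in algd x].

End OneGroupoid.

Definition groupoid_morphism (N M : manifold R) (H : lie_groupoid N)
    (G : lie_groupoid M) (Phi : H -> G) (phi : N -> M) : Prop :=
  [/\ smooth_map Phi /\ smooth_map phi,
      forall h, src (Phi h) = phi (src h),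
      forall h, tgt (Phi h) = phi (tgt h),
      forall y, Phi (unit H y) = unit G (phi y)
    & forall h k, src h = tgt k -> Phi (mul h k) = mul (Phi h) (Phi k)].

Definition isotropic_morphism (M : manifold R) (G : lie_groupoid M)
    (omega : form2 G) (eta : form3 M) (N : manifold R) (H : lie_groupoid N)
    (Phi : H -> G) (phi : N -> M) (sigma : form2 N) : Prop :=
  [/\ groupoid_morphism Phi phi, is_form2 sigma,
      eq2 (fun h u v => pull2 (@src _ H) sigma h u v
                        - pull2 (@tgt _ H) sigma h u v)
          (pull2 Phi omega)
    & is_d2 sigma (pull3 phi eta)].

Definition lagrangian_morphism (M : manifold R) (G : lie_groupoid M)
    (omega : form2 G) (eta : form3 M) (N : manifold R) (H : lie_groupoid N)
    (Phi : H -> G) (phi : N -> M) (sigma : form2 N) : Prop :=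
  isotropic_morphism omega eta Phi phi sigma /\
  forall x : N,
    exact5 (@algd _ H x) (tangent x `*` @algd _ G (phi x))
           (tangent (phi x) `*` cotangent x) (lin_dual (@algd _ H x))
      (fun w => (anchor x w, Tmap Phi (unit H x) w))
      (fun p : vec N * vec G =>
         (Tmap phi x p.1 - anchor (phi x) p.2,
          flat sigma x p.1 + cTmap phi x (lambda omega (phi x) p.2)))
      (fun p : vec M * covec N =>
         restr (@algd _ H x) (fun w =>
           - lambda omega (phi x) (Tmap Phi (unit H x) w) p.1
           + p.2 (anchor x w))).

(* The fibres of TN + T^*N + phi^*(TM + T^*M) are subspaces of this space. *)
Definition bivec (N M : manifold R) : Type :=
  ((vec N * covec N) * (vec M * covec M))%type.

Definition relR (N M : manifold R) (phi : N -> M) (sigma : form2 N) (x : N)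
    : set (bivec N M) :=
  [set p | [/\ tangent x p.1.1, p.2.1 = Tmap phi x p.1.1,
               cotangent (phi x) p.2.2
             & p.1.2 = cTmap phi x p.2.2 + flat sigma x p.1.1]].

Definition TNxL (N M : manifold R) (phi : N -> M)
    (L : M -> set (vec M * covec M)) (x : N)
    : set (bivec N M) :=
  [set p | [/\ tangent x p.1.1, p.1.2 = 0 & L (phi x) p.2]].

Definition infalgd (N M : manifold R) (L : M -> set (vec M * covec M))
    (phi : N -> M) (sigma : form2 N) (x : N)
    : set (bivec N M) :=
  relR phi sigma x `&` TNxL phi L x.

Definition inf_lagrangian_morphism (M : manifold R) (eta : form3 M)
    (L : M -> set (vec M * covec M)) (N : manifold R)
    (phi : N -> M) (sigma : form2 N) : Prop :=
  [/\ smooth_map phi, is_form2 sigma, is_d2 sigma (pull3 phi eta)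
    & constant_rank (infalgd L phi sigma)].

(* e : N -> phi^*(TM + T^*M) equals sum_i f_i phi^*(l_i) near x, where the
   l_i are sections of L. *)
Definition decomposition (N M : manifold R) (phi : N -> M)
    (L : M -> set (vec M * covec M)) (e : N -> vec M * covec M) (x : N)
    (k : nat) (f : 'I_k -> N -> R) (l : 'I_k -> M -> vec M * covec M) : Prop :=
  [/\ forall i, smooth_at (f i) x,
      forall i, \forall y \near phi x, L y (l i y),
      forall i, smooth_vf (fun y => (l i y).1) (phi x) /\
                smooth_coalong id (fun y => (l i y).2) (phi x)
    & \forall y \near x, e y = \sum_i f i y *: l i (phi y)].

(* The bracket of the product Lie algebroid TN x L at (x, phi x), on sections
   over Graph(phi) of the form e = ((Y, 0), sum_i f_i phi^*(l_i)) which are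
   tangent to Graph(phi). It is the bracket of the extensions
   (pr_N^*Y, sum_i pr_N^*f_i pr_M^*l_i) over N x M, expanded by the Leibniz rule
   from [(pr_N^*Y, pr_M^*l), (pr_N^*Y', pr_M^*l')]
   = (pr_N^*[Y, Y'], pr_M^*[l, l']). *)
Definition graph_bracket (N M : manifold R) (eta : form3 M)
    (L : M -> set (vec M * covec M)) (phi : N -> M)
    (e e' : N -> bivec N M) (x : N)
    (r : bivec N M) : Prop :=
  let Y y := (e y).1.1 in let Y' y := (e' y).1.1 in
  exists (k k' : nat)
    (f : 'I_k -> N -> R) (l : 'I_k -> M -> vec M * covec M)
    (f' : 'I_k' -> N -> R) (l' : 'I_k' -> M -> vec M * covec M)
    (b : 'I_k -> 'I_k' -> vec M * covec M),
  [/\ decomposition phi L (fun y => (e y).2) x f l,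
      decomposition phi L (fun y => (e' y).2) x f' l',
      forall i j, courant_bracket eta (l i) (l' j) (phi x) (b i j)
    & r = ((lie Y Y' x, 0),
           \sum_i \sum_j (f i x * f' j x) *: b i j
           + \sum_j Y x (f' j) *: l' j (phi x)
           - \sum_i Y' x (f i) *: l i (phi x))].

(* psi is an isomorphism of Lie algebroids over N from the Lie algebroid of H
   onto the intersection of R_{phi,sigma} and TN x L, identified with a bundle
   over N by Graph(phi) = N; in particular its anchor is ((Y, 0), l) |-> Y. *)
Definition integrates (M : manifold R) (eta : form3 M)
    (L : M -> set (vec M * covec M)) (N : manifold R) (phi : N -> M)
    (sigma : form2 N) (H : lie_groupoid N)
    (psi : N -> vec H -> bivec N M) : Prop :=
  [/\ forall x, set_bij (@algd _ H x) (infalgd L phi sigma x) (psi x),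
      forall x (c : R) w w', @algd _ H x w -> @algd _ H x w' ->
        psi x (c *: w + w') = c *: psi x w + psi x w',
      forall x w, algd_section w x ->
        [/\ smooth_vf (fun y => (psi y (w y)).1.1) x,
            smooth_along phi (fun y => (psi y (w y)).2.1) x
          & smooth_coalong phi (fun y => (psi y (w y)).2.2) x],
      forall x w, @algd _ H x w -> (psi x w).1.1 = anchor x w
    & forall x w w' r, algd_section w x -> algd_section w' x ->
        algd_bracket w w' x r ->
        graph_bracket eta L phi (fun y => psi y (w y)) (fun y => psi y (w' y))
          x (psi x r)].

(* Phi integrates the Lie algebroid morphism A_H = R /\ (TN x L) -> L, the
   projection, where A_G and L are identified by (anchor, lambda). *)
Definition integrates_projection (M : manifold R) (G : lie_groupoid M)
    (omega : form2 G) (N : manifold R) (H : lie_groupoid N)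
    (psi : N -> vec H -> bivec N M)
    (Phi : H -> G) (phi : N -> M) : Prop :=
  groupoid_morphism Phi phi /\
  forall x w, @algd _ H x w ->
    let u := Tmap Phi (unit H x) w in
    (anchor (phi x) u, lambda omega (phi x) u) = (psi x w).2.

End Groupoids.

(* Main.v *)
(* In (b) the point is that Om = Phi^*omega - s^*sigma + t^*sigma vanishes. Om is
   multiplicative and closed, and Om(w, .) = 0 for w in A_H at a unit, because A_H
   is identified with the intersection of R_{phi,sigma} and TN x L. Multiplicativity
   carries this to every vector tangent to an s-fibre. In coordinates in which s is
   linear, closedness then says that the coefficients of Om are constant along the
   s-fibres, which are connected and meet the units, where Om = 0. This needs no
   flows, only the inverse function theorem.
   For the exact sequence, the first map f is injective and its image is the kernel
   of the second one by the identification of A_H; the third map is up to sign the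
   transpose of the injection w |-> (lambda(Phi w), a(w)), hence onto; and exactness
   at the remaining place follows from dim A_G = dim M by counting dimensions.
   In (a), f and the injectivity of (a_G, lambda) identify A_H with the
   intersection, whose rank is therefore dim H - dim N.
   Tangent vectors being derivations, the finite dimension of tangent spaces rests
   on Hadamard's lemma. *)
From HB Require Import structures.
From mathcomp Require Import all_boot all_order all_algebra.
From mathcomp Require Import all_classical all_reals all_analysis.
From mathcomp Require Import ring lra.
Require Import Defs.

Set Implicit Arguments.
Unset Strict Implicit.
Unset Printing Implicit Defensive.

Import Order.TTheory GRing.Theory Num.Theory numFieldNormedType.Exports.
Local Open Scope classical_set_scope.
Local Open Scope ring_scope.

(** Two features of the setting shape the argument. The manifold of composable pairs is known only
    through its universal property, so multiplicativity is used for two smooth maps a and b from one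
    manifold with s a = t b. Each tangent vector of H to which it is applied must then come from
    maps defined on a whole manifold; R^p is enough. And exterior derivatives are given on vector
    fields, which do not restrict well along maps; they are replaced by derivatives of P^*Om on
    constant vectors, for smooth maps P from R^p to H. For constant u, v, h closedness reads D_h
    Om(u, v) = D_u Om(h, v) - D_v Om(h, u). If h is tangent to the s-fibres, the right side is 0,
    because Om(h, .) vanishes at all nearby points and not only at one. At a unit, Om(w, v) is the
    value on Tt(v) of T^*phi(lambda(Phi w)) + i_{a(w)} sigma, which is the covector that has to be 0
    for an element of R_{phi,sigma} to lie in TN x L. The same equation, with the isotropy of L,
    makes consecutive maps of the sequence compose to 0. *)

Local Notation "''e_' i" := (delta_mx 0 i) (at level 8, i at level 2).

(** * Smooth functions on open sets of R^n *)

Section Calculus.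
Variable R : realType.
Implicit Types (n p k : nat).

Lemma derive_coord_sum n (f : 'rV[R]_n -> R) x v :
  differentiable f x -> 'D_v f x = \sum_i v 0 i * 'D_'e_i f x.
Proof.
move=> df; rewrite deriveE// {1}(row_sum_delta v) linear_sum.
by apply: eq_bigr => i _; rewrite linearZ deriveE.
Qed.

Lemma differentiable_row (V : normedModType R) n (G : V -> 'rV[R]_n) x :
  (forall i, differentiable (fun y => G y 0 i : R) x) -> differentiable G x.
Proof.
move=> dG.
have -> : G = \sum_i (fun y => G y 0 i *: 'e_i).
  by apply/funext => y; rewrite fct_sumE {1}(row_sum_delta (G y)).
by apply: differentiable_sum => i; exact: differentiableZl.
Qed.

Lemma derive_row (V : normedModType R) n (G : V -> 'rV[R]_n) x v i :
  differentiable G x -> ('D_v G x) 0 i = 'D_v (fun y => G y 0 i : R) x.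
Proof.
move=> dG.
have @c : {linear 'rV[R]_n -> R}.
  by exists (fun N : 'rV[R]_n => N 0 i); do 2![eexists]; do ?[constructor];
     rewrite ?mxE// => ? *; rewrite ?mxE//; move=> ?; rewrite !mxE.
have cc : continuous c by exact: coord_continuous.
rewrite (_ : (fun y => _) = c \o G)//.
have dc : differentiable c (G x) by exact: linear_differentiable.
rewrite [RHS]deriveE; last exact: differentiable_comp.
by rewrite diff_comp// [in RHS]/comp (diff_lin _ cc) deriveE.
Qed.

Lemma derive_comp_row (V : normedModType R) n (f : 'rV[R]_n -> R)
    (G : V -> 'rV[R]_n) x v :
  (forall i, differentiable (fun y => G y 0 i : R) x) ->
  differentiable f (G x) ->
  'D_v (f \o G) x = 'D_('D_v G x) f (G x).
Proof.
move=> dGi df; have dG := differentiable_row dGi.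
by rewrite (deriveE _ df) (deriveE _ (differentiable_comp dG df)) diff_comp// (deriveE _ dG).
Qed.

Lemma derive_comp_row_sum (V : normedModType R) n (f : 'rV[R]_n -> R)
    (G : V -> 'rV[R]_n) x v :
  (forall i, differentiable (fun y => G y 0 i : R) x) ->
  differentiable f (G x) ->
  'D_v (f \o G) x = \sum_i 'D_v (fun y => G y 0 i : R) x * 'D_'e_i f (G x).
Proof.
move=> dGi df; rewrite derive_comp_row// derive_coord_sum//.
by apply: eq_bigr => i _; rewrite derive_row//; exact: differentiable_row.
Qed.

(** The differential of f satisfies the expansion that characterizes a differential of g, and
    differentials are unique. Differentiability thus becomes a property of germs, as needed for
    functions that are only locally given by a formula. *)
Lemma near_eq_differentiable (V W : normedModType R) (f g : V -> W) x :
  (\near x, f x = g x) -> differentiable f x -> differentiable g x.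
Proof.
move=> fg df.
have cd := diff_continuous df.
have fgx : f x = g x := nbhs_singleton fg.
have key : g \o shift x = cst (g x) + 'd f x +o_ (0 : V) id.
  apply/eqaddoP => _/posnumP[e].
  have := diff_locally df => /eqaddoP/(_ e%:num (gt0 e)) H.
  have fg' : \forall y \near 0, f (y + x) = g (y + x).
    have : \forall y \near 0, (fun z => f z = g z) (y + (x - 0)).
      by rewrite -(near_shift 0 x (fun z => f z = g z)).
    by apply: filterS => y; rewrite subr0.
  near=> y; have <- : ((f \o shift x) - (cst (f x) + 'd f x)) y =
          ((g \o shift x) - (cst (g x) + 'd f x)) y.
    rewrite /= ![in LHS]fctE ![in RHS]fctE /= -fgx; congr (_ - _).
    by near: y.
  by near: y.
apply/diff_locallyP.
have -> // : 'd g x = 'd f x :> (V -> W).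
exact: diff_unique.
Unshelve. all: by end_near. Qed.

Lemma Ck0P n (f : 'rV[R]_n -> R) x :
  Ck 0 f x <-> \forall y \near x, {for y, continuous f}.
Proof. by []. Qed.

Lemma CkSP n k (f : 'rV[R]_n -> R) x :
  Ck k.+1 f x <->
  (\forall y \near x, differentiable f y) /\ forall v, Ck k ('D_v f) x.
Proof. by []. Qed.

Lemma Ck_continuous n k (f : 'rV[R]_n -> R) x : Ck k f x -> {for x, continuous f}.
Proof.
case: k => [|k] /=; first exact: nbhs_singleton.
by case=> /nbhs_singleton /differentiable_continuous.
Qed.

Lemma near_forall (T : topologicalType) (x : T) (I : finType) (P : I -> T -> Prop) :
  (forall i, \forall y \near x, P i y) -> \forall y \near x, forall i, P i y.
Proof. exact: filter_forall. Qed.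

Lemma near_eq_continuous (T U : topologicalType) (f g : T -> U) (x : T) :
  (\near x, f x = g x) -> {for x, continuous f} -> {for x, continuous g}.
Proof.
move=> fg cf; rewrite /prop_for /continuous_at -(nbhs_singleton fg).
apply: (cvg_trans _ cf); apply: near_eq_cvg.
by apply: filterS fg => y ->.
Qed.

(** [near_join] spreads the equality to a neighbourhood of each nearby point, so that it survives
    differentiation and the induction goes through. *)
Lemma Ck_near_eq n k (f g : 'rV[R]_n -> R) x :
  (\near x, f x = g x) -> Ck k f x -> Ck k g x.
Proof.
elim: k f g => [|k IH] f g fg /=; have fg2 := near_join fg.
  by move: fg2; apply: filterS2 => y; exact: near_eq_continuous.
case=> df Df; split.
  by move: df fg2; apply: filterS2 => y df fg2; exact: near_eq_differentiable df.
by move=> v; apply: IH (Df v); move: fg2; apply: filterS => y; exact: near_eq_derive.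
Qed.

Lemma CkS n k (f : 'rV[R]_n -> R) x : Ck k.+1 f x -> Ck k f x.
Proof.
elim: k f => [|k IH] f.
  by move=> /CkSP[df _]; apply/Ck0P; move: df; apply: filterS => y /differentiable_continuous.
by move=> /CkSP[df Df]; apply/CkSP; split=> // v; apply: IH; exact: Df.
Qed.

Lemma Ck_cst n k (c : R) (x : 'rV[R]_n) : Ck k (fun=> c) x.
Proof.
elim: k c => [|k IH] c; first by apply/Ck0P; apply: filterE => y; exact: cst_continuous.
apply/CkSP; split; first by apply: filterE => y; exact: differentiable_cst.
move=> v; have -> : ('D_v (fun=> c) : 'rV[R]_n -> R) = (fun=> 0); last exact: IH.
by apply/funext => y; rewrite derive_cst.
Qed.

Lemma CkD n k (f g : 'rV[R]_n -> R) x :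
  Ck k f x -> Ck k g x -> Ck k (fun y => f y + g y) x.
Proof.
elim: k f g => [|k IH] f g.
  move=> /Ck0P Hf /Ck0P Hg; apply/Ck0P; move: Hf Hg.
  by     apply: filterS2 => y cf cg; exact: (continuousD cf cg).
move=> /CkSP[df Df] /CkSP[dg Dg]; apply/CkSP; split.
  by move: df dg; apply: filterS2 => y df dg; exact: differentiableD.
move=> v; apply: Ck_near_eq (IH _ _ (Df v) (Dg v)).
move: df dg; apply: filterS2 => y df dg.
by rewrite [RHS]deriveD//; exact: diff_derivable.
Qed.

Lemma CkM n k (f g : 'rV[R]_n -> R) x :
  Ck k f x -> Ck k g x -> Ck k (fun y => f y * g y) x.
Proof.
elim: k f g => [|k IH] f g.
  move=> /Ck0P Hf /Ck0P Hg; apply/Ck0P; move: Hf Hg.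
  by apply: filterS2 => y cf cg; exact: (continuousM cf cg).
move=> Hf Hg; have /CkSP[df Df] := Hf; have /CkSP[dg Dg] := Hg; apply/CkSP; split.
  by move: df dg; apply: filterS2 => y df dg; exact: differentiableM.
move=> v.
have /= := CkD (IH _ _ (CkS Hf) (Dg v)) (IH _ _ (CkS Hg) (Df v)).
apply: Ck_near_eq.
move: df dg; apply: filterS2 => y df dg.
by rewrite [RHS]deriveM//; exact: diff_derivable.
Qed.

Lemma Ck_sum n k (I : Type) (r : seq I) (P : pred I) (f : I -> 'rV[R]_n -> R) x :
  (forall i, P i -> Ck k (f i) x) -> Ck k (fun y => \sum_(i <- r | P i) f i y) x.
Proof.
move=> H; elim: r => [|i r IH].
  by rewrite (_ : (fun y => _) = fun=> 0) ?funeqE; [exact: Ck_cst|move=> y; rewrite big_nil].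
case Pi : (P i).
  rewrite (_ : (fun y => _) = fun y => f i y + \sum_(j <- r | P j) f j y) ?funeqE; last first.
    by move=> y; rewrite big_cons Pi.
  by apply: CkD => //; exact: H.
by under eq_fun do rewrite big_cons Pi.
Qed.

Lemma Ck_prod n k (I : Type) (r : seq I) (P : pred I) (f : I -> 'rV[R]_n -> R) x :
  (forall i, P i -> Ck k (f i) x) -> Ck k (fun y => \prod_(i <- r | P i) f i y) x.
Proof.
move=> H; elim: r => [|i r IH].
  by rewrite (_ : (fun y => _) = fun=> 1) ?funeqE; [exact: Ck_cst|move=> y; rewrite big_nil].
case Pi : (P i).
  rewrite (_ : (fun y => _) = fun y => f i y * \prod_(j <- r | P j) f j y) ?funeqE; last first.
    by move=> y; rewrite big_cons Pi.
  by apply: CkM => //; exact: H.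
by under eq_fun do rewrite big_cons Pi.
Qed.

Lemma Ck_coord n k (x : 'rV[R]_n) i : Ck k (fun y : 'rV[R]_n => y 0 i) x.
Proof.
case: k => [|k]; first by apply/Ck0P; apply: filterE => y; exact: coord_continuous.
apply/CkSP; split; first by apply: filterE => y; exact: differentiable_coord.
move=> v; have -> : 'D_v (fun y : 'rV[R]_n => y 0 i) = fun=> v 0 i; last exact: Ck_cst.
apply/funext => y.
by rewrite -(derive_row (G := id)) ?derive_id//.
Qed.

Lemma CkV n k (f : 'rV[R]_n -> R) x : f x != 0 ->
  Ck k f x -> Ck k (fun y => (f y)^-1) x.
Proof.
elim: k f => [|k IH] f fx0 Hf.
  have fn0 : \forall y \near x, f y != 0.
    exact: (Ck_continuous Hf) (open_nbhs_nbhs (conj (@open_neq _ 0) fx0)).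
  by apply/Ck0P; move: Hf fn0 => /Ck0P; apply: filterS2 => y cf fy; exact: continuousV.
have fn0 : \forall y \near x, f y != 0.
  exact: (Ck_continuous Hf) (open_nbhs_nbhs (conj (@open_neq _ 0) fx0)).
have /CkSP[df Df] := Hf; apply/CkSP; split.
  by move: df fn0; apply: filterS2 => y df fy; exact: differentiableV.
move=> v; have IHf := IH _ fx0 (CkS Hf).
have := CkM (Ck_cst k (-1) x) (CkM (Df v) (CkM IHf IHf)).
apply: Ck_near_eq; move: df fn0; apply: filterS2 => y df fy.
rewrite [RHS]deriveV//; last exact: diff_derivable.
by rewrite /GRing.scale/= expr2 invfM; ring.
Qed.

Lemma continuous_row (T : topologicalType) n (G : T -> 'rV[R]_n) y :
  (forall i, {for y, continuous (fun z => G z 0 i)}) -> {for y, continuous G}.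
Proof.
move=> HGy; apply/cvgrPdist_lt => e e0.
have : \forall z \near y, forall i, `|G y 0 i - G z 0 i| < e.
  by apply: filter_forall => i; have /cvgrPdist_lt/(_ e e0) := HGy i; exact.
apply: filterS => z Hz.
rewrite /Num.norm/= mx_normrE; apply/bigmax_ltP; split=> // -[i j] _ /=.
by rewrite !mxE (ord1 i); exact: Hz.
Qed.

(** Induction on k, for all f at once: by the chain rule a derivative of f \o G is a sum of products
    of derivatives of the coordinates of G with ['D_'e_i f \o G], to which the induction hypothesis
    applies. *)
Lemma Ck_comp n p k (f : 'rV[R]_n -> R) (G : 'rV[R]_p -> 'rV[R]_n) x :
  (forall i, Ck k (fun y => G y 0 i) x) -> Ck k f (G x) -> Ck k (f \o G) x.
Proof.
have contG k' y : (forall i, Ck k' (fun y => G y 0 i) y) -> {for y, continuous G}.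
  by move=> H; apply: continuous_row => i; exact: (Ck_continuous (H i)).
elim: k f => [|k IH] f HG Hf.
  have HGn : \forall y \near x, forall i, {for y, continuous (fun y => G y 0 i)}.
    by apply: near_forall => i; have /Ck0P := HG i.
  have Gf : \forall y \near x, {for (G y), continuous f} := contG 0%N x HG _ Hf.
  apply/Ck0P; move: HGn Gf; apply: filterS2 => y HGy fy.
  apply: (@continuous_comp _ _ _ G f) => //.
  by apply: continuous_row => i; exact: HGy.
have dGn : \forall y \near x, forall i, differentiable (fun y => G y 0 i : R) y.
  by apply: near_forall => i; have /CkSP[] := HG i.
have /CkSP[df Df] := Hf.
have Gf : \forall y \near x, differentiable f (G y) := contG k.+1 x HG _ df.
apply/CkSP; split.
  move: dGn Gf; apply: filterS2 => y dG df'.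
  by apply: differentiable_comp => //; exact: differentiable_row.
move=> v.
have : Ck k (fun y => \sum_i 'D_v (fun y => G y 0 i : R) y * 'D_'e_i f (G y)) x.
  apply: Ck_sum => i _; apply: CkM; first by have /CkSP[_] := HG i; exact.
  by apply: (IH ('D_'e_i f)); [move=> j; exact: CkS|exact: Df].
apply: Ck_near_eq; move: dGn Gf; apply: filterS2 => y dG df'.
by rewrite derive_comp_row_sum.
Qed.

Lemma Ck_det n m k (A : 'rV[R]_n -> 'M[R]_m) x :
  (forall i j, Ck k (fun y => A y i j) x) -> Ck k (fun y => \det (A y)) x.
Proof.
move=> H; apply: Ck_sum => s _; apply: CkM; first exact: Ck_cst.
by apply: Ck_prod => i _; exact: H.
Qed.

(** Cramer's formula: near x, [invmx] is the adjugate divided by the determinant, a rational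
    expression in the entries. *)
Lemma Ck_invmx n m k (A : 'rV[R]_n -> 'M[R]_m) x :
  A x \in unitmx ->
  (forall i j, Ck k (fun y => A y i j) x) ->
  forall i j, Ck k (fun y => invmx (A y) i j) x.
Proof.
rewrite unitmxE unitfE => detx H i j.
have Hd := Ck_det H.
have dn : \forall y \near x, \det (A y) != 0.
  exact: (Ck_continuous Hd) (open_nbhs_nbhs (conj (@open_neq _ 0) detx)).
have : Ck k (fun y => (\det (A y))^-1 * \adj (A y) i j) x.
  apply: CkM; first exact: CkV.
  under eq_fun do rewrite mxE /cofactor.
  apply: CkM; first exact: Ck_cst.
  by apply: Ck_det => a b; under eq_fun do rewrite !mxE; exact: H.
apply: Ck_near_eq; move: dn; apply: filterS => y dy.
by rewrite /invmx unitmxE unitfE dy !mxE.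
Qed.

End Calculus.

(** * Germs of smooth functions and symmetry of second derivatives *)

Section SmoothNear.
Variable R : realType.
Implicit Types (n p k : nat).

Lemma smooth_near_nbhs n (f : 'rV[R]_n -> R) x :
  smooth_near f x -> \forall y \near x, smooth_near f y.
Proof. exact: near_join. Qed.

Lemma smooth_near_Ck n k (f : 'rV[R]_n -> R) x : smooth_near f x -> Ck k f x.
Proof. by move=> /nbhs_singleton; exact. Qed.

Lemma smooth_near_differentiable n (f : 'rV[R]_n -> R) x :
  smooth_near f x -> differentiable f x.
Proof. by move=> /(smooth_near_Ck 1) [/nbhs_singleton]. Qed.

Lemma smooth_near_continuous n (f : 'rV[R]_n -> R) x :
  smooth_near f x -> {for x, continuous f}.
Proof. by move=> /(smooth_near_Ck 0) /nbhs_singleton. Qed.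

Lemma smooth_near_eq n (f g : 'rV[R]_n -> R) x :
  (\near x, f x = g x) -> smooth_near f x -> smooth_near g x.
Proof.
move=> /near_join; apply: filterS2 => y fg H k.
exact: Ck_near_eq (H k).
Qed.

Lemma smooth_near_cst n (c : R) (x : 'rV[R]_n) : smooth_near (fun=> c) x.
Proof. by apply: filterE => y k; exact: Ck_cst. Qed.

Lemma smooth_near_coord n (x : 'rV[R]_n) i :
  smooth_near (fun y : 'rV[R]_n => y 0 i) x.
Proof. by apply: filterE => y k; exact: Ck_coord. Qed.

Lemma smooth_nearD n (f g : 'rV[R]_n -> R) x :
  smooth_near f x -> smooth_near g x -> smooth_near (fun y => f y + g y) x.
Proof. by apply: filterS2 => y Hf Hg k; exact: CkD. Qed.

Lemma smooth_nearM n (f g : 'rV[R]_n -> R) x :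
  smooth_near f x -> smooth_near g x -> smooth_near (fun y => f y * g y) x.
Proof. by apply: filterS2 => y Hf Hg k; exact: CkM. Qed.

Lemma smooth_nearV n (f : 'rV[R]_n -> R) x : f x != 0 ->
  smooth_near f x -> smooth_near (fun y => (f y)^-1) x.
Proof.
move=> fx0 Hf.
have : \forall y \near x, f y != 0.
  exact: (smooth_near_continuous Hf) (open_nbhs_nbhs (conj (@open_neq _ 0) fx0)).
by move: Hf; apply: filterS2 => y Hf fy k; exact: CkV.
Qed.

Lemma smooth_near_sum n (I : finType) (P : pred I) (f : I -> 'rV[R]_n -> R) x :
  (forall i, smooth_near (f i) x) ->
  smooth_near (fun y => \sum_(i | P i) f i y) x.
Proof.
move=> H; have : \forall y \near x, forall i k, Ck k (f i) y.
  exact: near_forall.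
by apply: filterS => y Hy k; apply: Ck_sum => i _; exact: Hy.
Qed.

Lemma smooth_near_derive n (f : 'rV[R]_n -> R) x v :
  smooth_near f x -> smooth_near ('D_v f) x.
Proof. by apply: filterS => y Hf k; exact: (Hf k.+1).2. Qed.

Lemma smooth_near_comp n p (f : 'rV[R]_n -> R) (G : 'rV[R]_p -> 'rV[R]_n) x :
  (forall i, smooth_near (fun y => G y 0 i) x) ->
  smooth_near f (G x) -> smooth_near (f \o G) x.
Proof.
move=> HG Hf.
have cG : {for x, continuous G}.
  by apply: continuous_row => i; exact: smooth_near_continuous.
have HG' : \forall y \near x, forall i k, Ck k (fun y => G y 0 i) y.
  exact: near_forall.
have Hf' : \forall y \near x, forall k, Ck k f (G y) := cG _ Hf.
by move: HG' Hf'; apply: filterS2 => y HGy Hfy k; exact: Ck_comp.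
Qed.

Lemma smooth_near_linear n (f : 'rV[R]_n -> R) x :
  linear f -> smooth_near f x.
Proof.
move=> lf.
pose f' : {linear 'rV[R]_n -> R} := HB.pack f (GRing.isLinear.Build _ _ _ _ f lf).
rewrite (_ : f = fun y => \sum_i y 0 i * f 'e_i); last first.
  apply/funext => y; rewrite -[LHS]/(f' y) {1}(row_sum_delta y) linear_sum.
  by apply: eq_bigr => i _; rewrite linearZ.
by apply: smooth_near_sum => i; apply: smooth_nearM;
  [exact: smooth_near_coord|exact: smooth_near_cst].
Qed.

Lemma smooth_near_mulmx n p (A : 'M[R]_(n, p)) (G : 'rV[R]_n -> 'rV[R]_n) x i :
  (forall j, smooth_near (fun y => G y 0 j) x) ->
  smooth_near (fun y => (G y *m A) 0 i) x.
Proof.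
move=> HG; under eq_fun do rewrite mxE.
by apply: smooth_near_sum => j; apply: smooth_nearM => //; exact: smooth_near_cst.
Qed.

Lemma derive_dir_linear n (f : 'rV[R]_n -> R) x (c : R) u v :
  differentiable f x -> 'D_(c *: u + v) f x = c * 'D_u f x + 'D_v f x.
Proof. by move=> df; rewrite !deriveE// linearP. Qed.

Lemma differentiable_comp_coord (V : normedModType R) n (G : V -> 'rV[R]_n) x i :
  differentiable G x -> differentiable (fun y => G y 0 i : R) x.
Proof. by move=> dG; exact: (differentiable_comp dG (differentiable_coord (G x) 0 i)). Qed.

Lemma is_derive_line n (f : 'rV[R]_n -> R) x h (t : R) :
  differentiable f (x + t *: h) ->
  is_derive t 1 (fun s : R => f (x + s *: h)) ('D_h f (x + t *: h)).
Proof.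
move=> df; pose G (s : R) := x + s *: h.
have dG : differentiable G t by [].
have GE : 'D_1 G t = h.
  rewrite deriveD//; last by apply: diff_derivable; exact: differentiableZl.
  rewrite derive_cst add0r deriveE; last exact: differentiableZl.
  by rewrite diffZl// diff_val/= scale1r.
have E : 'D_1 (f \o G) t = 'D_('D_1 G t) f (G t).
  by apply: derive_comp_row => // i; exact: differentiable_comp_coord.
rewrite GE in E; rewrite -[x + _]/(G t) -E; apply: DeriveDef; last by [].
by apply: diff_derivable; exact: differentiable_comp.
Qed.

Lemma MVT_line n (f : 'rV[R]_n -> R) x h :
  (forall t : R, 0 <= t <= 1 -> differentiable f (x + t *: h)) ->
  exists2 c : R, 0 <= c <= 1 & f (x + h) - f x = 'D_h f (x + c *: h).
Proof.
move=> df.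
have [||c] := @MVT_segment R (fun t => f (x + t *: h))
    (fun t => 'D_h f (x + t *: h)) 0 1 ler01.
- by move=> t /itvP t01; apply: is_derive_line; apply: df; rewrite !t01.
- apply: continuous_in_subspaceT => t; rewrite inE/= => /itvP t01.
  have : is_derive t 1 (fun t : R => f (x + t *: h)) ('D_h f (x + t *: h)).
    by apply: is_derive_line; apply: df; rewrite !t01.
  by move=> [/derivable1_diffP/differentiable_continuous].
- rewrite in_itv/= => c01; rewrite scale1r scale0r addr0 subr0 mulr1 => E.
  by exists c.
Qed.

Lemma derive_shift_rV n (f : 'rV[R]_n -> R) a x v :
  'D_v (fun y => f (a + y)) x = 'D_v f (a + x).
Proof.
rewrite /derive /=.
have -> // : (fun h : R => h^-1 *: (f (a + (h *: v + x)) - f (a + x))) =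
  (fun h : R => h^-1 *: (f (h *: v + (a + x)) - f (a + x))).
by apply/funext => h; rewrite addrCA.
Qed.

Lemma differentiable_shift n (f : 'rV[R]_n -> R) a x :
  differentiable f (a + x) -> differentiable (fun y => f (a + y)) x.
Proof. by move=> df; apply: (differentiable_comp (f := fun y => a + y)). Qed.

Lemma deriveZdir n (f : 'rV[R]_n -> R) x (c : R) v :
  differentiable f x -> 'D_(c *: v) f x = c * 'D_v f x.
Proof. by move=> df; rewrite !deriveE// linearZ. Qed.

(** The mean value theorem twice: for y |-> f(y + t v) - f(y) in the direction u, then for ['D_u f]
    in the direction v. *)
Lemma second_difference n (f : 'rV[R]_n -> R) x (r : R) u v (t : R) :
  (forall y, `|y - x| < r -> smooth_near f y) ->
  0 < t -> t * (`|u| + `|v|) < r ->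
  exists2 y, `|y - x| <= t * (`|u| + `|v|) &
    f (x + t *: u + t *: v) - f (x + t *: u) - (f (x + t *: v) - f x)
      = t ^+ 2 * 'D_v ('D_u f) y.
Proof.
move=> sf t0 tr.
have bnd (a b : R) : 0 <= a <= 1 -> 0 <= b <= 1 ->
    `|x + a *: (t *: u) + b *: (t *: v) - x| <= t * (`|u| + `|v|).
  move=> /andP[a0 a1] /andP[b0 b1].
  rewrite addrAC [x + _ - x]addrAC subrr add0r mulrDr.
  rewrite (le_trans (ler_normD _ _))// lerD// !normrZ (gtr0_norm t0) ger0_norm//.
    by rewrite ler_piMl// mulr_ge0// ltW.
  by rewrite ler_piMl// mulr_ge0// ltW.
pose g y := f (t *: v + y) - f y.
have sg (c : R) : 0 <= c <= 1 -> differentiable (fun y => f (t *: v + y)) (x + c *: (t *: u)) /\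
    differentiable f (x + c *: (t *: u)).
  move=> c01; split.
    apply: differentiable_shift; apply/smooth_near_differentiable/sf.
    apply: le_lt_trans tr; rewrite [t *: v + _]addrC -[t *: v]scale1r; apply: bnd => //.
    by rewrite ler01 lexx.
  apply/smooth_near_differentiable/sf; apply: le_lt_trans tr.
  by rewrite -[x + _]addr0 -(scale0r (t *: v)); apply: bnd => //; rewrite lexx ler01.
have [c c01 E] : exists2 c : R, 0 <= c <= 1 &
    g (x + t *: u) - g x = 'D_(t *: u) g (x + c *: (t *: u)).
  by apply: (@MVT_line _ g) => s /sg[d1 d2]; exact: differentiableB.
have [d1 d2] := sg c c01.
have [c' c'01 E'] : exists2 c' : R, 0 <= c' <= 1 &
   'D_u f (x + c *: (t *: u) + t *: v) - 'D_u f (x + c *: (t *: u)) =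
   'D_(t *: v) ('D_u f) (x + c *: (t *: u) + c' *: (t *: v)).
  apply: (@MVT_line _ ('D_u f)) => s s01; apply: smooth_near_differentiable.
  apply: smooth_near_derive; apply: sf.
  by apply: le_lt_trans tr; exact: bnd.
exists (x + c *: (t *: u) + c' *: (t *: v)); first exact: bnd.
have -> : f (x + t *: u + t *: v) - f (x + t *: u) - (f (x + t *: v) - f x) =
   g (x + t *: u) - g x.
  by rewrite /g ![t *: v + _]addrC.
rewrite E deriveB; [|exact: diff_derivable..].
have d3 : differentiable f (t *: v + (x + c *: (t *: u))).
  rewrite [t *: v + _]addrC; apply/smooth_near_differentiable/sf.
  apply: le_lt_trans tr; rewrite -[t *: v]scale1r; apply: bnd => //.
  by rewrite lexx ler01.
rewrite derive_shift_rV (deriveZdir t u d3) (deriveZdir t u d2).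
rewrite -mulrBr [t *: v + _]addrC E' deriveZdir; first by rewrite mulrA expr2.
apply: smooth_near_differentiable; apply: smooth_near_derive; apply: sf.
by apply: le_lt_trans tr; exact: bnd.
Qed.

Lemma nbhs_rV_ball n (P : set 'rV[R]_n) (x : 'rV[R]_n) : nbhs x P ->
  exists2 r : R, 0 < r & forall y : 'rV[R]_n, `|y - x| < r -> P y.
Proof.
move=> /nbhs_normP[r r0 H]; exists r => // y yx; apply: H.
by rewrite /ball_/= distrC.
Qed.

(** The values compared are taken at two different points y and z, both tending to x with t; a mean
    value theorem gives no control over which points they are. *)
Lemma continuous_eq_at n (A B : 'rV[R]_n -> R) (x : 'rV[R]_n) (r s : R) :
  0 < r -> 0 <= s -> {for x, continuous A} -> {for x, continuous B} ->
  (forall t, 0 < t -> t * s < r -> exists y z : 'rV[R]_n,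
    [/\ `|y - x| <= t * s, `|z - x| <= t * s & A y = B z]) ->
  A x = B x.
Proof.
move=> r0 s0 cA cB H.
apply/eqP; rewrite -subr_eq0 -normr_le0; apply/ler_addgt0Pr => e e0; rewrite add0r.
have e2 : 0 < e / 2 by rewrite divr_gt0.
have /cvgrPdist_lt/(_ _ e2)/nbhs_rV_ball[r1 r10 H1] := cA.
have /cvgrPdist_lt/(_ _ e2)/nbhs_rV_ball[r2 r20 H2] := cB.
pose m := Num.min r (Num.min r1 r2).
have m0 : 0 < m by rewrite !lt_min r0 r10.
have s1 : 0 < s + 1 by rewrite ltr_wpDl.
(* Dividing by s + 1 allows s = 0, and the half makes the inequality strict. *)
pose t := m / (s + 1) / 2.
have t0 : 0 < t by rewrite !divr_gt0.
have tm : t * s < m.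
  have ts : t * (s + 1) = m / 2 by rewrite /t mulrAC divfK// gt_eqF.
  apply: (@le_lt_trans _ _ (t * (s + 1))); first by rewrite ler_pM2l// lerDl.
  by rewrite ts ltr_pdivrMr// ltr_pMr// ltr1n.
have [|y [z [yx zx E]]] := H t t0; first by rewrite (lt_le_trans tm)// /m ge_min lexx.
have -> : A x - B x = (A x - A y) - (B x - B z) by rewrite E opprB addrA subrK.
apply: (le_trans (ler_normB _ _)); rewrite [e]splitr; apply: lerD; apply: ltW.
  by apply: H1; apply: (le_lt_trans yx); apply: (lt_le_trans tm);
     rewrite /m !ge_min lexx orbT.
by apply: H2; apply: (le_lt_trans zx); apply: (lt_le_trans tm);
   rewrite /m !ge_min lexx !orbT.
Qed.

Lemma near_ball_rV n (r : R) (x y : 'rV[R]_n) : `|y - x| < r ->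
  \forall z \near y, `|z - x| < r.
Proof.
move=> yr; apply/nbhs_normP; exists (r - `|y - x|); first by rewrite /= subr_gt0.
move=> z; rewrite /ball_/= distrC => zy.
have -> : z - x = (z - y) + (y - x) by rewrite addrA subrK.
by apply: (le_lt_trans (ler_normD _ _)); rewrite -ltrBrDr.
Qed.

(** The second difference of f along u and v is symmetric in u and v, and divided by t^2 it is a
    value near x of either mixed derivative. *)
Lemma derive_sym n (f : 'rV[R]_n -> R) x u v : smooth_near f x ->
  'D_u ('D_v f) x = 'D_v ('D_u f) x.
Proof.
move=> sf; have [r r0 Hr] := nbhs_rV_ball (smooth_near_nbhs sf).
have s0 : 0 <= `|u| + `|v| by rewrite addr_ge0.
apply: (@continuous_eq_at _ ('D_u ('D_v f)) ('D_v ('D_u f)) x r _ r0 s0).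
- exact: smooth_near_continuous (smooth_near_derive u (smooth_near_derive v sf)).
- exact: smooth_near_continuous (smooth_near_derive v (smooth_near_derive u sf)).
move=> t t0 tr; have [y1 y1x E1] := second_difference Hr t0 tr.
rewrite [`|u| + _]addrC in tr; have [y2 y2x E2] := second_difference Hr t0 tr.
rewrite [`|v| + _]addrC in y2x; exists y2, y1; split; [exact: y2x|exact: y1x|].
have t2 : t ^+ 2 != 0 by rewrite expf_neq0// gt_eqF.
apply: (mulfI t2).
apply: etrans (esym E2) (etrans _ E1); rewrite (addrAC x (t *: v)).
by move: (f _) (f _) (f _) (f x) => a b c d; ring.
Qed.

End SmoothNear.

(** * Averages over [0, 1] *)

Section Mean.
Variable R : realType.
Implicit Types f g : R -> R.

(** Continuity is two-sided also at 0 and 1: the integrands are defined on the whole line, and the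
    one-sided limits required by the fundamental theorem of calculus follow. *)
Definition cont01 f := forall t : R, 0 <= t <= 1 -> {for t, continuous f}.

Definition mean f : R :=
  \int[@lebesgue_measure R]_(t in `[0, 1]) f t.

Lemma cont01_within f : cont01 f -> {within `[0, 1], continuous f}.
Proof.
move=> cf; apply: continuous_in_subspaceT => t; rewrite inE/= in_itv/= => t01.
exact: cf.
Qed.

Lemma cont01_integrable f : cont01 f ->
  (@lebesgue_measure R).-integrable `[0, 1] (EFin \o f).
Proof.
by move=> /cont01_within cf; apply: continuous_compact_integrable => //; exact: segment_compact.
Qed.

Lemma eq_mean f g : (forall t : R, 0 <= t <= 1 -> f t = g t) -> mean f = mean g.
Proof. by move=> fg; apply: eq_Rintegral => t; rewrite inE/= in_itv/=; exact: fg. Qed.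

Lemma meanD f g : cont01 f -> cont01 g -> mean (fun t => f t + g t) = mean f + mean g.
Proof. by move=> cf cg; apply: RintegralD => //; exact: cont01_integrable. Qed.

Lemma meanB f g : cont01 f -> cont01 g -> mean (fun t => f t - g t) = mean f - mean g.
Proof. by move=> cf cg; apply: RintegralB => //; exact: cont01_integrable. Qed.

Lemma meanZ (c : R) f : cont01 f -> mean (fun t => c * f t) = c * mean f.
Proof. by move=> cf; apply: RintegralZl => //; exact: cont01_integrable. Qed.

Lemma mean_cst (c : R) : mean (fun=> c) = c.
Proof.
rewrite /mean Rintegral_cst//= lebesgue_measure_itv/= lte_fin ltr01.
by rewrite oppr0 adde0 mulr1.
Qed.

Lemma cont01_cst (c : R) : cont01 (fun=> c).
Proof. by move=> t _; exact: cst_continuous. Qed.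

Lemma cont01D f g : cont01 f -> cont01 g -> cont01 (fun t => f t + g t).
Proof. by move=> cf cg t t01; exact: (continuousD (cf t t01) (cg t t01)). Qed.

Lemma cont01M f g : cont01 f -> cont01 g -> cont01 (fun t => f t * g t).
Proof. by move=> cf cg t t01; exact: (continuousM (cf t t01) (cg t t01)). Qed.

Lemma mean_sum n (F : 'I_n -> R -> R) : (forall i, cont01 (F i)) ->
  mean (fun t => \sum_i F i t) = \sum_i mean (F i).
Proof.
move=> cF.
suff /(_ (index_enum _))[] : forall s : seq 'I_n, cont01 (fun t => \sum_(i <- s) F i t) /\
  mean (fun t => \sum_(i <- s) F i t) = \sum_(i <- s) mean (F i) by [].
elim=> [|i s [IH1 IH2]].
  rewrite big_nil; under [X in cont01 X /\ _]eq_fun do rewrite big_nil.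
  under [X in _ /\ mean X = _]eq_fun do rewrite big_nil.
  by rewrite mean_cst; split=> //; exact: cont01_cst.
rewrite big_cons; under [X in cont01 X /\ _]eq_fun do rewrite big_cons.
under [X in _ /\ mean X = _]eq_fun do rewrite big_cons.
by rewrite meanD// IH2; split=> //; exact: cont01D.
Qed.

Lemma mean_le f (C : R) : cont01 f -> (forall t : R, 0 <= t <= 1 -> `|f t| <= C) ->
  `|mean f| <= C.
Proof.
move=> cf fC.
have i1 := cont01_integrable cf.
have ic (c : R) := cont01_integrable (@cont01_cst c).
rewrite ler_norml; apply/andP; split.
  rewrite -[leLHS](mean_cst (- C)); apply: le_Rintegral => // t /=.
  by rewrite in_itv/= => /fC; rewrite ler_norml => /andP[].
rewrite -[leRHS](mean_cst C); apply: le_Rintegral => // t /=.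
by rewrite in_itv/= => /fC; rewrite ler_norml => /andP[].
Qed.

Lemma mean_FTC (F f : R -> R) : cont01 f ->
  (forall t : R, 0 <= t <= 1 -> is_derive t 1 F (f t)) -> mean f = F 1 - F 0.
Proof.
move=> cf dF.
have cF (t : R) : 0 <= t <= 1 -> {for t, continuous F}.
  by move=> /dF[/derivable1_diffP/differentiable_continuous].
rewrite /mean /Rintegral (@continuous_FTC2 _ f F 0 1)//.
- exact: cont01_within.
- split.
  + by move=> t; rewrite in_itv/= => /andP[t0 t1]; have [] := dF t; rewrite ?ltW.
  + by apply: cvg_at_right_filter; apply: cF; rewrite lexx ler01.
  + by apply: cvg_at_left_filter; apply: cF; rewrite lexx ler01.
- move=> t; rewrite in_itv/= => /andP[t0 t1]; rewrite derive1E.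
  by have [] := dF t; rewrite ?ltW.
Qed.

End Mean.

(** * Differentiation under the integral sign and Hadamard's lemma *)

Section Hadamard.
Variable R : realType.

Lemma continuous_sum (T : topologicalType) (I : finType) (F : I -> T -> R) (x : T) :
  (forall i, {for x, continuous (F i)}) ->
  {for x, continuous (fun y => \sum_i F i y)}.
Proof.
move=> cF; rewrite /index_enum; elim: (locked_with _ _) => [|i s IH].
  apply: (@near_eq_continuous _ _ (fun=> 0)); last exact: cst_continuous.
  by apply: filterE => y; rewrite big_nil.
apply: (@near_eq_continuous _ _ (fun y => F i y + \sum_(j <- s) F j y)).
  by apply: filterE => y; rewrite big_cons.
exact: (continuousD (cF i) IH).
Qed.

Lemma coord_le_norm n (h : 'rV[R]_n) i : `|h 0 i| <= `|h|.
Proof. by rewrite [leRHS]/Num.norm/= mx_normrE; apply: (le_bigmax _ _ (0, i)). Qed.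

(** A candidate for the partial derivatives and a little-o estimate give differentiability and the
    derivative together, without knowing beforehand that the partial derivatives exist. *)
Lemma differentiable_bound n (f : 'rV[R]_n -> R) x (a : 'I_n -> R) :
  (forall e : R, 0 < e -> \forall h \near (0 : 'rV[R]_n),
     `|f (h + x) - (f x + \sum_i h 0 i * a i)| <= e * `|h|) ->
  differentiable f x /\ forall v, 'D_v f x = \sum_i v 0 i * a i.
Proof.
move=> H; pose L (h : 'rV[R]_n) := \sum_i h 0 i * a i.
have lL : linear L.
  move=> c u v; rewrite /L scaler_sumr -big_split/=; apply: eq_bigr => i _.
  by rewrite !mxE /GRing.scale/=; ring.
pose L' : {linear 'rV[R]_n -> R} := HB.pack L (GRing.isLinear.Build _ _ _ _ L lL).
have cL : continuous L'.
  by move=> y; apply: smooth_near_continuous; exact: smooth_near_linear.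
have key : f \o shift x = cst (f x) + L' +o_ (0 : 'rV[R]_n) id.
  by apply/eqaddoP => e e0; exact: H.
have dE := diff_unique cL key.
have df : differentiable f x by apply/diff_locallyP; rewrite dE.
by split=> // v; rewrite deriveE// dE.
Qed.

(** The mean value theorem twice in a row. The factor c need not be 1/2; only a bound of the
    remainder by the second derivative is wanted. *)
Lemma taylor2 n (f : 'rV[R]_n -> R) a h :
  (forall t : R, 0 <= t <= 1 -> smooth_near f (a + t *: h)) ->
  exists c d : R, [/\ 0 <= c <= 1, 0 <= d <= 1 &
    f (a + h) - f a - 'D_h f a = c * 'D_h ('D_h f) (a + d *: h)].
Proof.
move=> sf.
have [c c01 E] : exists2 c : R, 0 <= c <= 1 & f (a + h) - f a = 'D_h f (a + c *: h).
  by apply: MVT_line => t t01; apply: smooth_near_differentiable; exact: sf.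
have cs (s : R) : 0 <= s <= 1 -> 0 <= s * c <= 1.
  by move=> /andP[s0 s1]; case/andP: c01 => c0 c1; rewrite mulr_ge0//= mulr_ile1.
have [d d01 E'] : exists2 d : R, 0 <= d <= 1 &
   'D_h f (a + c *: h) - 'D_h f a = 'D_(c *: h) ('D_h f) (a + d *: (c *: h)).
  apply: (@MVT_line _ _ ('D_h f)) => t t01; apply: smooth_near_differentiable.
  by apply: smooth_near_derive; rewrite scalerA; apply: sf; exact: cs.
exists c, (d * c); split; [by []|exact: cs|].
rewrite E E' scalerA deriveZdir; first by [].
by apply: smooth_near_differentiable; apply: smooth_near_derive; apply: sf; exact: cs.
Qed.

Lemma derive2_sum n (f : 'rV[R]_n -> R) a h : smooth_near f a ->
  'D_h ('D_h f) a = \sum_i \sum_j h 0 i * h 0 j * 'D_'e_j ('D_'e_i f) a.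
Proof.
move=> sf.
rewrite (near_eq_derive (g := fun y => \sum_i h 0 i * 'D_'e_i f y)); last first.
  apply: filterS (smooth_near_nbhs sf) => y sfy.
  by rewrite derive_coord_sum//; exact: smooth_near_differentiable.
have -> : (fun y => \sum_i h 0 i * 'D_'e_i f y) = \sum_i (fun y => h 0 i * 'D_'e_i f y).
  by apply/funext => y; rewrite fct_sumE.
have d1 i : differentiable ('D_'e_i f) a.
  by apply: smooth_near_differentiable; exact: smooth_near_derive.
have d2 i : derivable ('D_'e_i f) a h by exact: diff_derivable.
rewrite derive_sum; last by move=> i; exact: derivableZ.
apply: eq_bigr => i _.
rewrite deriveZ; last exact: d2.
rewrite derive_coord_sum; last exact: d1.
by rewrite /GRing.scale/= mulr_sumr; apply: eq_bigr => j _; rewrite mulrA.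
Qed.

(** All second partial derivatives are bounded at once by compactness of the closed ball; averaging
    over t requires this uniformity. *)
Lemma derive2_bound n (f : 'rV[R]_n -> R) (r rho : R) : 0 <= rho -> rho < r ->
  (forall y, `|y| < r -> smooth_near f y) ->
  exists2 C : R, 0 <= C & forall y h, `|y| <= rho ->
    `|'D_h ('D_h f) y| <= C * `|h| ^+ 2.
Proof.
move=> rho0 rr sf; pose A := [set y : 'rV[R]_n | `|y| <= rho].
pose S y := \sum_i \sum_j `|'D_'e_j ('D_'e_i f) y|.
have cA : compact A.
  apply: bounded_closed_compact.
    exists rho; split; first exact: num_real.
    by move=> M rM y /= yr; rewrite (le_trans yr)// ltW.
  rewrite (_ : A = (fun y : 'rV[R]_n => `|y|) @^-1` [set t | t <= rho]); last by [].
  by apply: preimage_closed; [move=> y _; exact: norm_continuous|exact: closed_le].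
have cS : {within A, continuous S}.
  apply: continuous_in_subspaceT => y; rewrite inE/= => yr.
  have sfy := sf y (le_lt_trans yr rr).
  apply: continuous_sum => i; apply: continuous_sum => j.
  apply: (@continuous_comp _ _ _ _ (fun z : R => `|z|)); last exact: norm_continuous.
  apply: smooth_near_continuous; apply: smooth_near_derive; exact: smooth_near_derive.
have [|c _ cmax] := EVT_max_rV _ cA cS; first by exists 0; rewrite /A/= normr0.
exists (S c).
  by apply: sumr_ge0 => i _; apply: sumr_ge0 => j _; exact: normr_ge0.
move=> y h yr; rewrite derive2_sum; last exact: sf (le_lt_trans yr rr).
have {cmax} Sy : S y <= S c by apply: cmax; rewrite inE.
apply: (@le_trans _ _ (S y * `|h| ^+ 2)); last by rewrite ler_wpM2r// exprn_ge0.
apply: (le_trans (ler_norm_sum _ _ _)); rewrite /S mulr_suml; apply: ler_sum => i _.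
apply: (le_trans (ler_norm_sum _ _ _)); rewrite mulr_suml; apply: ler_sum => j _.
rewrite normrM mulrC; apply: ler_wpM2l; first exact: normr_ge0.
by rewrite normrM expr2; apply: ler_pM; rewrite ?normr_ge0 ?coord_le_norm.
Qed.

(** The integral of t^j phi(t u) over [0, 1]. The power of t keeps the family closed under
    differentiation, as each derivative in u brings out one more factor t. *)
Definition radial n (phi : 'rV[R]_n -> R) (j : nat) (u : 'rV[R]_n) : R :=
  mean (fun t => t ^+ j * phi (t *: u)).

Lemma norm_scale01 n (t r : R) (u : 'rV[R]_n) : 0 <= t <= 1 -> `|u| < r -> `|t *: u| < r.
Proof.
move=> /andP[t0 t1] ur; apply: le_lt_trans ur.
by rewrite normrZ ger0_norm// ler_piMl.
Qed.

Lemma cont01_radial n (phi : 'rV[R]_n -> R) (r : R) j u :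
  (forall y, `|y| < r -> smooth_near phi y) -> `|u| < r ->
  cont01 (fun t => t ^+ j * phi (t *: u)).
Proof.
move=> sp ur; apply: cont01M => t t01; first exact: exprn_continuous.
apply: (@continuous_comp _ _ _ (fun t : R => t *: u) phi).
  by apply: cvgZr_tmp; exact: cvg_id.
by apply: smooth_near_continuous; apply: sp; exact: norm_scale01.
Qed.

Arguments cont01_radial {n phi r} j {u} _ _.

Lemma differentiable_radial n (phi : 'rV[R]_n -> R) (r : R) j y :
  (forall z, `|z| < r -> smooth_near phi z) -> `|y| < r ->
  differentiable (radial phi j) y /\
  forall v, 'D_v (radial phi j) y = radial ('D_v phi) j.+1 y.
Proof.
move=> sp yr.
have sD v z : `|z| < r -> smooth_near ('D_v phi) z.
  by move=> zr; apply: smooth_near_derive; exact: sp.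
have dphi (t : R) : 0 <= t <= 1 -> differentiable phi (t *: y).
  by move=> t01; apply: smooth_near_differentiable; apply: sp; exact: norm_scale01.
have radE v : radial ('D_v phi) j.+1 y = \sum_i v 0 i * radial ('D_'e_i phi) j.+1 y.
  rewrite /radial.
  transitivity (mean (fun t : R => \sum_i v 0 i * (t ^+ j.+1 * 'D_'e_i phi (t *: y)))).
    apply: eq_mean => t t01; rewrite derive_coord_sum; last exact: dphi.
    by rewrite mulr_sumr; apply: eq_bigr => i _; rewrite mulrCA.
  have cD i := cont01_radial j.+1 (sD 'e_i) yr.
  rewrite mean_sum; last by move=> i; apply: cont01M => //; exact: cont01_cst.
  by apply: eq_bigr => i _; rewrite meanZ.
(* An intermediate radius: second derivatives are bounded only on closed balls strictly inside the
   ball where phi is smooth. *)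
pose rho := (`|y| + r) / 2.
have rho0 : 0 <= rho.
  by rewrite divr_ge0// addr_ge0// ltW// (le_lt_trans (normr_ge0 y)).
have rr : rho < r by rewrite /rho; lra.
have yrho : `|y| < rho by rewrite /rho; lra.
have [C C0 HC] := derive2_bound rho0 rr sp.
suff H : forall e : R, 0 < e -> \forall h \near (0 : 'rV[R]_n),
    `|radial phi j (h + y) -
      (radial phi j y + \sum_i h 0 i * radial ('D_'e_i phi) j.+1 y)| <= e * `|h|.
  have [df DE] := differentiable_bound H.
  by split=> // v; rewrite DE radE.
move=> e e0.
(* The first bound on |h| keeps h + y in the ball of radius [rho], the second gives C |h| <= e; C +
   1 avoids dividing by 0. *)
have d0 : 0 < Num.min (rho - `|y|) (e / (C + 1)).
  by rewrite lt_min subr_gt0 yrho divr_gt0// ltr_wpDl.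
apply/nbhs_normP; exists (Num.min (rho - `|y|) (e / (C + 1))) => //= h.
rewrite /ball_/= sub0r normrN lt_min => /andP[h1 h2].
have hyr : `|h + y| < rho.
  by apply: (le_lt_trans (ler_normD _ _)); rewrite -ltrBrDr.
have hyr' := lt_trans hyr rr.
rewrite -radE opprD addrA /radial.
have c1 := cont01_radial j sp hyr'.
have c2 := cont01_radial j sp yr.
have c3 := cont01_radial j.+1 (sD h) yr.
have c12 : cont01 (fun t : R => t ^+ j * phi (t *: (h + y)) - t ^+ j * phi (t *: y)).
  by apply: cont01D => // t t01; exact: (continuousN (c2 t t01)).
rewrite -(meanB c1 c2) -(meanB c12 c3).
apply: (@le_trans _ _ (C * `|h| ^+ 2)); last first.
  rewrite expr2 mulrA; apply: ler_wpM2r => //.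
  apply: (@le_trans _ _ ((C + 1) * `|h|)); first by rewrite ler_wpM2r// lerDl.
  by rewrite mulrC -ler_pdivlMr ?ltW// ltr_wpDl.
apply: mean_le.
  by apply: cont01D => // t t01; exact: (continuousN (c3 t t01)).
move=> t t01; have /andP[t0 t1] := t01.
have seg (s : R) : 0 <= s <= 1 -> `|t *: y + s *: (t *: h)| <= rho.
  move=> /andP[s0 s1]; apply: (le_trans (ler_normD _ _)).
  have : `|t *: y| <= `|y| by rewrite normrZ ger0_norm// ler_piMl.
  have : `|s *: (t *: h)| <= `|h|.
    by rewrite !normrZ !ger0_norm// mulrA ler_piMl// mulr_ile1.
  by move=> ? ?; lra.
have [c [d [c01 d01 E]]] : exists c d : R, [/\ 0 <= c <= 1, 0 <= d <= 1 &
    phi (t *: y + t *: h) - phi (t *: y) - 'D_(t *: h) phi (t *: y) =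
    c * 'D_(t *: h) ('D_(t *: h) phi) (t *: y + d *: (t *: h))].
  by apply: taylor2 => s s01; apply: sp; apply: (le_lt_trans (seg s s01)).
have -> : t ^+ j * phi (t *: (h + y)) - t ^+ j * phi (t *: y) -
    t ^+ j.+1 * 'D_h phi (t *: y) =
    t ^+ j * (c * 'D_(t *: h) ('D_(t *: h) phi) (t *: y + d *: (t *: h))).
  rewrite -E (deriveZdir _ _ (dphi t t01)) scalerDr [t *: h + _]addrC exprSr.
  by move: (phi _) (phi _) ('D_h _ _) => a b b'; ring.
case/andP: c01 => c0 c1'.
rewrite normrM ger0_norm ?exprn_ge0//.
apply: (@le_trans _ _ (`|c * 'D_(t *: h) ('D_(t *: h) phi) (t *: y + d *: (t *: h))|)).
  by rewrite ler_piMl// exprn_ile1.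
rewrite normrM ger0_norm//.
apply: (@le_trans _ _ (`|'D_(t *: h) ('D_(t *: h) phi) (t *: y + d *: (t *: h))|)).
  by rewrite ler_piMl.
apply: (le_trans (HC _ _ (seg d d01))); apply: ler_wpM2l => //.
rewrite lerXn2r ?nnegrE//.
by rewrite normrZ ger0_norm// ler_piMl.
Qed.

Lemma near_norm_lt n (r : R) (y : 'rV[R]_n) : `|y| < r -> \forall z \near y, `|z| < r.
Proof.
move=> yr; have : `|y - 0| < r by rewrite subr0.
by move=> /near_ball_rV; apply: filterS => z; rewrite subr0.
Qed.

Lemma Ck_radial n k (phi : 'rV[R]_n -> R) (r : R) j y :
  (forall z, `|z| < r -> smooth_near phi z) -> `|y| < r -> Ck k (radial phi j) y.
Proof.
elim: k phi j => [|k IH] phi j sp yr.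
  apply/Ck0P; move: (near_norm_lt yr); apply: filterS => z zr.
  by apply: differentiable_continuous; have [] := differentiable_radial j sp zr.
apply/CkSP; split.
  by move: (near_norm_lt yr); apply: filterS => z zr;
    have [] := differentiable_radial j sp zr.
move=> v; have := IH ('D_v phi) j.+1 (fun z zr => smooth_near_derive v (sp z zr)) yr.
apply: Ck_near_eq; move: (near_norm_lt yr); apply: filterS => z zr.
by have [_ ->] := differentiable_radial j sp zr.
Qed.


(* The factor g_i is the integral of (D_i f)(x + t (y - x)) over t in [0, 1]. *)
Lemma hadamard n (f : 'rV[R]_n -> R) x : smooth_near f x ->
  exists g : 'I_n -> 'rV[R]_n -> R, (forall i, smooth_near (g i) x) /\
    (\forall y \near x, f y = f x + \sum_i (y - x) 0 i * g i y) /\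
    forall i, g i x = 'D_'e_i f x.
Proof.
move=> sf; have [r r0 Hr] := nbhs_rV_ball (smooth_near_nbhs sf).
(* [radial] is centred at the origin, so the base point is moved there. *)
pose f0 z := f (x + z).
have sf0 z : `|z| < r -> smooth_near f0 z.
  move=> zr; apply: smooth_near_comp; last by apply: Hr; rewrite addrAC subrr add0r.
  move=> i; under eq_fun do rewrite mxE.
  by apply: smooth_nearD; [exact: smooth_near_cst|exact: smooth_near_coord].
have sD i z : `|z| < r -> smooth_near ('D_'e_i f0) z.
  by move=> zr; apply: smooth_near_derive; exact: sf0.
exists (fun i y => radial ('D_'e_i f0) 0 (y - x)); split; [|split].
- move=> i; apply: (@smooth_near_comp _ _ _ (radial ('D_'e_i f0) 0) (fun y => y - x)).
    move=> j; under eq_fun do rewrite mxE.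
    by apply: smooth_nearD; [exact: smooth_near_coord|exact: smooth_near_cst].
  have xx : `|x - x| < r by rewrite subrr normr0.
  move: (near_norm_lt xx); apply: filterS => z zr k; exact: (Ck_radial _ _ (sD i)).
- apply/nbhs_normP; exists r => // y; rewrite /ball_/= distrC => yr.
  have E : mean (fun t : R => 'D_(y - x) f0 (t *: (y - x))) = f y - f x.
    have -> : f y - f x = f0 (0 + 1 *: (y - x)) - f0 (0 + 0 *: (y - x)).
      by rewrite /f0 scale1r scale0r !add0r addr0 [x + (y - x)]addrC subrK.
    apply: (@mean_FTC _ (fun t : R => f0 (0 + t *: (y - x)))).
      have cD : cont01 (fun s : R => s ^+ 0 * 'D_(y - x) f0 (s *: (y - x))).
        apply: (@cont01_radial _ ('D_(y - x) f0) r 0 (y - x)) yr => z zr.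
        by apply: smooth_near_derive; exact: sf0.
      move=> t t01; apply: near_eq_continuous (cD t t01).
      by apply: filterE => s; rewrite expr0 mul1r.
    move=> t t01; rewrite -[X in 'D_(y - x) f0 X]add0r; apply: is_derive_line.
    by apply: smooth_near_differentiable; rewrite add0r; apply: sf0; exact: norm_scale01.
  rewrite -[LHS](subrK (f x)) -E addrC; congr (_ + _).
  transitivity (mean (fun t : R => \sum_i (y - x) 0 i * (t ^+ 0 * 'D_'e_i f0 (t *: (y - x))))).
    apply: eq_mean => t t01; rewrite derive_coord_sum.
      by apply: eq_bigr => i _; rewrite expr0 mul1r.
    by apply: smooth_near_differentiable; apply: sf0; exact: norm_scale01.
  have cD i := cont01_radial 0 (sD i) yr.
  rewrite mean_sum; last by move=> i; apply: cont01M => //; exact: cont01_cst.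
  by apply: eq_bigr => i _; rewrite meanZ.
- move=> i; rewrite subrr /radial.
  transitivity (mean (fun=> 'D_'e_i f x)); last exact: mean_cst.
  apply: eq_mean => t _; rewrite expr0 mul1r scaler0.
  by rewrite derive_shift_rV addr0.
Qed.

End Hadamard.

(** * The inverse function theorem, by Banach's fixed point theorem *)

HB.instance Definition _ (R : realType) n := Complete.on 'rV[R]_n.

Section InverseFunction.
Variable R : realType.

Lemma norm_le_coord n (h : 'rV[R]_n) (C : R) :
  0 <= C -> (forall i, `|h 0 i| <= C) -> `|h| <= C.
Proof.
move=> C0 H; rewrite [leLHS]/Num.norm/= mx_normrE; apply/bigmax_leP; split=> // -[i j] _ /=.
by rewrite (ord1 i).
Qed.

Lemma norm_mulmx_le n p (h : 'rV[R]_n) (A : 'M[R]_(n, p)) :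
  `|h *m A| <= `|h| * \sum_i \sum_j `|A i j|.
Proof.
apply: norm_le_coord => [|k].
  by rewrite mulr_ge0// sumr_ge0// => i _; rewrite sumr_ge0.
rewrite mxE; apply: (le_trans (ler_norm_sum _ _ _)).
rewrite mulr_sumr; apply: ler_sum => i _; rewrite normrM.
apply: ler_pM; rewrite ?normr_ge0 ?coord_le_norm//.
by rewrite (bigD1 k)//= lerDl sumr_ge0.
Qed.

Lemma unitmx_inj n (A : 'M[R]_n) :
  (forall h : 'rV[R]_n, h *m A = 0 -> h = 0) -> A \in unitmx.
Proof. by move=> H; rewrite -row_free_unit; exact: inj_row_free. Qed.

(** Row i holds the derivatives along the i-th basis vector, so that the derivative is v |-> v *m
    jac F u and the chain rule multiplies from left to right. *)
Definition jac n p (F : 'rV[R]_n -> 'rV[R]_p) (u : 'rV[R]_n) : 'M[R]_(n, p) :=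
  \matrix_(i, j) 'D_'e_i (fun y => F y 0 j : R) u.

Lemma derive_jac n p (F : 'rV[R]_n -> 'rV[R]_p) u v j :
  differentiable (fun y => F y 0 j : R) u ->
  'D_v (fun y => F y 0 j : R) u = (v *m jac F u) 0 j.
Proof.
move=> dF; rewrite derive_coord_sum// mxE.
by apply: eq_bigr => i _; rewrite mxE.
Qed.

Lemma differentiable_littleo n (f : 'rV[R]_n -> R) u (e : R) :
  differentiable f u -> 0 < e ->
  \forall k \near (0 : 'rV[R]_n), `|f (k + u) - f u - 'D_k f u| <= e * `|k|.
Proof.
move=> df e0; have /eqaddoP/(_ e e0) := diff_locally df.
by apply: filterS => k; rewrite deriveE// -addrA -opprD.
Qed.

Lemma ball_segment n (z z' x : 'rV[R]_n) (r c : R) :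
  `|z - x| < r -> `|z' - x| < r -> 0 <= c <= 1 -> `|z + c *: (z' - z) - x| < r.
Proof.
move=> zr z'r /andP[c0 c1].
have -> : z + c *: (z' - z) - x = (1 - c) *: (z - x) + c *: (z' - x).
  by apply/rowP => i; rewrite !mxE; ring.
apply: (le_lt_trans (ler_normD _ _)); rewrite !normrZ !ger0_norm// ?subr_ge0//.
have : (1 - c) * `|z - x| <= (1 - c) * Num.max (`|z - x|) (`|z' - x|).
  by rewrite ler_wpM2l ?subr_ge0// le_max lexx.
have : c * `|z' - x| <= c * Num.max (`|z - x|) (`|z' - x|).
  by rewrite ler_wpM2l// le_max lexx orbT.
have : Num.max (`|z - x|) (`|z' - x|) < r by rewrite gt_max zr.
by move: (Num.max _ _) => m; nra.
Qed.

Section Inverse.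
Variables (n : nat) (F : 'rV[R]_n -> 'rV[R]_n) (x : 'rV[R]_n).
Hypothesis sF : forall i, smooth_near (fun y => F y 0 i) x.
Hypothesis dF : jac F x = 1%:M.

(** Near x the Jacobian is close to 1, so u |-> u - F u is Lipschitz with constant 1/2; the same
    estimate makes each nearby Jacobian injective. *)
Lemma inverse_contraction : exists2 r : R, 0 < r &
  (forall u, `|u - x| < r -> forall i, smooth_near (fun y => F y 0 i) u) /\
  (forall u, `|u - x| < r -> forall h : 'rV[R]_n, `|h - h *m jac F u| <= 2^-1 * `|h|) /\
  (forall u w, `|u - x| < r -> `|w - x| < r ->
     `|(u - F u) - (w - F w)| <= 2^-1 * `|u - w|).
Proof.
have n1 : 0 < (n.+1%:R : R) by rewrite ltr0Sn.
(* The bound for a row vector times a matrix adds up all n^2 entries; n + 1 in place of n covers n =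
   0. *)
have e0 : 0 < (2^-1 / n.+1%:R / n.+1%:R : R) by rewrite !divr_gt0.
have near_jac : \forall u \near x, forall i j,
    `|(1%:M - jac F u) i j| < (2^-1 / n.+1%:R / n.+1%:R : R).
  apply: near_forall => i; apply: near_forall => j.
  have := smooth_near_continuous (smooth_near_derive 'e_i (sF j)).
  move=> /cvgrPdist_lt/(_ _ e0); apply: filterS => u.
  have <- : (1%:M : 'M[R]_n) i j = 'D_'e_i (fun y => F y 0 j) x by rewrite -dF mxE.
  by rewrite !mxE.
have near_s : \forall u \near x, forall i, smooth_near (fun y => F y 0 i) u.
  by apply: near_forall => i; exact: smooth_near_nbhs.
have [r r0 Hr] : exists2 r : R, 0 < r & forall u, `|u - x| < r ->
    (forall i j, `|(1%:M - jac F u) i j| < (2^-1 / n.+1%:R / n.+1%:R : R)) /\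
    (forall i, smooth_near (fun y => F y 0 i) u).
  by apply: nbhs_rV_ball; move: near_jac near_s; apply: filterS2.
have jb u (h : 'rV[R]_n) : `|u - x| < r -> `|h - h *m jac F u| <= 2^-1 * `|h|.
  move=> /Hr[Hj _]; rewrite -{1}(mulmx1 h) -mulmxBr mulrC.
  apply: (le_trans (norm_mulmx_le _ _)); apply: ler_wpM2l => //.
  apply: (@le_trans _ _ (\sum_(i < n) \sum_(j < n) (2^-1 / n.+1%:R / n.+1%:R : R))).
    by apply: ler_sum => i _; apply: ler_sum => j _; exact: ltW.
  have -> (c : R) : \sum_(i < n) \sum_(j < n) c = c * (n%:R * n%:R).
    by rewrite !sumr_const !card_ord -mulrnA -natrM mulr_natr.
  have nn : (n%:R : R) / n.+1%:R <= 1 by rewrite ler_pdivrMr// mul1r ler_nat.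
  have -> : 2^-1 / n.+1%:R / n.+1%:R * (n%:R * n%:R) =
     2^-1 * ((n%:R / n.+1%:R) * (n%:R / n.+1%:R)) :> R by field; rewrite gt_eqF.
  by rewrite ler_piMr// mulr_ile1// divr_ge0.
exists r => //; split; first by move=> u /Hr[].
split; first by move=> u ur h; exact: jb.
move=> u w ur wr.
have seg (c : R) : 0 <= c <= 1 -> `|w + c *: (u - w) - x| < r := ball_segment wr ur.
apply: norm_le_coord => [|i]; first by rewrite mulr_ge0.
pose f (y : 'rV[R]_n) : R := y 0 i - F y 0 i.
have df y : `|y - x| < r -> differentiable f y.
  move=> /Hr[_ /(_ i) s].
  by apply: differentiableB; [exact: differentiable_coord|exact: smooth_near_differentiable].
have [c c01 E] : exists2 c : R, 0 <= c <= 1 &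
    f (w + (u - w)) - f w = 'D_(u - w) f (w + c *: (u - w)).
  by apply: MVT_line => t /seg; exact: df.
have -> : (u - F u - (w - F w)) 0 i = f (w + (u - w)) - f w.
  by rewrite [w + (u - w)]addrC subrK /f !mxE.
have cr := seg c c01; have [_ /(_ i) s] := Hr _ cr.
have d1 : differentiable (fun y : 'rV[R]_n => y 0 i : R) (w + c *: (u - w)).
  exact: differentiable_coord.
have d2 := smooth_near_differentiable s.
rewrite E deriveB; [|exact: diff_derivable..].
rewrite -(derive_row (G := id))// derive_id derive_jac//.
apply: le_trans (jb _ (u - w) cr).
by apply: le_trans (coord_le_norm _ i); rewrite !mxE.
Qed.

(** G v is the fixed point of a contraction depending on v. Its derivative is the inverse of the
    Jacobian of F at G v, and this formula raises the regularity of G one order at a time. *)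
Lemma inverse_function : exists G : 'rV[R]_n -> 'rV[R]_n,
  [/\ forall i, smooth_near (fun v => G v 0 i) (F x), G (F x) = x,
      \forall v \near F x, F (G v) = v & \forall y \near x, G (F y) = y].
Proof.
have [r r0 [sFr [jb lip]]] := inverse_contraction.
pose rho := r / 2.
have rho0 : 0 < rho by rewrite divr_gt0.
have rhor : rho < r by rewrite /rho; lra.
pose B := [set u : 'rV[R]_n | `|u - x| <= rho].
have clB : closed B.
  rewrite (_ : B = (fun u : 'rV[R]_n => `|u - x|) @^-1` [set t | t <= rho]); last by [].
  apply: preimage_closed; last exact: closed_le.
  move=> u _; apply: (@continuous_comp _ _ _ (fun u : 'rV[R]_n => u - x) (fun z => `|z|)).
    by apply: differentiable_continuous; exact: differentiableB.
  exact: norm_continuous.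
have Br u : B u -> `|u - x| < r by move=> /= h; exact: le_lt_trans rhor.
have ex v : `|v - F x| <= rho / 2 -> exists u, B u /\ F u = v.
  (* The fixed points of T are the solutions of F u = v. T preserves B: rho / 2 comes from the
     distance of v to F x and rho / 2 from the contraction. *)
  move=> vr; pose T u := v + (u - F u).
  have TB : set_fun B B T.
    move=> u Bu; rewrite /B/= /T.
    have -> : v + (u - F u) - x = (v - F x) + ((u - F u) - (x - F x)).
      by apply/rowP => i; rewrite !mxE; ring.
    apply: (le_trans (ler_normD _ _)); rewrite [rho]splitr; apply: lerD => //.
    have xr : `|x - x| < r by rewrite subrr normr0.
    apply: (le_trans (lip u x (Br u Bu) xr)).
    by rewrite mulrC ler_pM2r.
  pose Tf : {fun B >-> B} := mkfun TB.
  have ctr : is_contraction Tf.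
    exists (2^-1)%:nng; split; first by rewrite /= invf_lt1// ltr1n.
    move=> [u w] /= [Bu Bw]; change (`|T u - T w| <= 2^-1 * `|u - w|).
    have -> : T u - T w = (u - F u) - (w - F w) by apply/rowP => i; rewrite !mxE; ring.
    exact: lip (Br u Bu) (Br w Bw).
  have [|u Bu uT] := banach_fixed_point ctr clB; first by exists x; rewrite /B/= subrr normr0 ltW.
  have {}uT : u = v + (u - F u) := uT.
  exists u; split=> //; transitivity (u - (u - F u)).
    by rewrite opprB addrC subrK.
  by rewrite {1}uT addrK.
have inj u w : `|u - x| < r -> `|w - x| < r -> `|u - w| <= 2 * `|F u - F w|.
  move=> ur wr; have := lip u w ur wr.
  have -> : u - F u - (w - F w) = (u - w) - (F u - F w) by apply/rowP => i; rewrite !mxE; ring.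
  have := lerB_dist (u - w) (F u - F w); move=> ? ?; lra.
(* Outside the ball of radius rho / 2 around F x, the value x is a default. *)
pose G v := if `[< `|v - F x| <= rho / 2 >] then get [set u | B u /\ F u = v] else x.
have GP v : `|v - F x| <= rho / 2 -> B (G v) /\ F (G v) = v.
  move=> vr; rewrite /G asboolT//.
  by have [u Hu] := ex v vr; apply: (@getPex _ [set u | B u /\ F u = v]); exists u.
have lipG v w : `|v - F x| <= rho / 2 -> `|w - F x| <= rho / 2 ->
    `|G v - G w| <= 2 * `|v - w|.
  move=> /GP[Bv Fv] /GP[Bw Fw]; have := inj (G v) (G w) (Br _ Bv) (Br _ Bw).
  by rewrite Fv Fw.
have rho20 : 0 < rho / 2 by rewrite divr_gt0.
have uA u : `|u - x| < r -> jac F u \in unitmx.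
  move=> ur; apply: unitmx_inj => h hA; have := jb u ur h.
  rewrite hA subr0 => ?; apply/eqP; rewrite -normr_le0.
  have := normr_ge0 h; lra.
have dG v i : `|v - F x| < rho / 2 -> differentiable (fun w => G w 0 i : R) v /\
    forall h, 'D_h (fun w => G w 0 i : R) v =
      \sum_j h 0 j * invmx (jac F (G v)) j i.
  move=> vr; apply: differentiable_bound => e e0.
  have [BG FG] := GP v (ltW vr).
  have ur := Br _ BG; set u := G v in BG FG ur *.
  set A := jac F u; set b := \sum_i \sum_j `|invmx A i j|.
  have b0 : 0 <= b by apply: sumr_ge0 => ? _; apply: sumr_ge0.
  (* The increment k of G satisfies |k| <= 2 |h|, and multiplication by the inverse Jacobian costs
     at most the factor b. *)
  pose e' := e / (2 * (b + 1)).
  have e'0 : 0 < e' by rewrite divr_gt0// mulr_gt0// ltr_wpDl.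
  have near_o : \forall k \near (0 : 'rV[R]_n), forall j,
      `|F (k + u) 0 j - F u 0 j - 'D_k (fun y => F y 0 j) u| <= e' * `|k|.
    apply: near_forall => j; apply: differentiable_littleo => //.
    by apply: smooth_near_differentiable; exact: sFr.
  have [d d0 Hd] := nbhs_rV_ball near_o.
  have m0 : 0 < Num.min (rho / 2 - `|v - F x|) (d / 2).
    by rewrite lt_min subr_gt0 vr divr_gt0.
  apply/nbhs_normP; exists (Num.min (rho / 2 - `|v - F x|) (d / 2)) => // h.
  rewrite /ball_/= sub0r normrN lt_min => /andP[h1 h2].
  have hv : `|h + v - F x| <= rho / 2.
    rewrite -addrA; apply: (le_trans (ler_normD _ _)).
    by rewrite ltW// -ltrBrDr.
  have [BG' FG'] := GP _ hv.
  pose k := G (h + v) - u.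
  have kh : `|k| <= 2 * `|h|.
    by have := lipG _ _ hv (ltW vr); rewrite addrK.
  have kd : `|k - 0| < d by rewrite subr0; lra.
  pose rem := h - k *m A.
  have remb : `|rem| <= e' * `|k|.
    apply: norm_le_coord => [|j]; first by rewrite mulr_ge0// ltW.
    have := Hd k kd j; rewrite subrK FG FG' derive_jac; last first.
      by apply: smooth_near_differentiable; exact: sFr.
    by rewrite !mxE addrK.
  have kE : k - h *m invmx A = - (rem *m invmx A).
    by rewrite mulmxBl mulmxK ?uA// opprB.
  apply: (@le_trans _ _ (`|rem *m invmx A|)).
    rewrite -[leRHS]normrN -kE; apply: le_trans (coord_le_norm _ i).
    by rewrite !mxE opprD addrA.
  apply: (le_trans (norm_mulmx_le _ _)); rewrite -/b.
  apply: (@le_trans _ _ (e' * (2 * `|h|) * b)).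
    apply: ler_wpM2r => //; apply: (le_trans remb).
    by rewrite ler_pM2l.
  have -> : e' * (2 * `|h|) * b = (e * `|h|) * (b / (b + 1)).
    by rewrite /e'; field; rewrite gt_eqF// ltr_wpDl.
  apply: ler_piMr; first by rewrite mulr_ge0// ltW.
  by rewrite ler_pdivrMr ?ltr_wpDl// mul1r lerDl.
(* Bootstrap: if G is of class C^k, so is the inverse of the Jacobian of F at G, which is the
   derivative of G. *)
have CkG k v i : `|v - F x| < rho / 2 -> Ck k (fun w => G w 0 i) v.
  elim: k v i => [|k IH] v i vr.
    apply/Ck0P; move: (near_ball_rV vr); apply: filterS => w wr.
    by apply: differentiable_continuous; have [] := dG w i wr.
  apply/CkSP; split.
    by move: (near_ball_rV vr); apply: filterS => w wr; have [] := dG w i wr.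
  move=> h.
  have : Ck k (fun w => \sum_j h 0 j * invmx (jac F (G w)) j i) v.
    apply: Ck_sum => j _; apply: CkM; first exact: Ck_cst.
    have [BG _] := GP v (ltW vr).
    apply: (@Ck_invmx _ _ _ _ (fun w => jac F (G w))); first by apply: uA; exact: Br.
    move=> a b; under eq_fun do rewrite mxE.
    apply: (@Ck_comp _ _ _ _ ('D_'e_a (fun y => F y 0 b)) G); first by move=> c; exact: IH.
    by apply: smooth_near_Ck; apply: smooth_near_derive; apply: sFr; exact: Br.
  apply: Ck_near_eq; move: (near_ball_rV vr); apply: filterS => w wr.
  by have [_ ->] := dG w i wr.
have xr : `|F x - F x| < rho / 2 by rewrite subrr normr0.
have GF y : `|y - x| < r -> `|F y - F x| <= rho / 2 -> G (F y) = y.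
  move=> yr Fyr; have [BG FG] := GP _ Fyr.
  have := inj _ _ (Br _ BG) yr; rewrite FG subrr normr0 mulr0 normr_le0 subr_eq0.
  by move/eqP.
exists G; split.
- by move=> i; move: (near_ball_rV xr); apply: filterS => v vr k; exact: CkG.
- by apply: GF; rewrite ?subrr ?normr0 ?ltW.
- by move: (near_ball_rV xr); apply: filterS => v vr; have [] := GP v (ltW vr).
have cF : {for x, continuous F}.
  by apply: continuous_row => i; exact: smooth_near_continuous.
have n1 : \forall y \near x, `|F y - F x| < rho / 2 := cF _ (near_ball_rV xr).
have n2 : \forall y \near x, `|y - x| < r.
  by apply/nbhs_normP; exists r => // y; rewrite /ball_/= distrC.
by move: n1 n2; apply: filterS2 => y y1 y2; apply: GF => //; exact: ltW.
Qed.

End Inverse.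
End InverseFunction.

(** * Tangent vectors and smooth maps *)

Section ManifoldCalculus.
Variable R : realType.
Implicit Types M N P : manifold R.

Section Charts.
Variables (M : manifold R) (c : chart R M (dim M)).

Lemma near_cdom x : cdom c x -> \forall y \near x, cdom c y.
Proof. by move=> cx; apply: open_nbhs_nbhs; split=> //; exact: cdom_open. Qed.

Lemma near_cim x : cdom c x -> \forall u \near cmap c x, (cmap c @` cdom c) u.
Proof.
by move=> cx; apply: open_nbhs_nbhs; split; [exact: cim_open|exists x].
Qed.

Lemma cinvK u : (cmap c @` cdom c) u -> cmap c (cinv c u) = u.
Proof. by move=> [y cy <-]; rewrite cmapK. Qed.

Lemma cdom_cinv u : (cmap c @` cdom c) u -> cdom c (cinv c u).
Proof. by move=> [y cy <-]; rewrite cmapK. Qed.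

Lemma near_cinvK x : cdom c x -> \forall u \near cmap c x, cmap c (cinv c u) = u.
Proof. by move=> cx; apply: filterS (near_cim cx) => u; exact: cinvK. Qed.

Lemma near_cinv x (Q : M -> Prop) : cdom c x ->
  (\forall y \near x, Q y) -> \forall u \near cmap c x, Q (cinv c u).
Proof.
move=> cx HQ; have := @cinv_cont _ _ _ c (cmap c x) (ex_intro2 _ _ x cx erefl) Q.
by rewrite cmapK//; exact.
Qed.

Lemma near_cmap x (Q : 'rV[R]_(dim M) -> Prop) : cdom c x ->
  (\forall u \near cmap c x, Q u) -> \forall y \near x, Q (cmap c y).
Proof. by move=> cx HQ; exact: (@cmap_cont _ _ _ c x cx Q HQ). Qed.

End Charts.

Lemma smooth_at_chart M (f : M -> R) x c : atlas c -> cdom c x ->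
  smooth_near (f \o cinv c) (cmap c x) -> smooth_at f x.
Proof.
move=> ac cx sf c' ac' c'x.
apply: (@smooth_near_eq _ _ ((f \o cinv c) \o (fun u => cmap c (cinv c' u)))).
  apply: filterS (near_cinv c'x (near_cdom cx)) => u cu /=.
  by rewrite cmapK.
apply: smooth_near_comp; last by rewrite cmapK.
by move=> i; exact: atlas_compat.
Qed.

Lemma smooth_at_near M (f : M -> R) x : smooth_at f x ->
  \forall y \near x, smooth_at f y.
Proof.
move=> sf; have [c ac cx] := atlas_cover x.
have H := near_cmap cx (smooth_near_nbhs (sf c ac cx)).
move: H (near_cdom cx); apply: filterS2 => y sy cy.
exact: (smooth_at_chart ac cy).
Qed.

Lemma smooth_at_eq M (f g : M -> R) x : (\near x, f x = g x) ->
  smooth_at f x -> smooth_at g x.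
Proof.
move=> fg sf; have [c ac cx] := atlas_cover x.
apply: (smooth_at_chart ac cx); apply: smooth_near_eq (sf c ac cx).
exact: (near_cinv cx fg).
Qed.

Lemma smooth_at_cst M (a : R) (x : M) : smooth_at (fun=> a) x.
Proof. by move=> c _ _; exact: smooth_near_cst. Qed.

Lemma smooth_atD M (f g : M -> R) x : smooth_at f x -> smooth_at g x ->
  smooth_at (fun y => f y + g y) x.
Proof.
by move=> sf sg c ac cx; apply: (smooth_nearD (sf c ac cx) (sg c ac cx)).
Qed.

Lemma smooth_atM M (f g : M -> R) x : smooth_at f x -> smooth_at g x ->
  smooth_at (fun y => f y * g y) x.
Proof.
by move=> sf sg c ac cx; apply: (smooth_nearM (sf c ac cx) (sg c ac cx)).
Qed.

Lemma smooth_atZ M (a : R) (f : M -> R) x : smooth_at f x ->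
  smooth_at (fun y => a * f y) x.
Proof. by move=> sf; apply: smooth_atM => //; exact: smooth_at_cst. Qed.

Lemma smooth_at_sum M (I : finType) (f : I -> M -> R) x :
  (forall i, smooth_at (f i) x) -> smooth_at (fun y => \sum_i f i y) x.
Proof.
by move=> sf c ac cx; apply: (@smooth_near_sum _ _ I predT (fun i => f i \o cinv c)) => i;
  exact: sf.
Qed.

Lemma smooth_at_of_coord M (g : 'rV[R]_(dim M) -> R) x c : atlas c -> cdom c x ->
  smooth_near g (cmap c x) -> smooth_at (fun y => g (cmap c y)) x.
Proof.
move=> ac cx sg; apply: (smooth_at_chart ac cx).
by apply: smooth_near_eq sg; apply: filterS (near_cinvK cx) => u /= ->.
Qed.

Lemma smooth_at_coord M x c i : @atlas _ M c -> cdom c x ->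
  smooth_at (fun y => cmap c y 0 i) x.
Proof.
by move=> ac cx; apply: (smooth_at_of_coord (g := fun u => u 0 i) ac cx);
  exact: smooth_near_coord.
Qed.

(** The condition of [smooth_map] at one point, for maps that are smooth only locally, such as
    parametrizations; [smooth_map f] is convertible with [forall x, smap_at f x]. *)
Definition smap_at M N (f : M -> N) (x : M) : Prop :=
  {for x, continuous f} /\
    forall c c', @atlas _ M c -> @atlas _ N c' -> cdom c x -> cdom c' (f x) ->
      forall i, smooth_near (fun u => cmap c' (f (cinv c u)) 0 i) (cmap c x).

(** Coordinates are themselves smooth functions, so smoothness can be tested on functions;
    compositions and [Tmap] then need no charts. *)
Lemma smap_atP M N (f : M -> N) x : smap_at f x <->
  {for x, continuous f} /\ forall h, smooth_at h (f x) -> smooth_at (h \o f) x.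
Proof.
split=> [[cf sf]|[cf sf]]; split=> //.
  move=> h sh; have [c ac cx] := atlas_cover x; have [c' ac' cx'] := atlas_cover (f x).
  apply: (smooth_at_chart ac cx).
  apply: (@smooth_near_eq _ _ ((h \o cinv c') \o (fun u => cmap c' (f (cinv c u))))).
    have : \forall y \near x, cdom c' (f y) by apply: cf; exact: near_cdom.
    by move=> /(near_cinv cx); apply: filterS => u cu /=; rewrite cmapK.
  apply: smooth_near_comp; first by move=> i; exact: sf.
  by rewrite cmapK//; exact: sh.
move=> c c' ac ac' cx cx' i.
exact: (sf _ (smooth_at_coord i ac' cx') c ac cx).
Qed.

Lemma smap_at_comp M N P (f : M -> N) (g : N -> P) x :
  smap_at f x -> smap_at g (f x) -> smap_at (g \o f) x.
Proof.
move=> /smap_atP[cf sf] /smap_atP[cg sg]; apply/smap_atP; split.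
  exact: (@continuous_comp _ _ _ f g).
by move=> h sh; apply: (sf (h \o g)); exact: sg.
Qed.

Lemma smap_at_cst M N (z : N) (x : M) : smap_at (fun=> z) x.
Proof.
apply/smap_atP; split; first exact: cst_continuous.
by move=> h _; exact: smooth_at_cst.
Qed.

Lemma smap_at_id M (x : M) : smap_at (fun y => y) x.
Proof. by apply/smap_atP; split=> //; exact: cvg_id. Qed.

Lemma vecP M (a : R) (u v : vec M) f : (a *: u + v) f = a * u f + v f.
Proof. by []. Qed.

Section Tangent.
Variables (M : manifold R) (x : M).

Lemma tangent_nonsmooth v f : tangent x v -> ~ smooth_at f x -> v f = 0.
Proof. by move=> [H _ _]; exact: H. Qed.

Lemma tangentP v a f g : tangent x v -> smooth_at f x -> smooth_at g x ->
  v (fun y => a * f y + g y) = a * v f + v g.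
Proof. by move=> [_ H _]; exact: H. Qed.

Lemma tangentM v f g : tangent x v -> smooth_at f x -> smooth_at g x ->
  v (fun y => f y * g y) = v f * g x + f x * v g.
Proof. by move=> [_ _ H]; exact: H. Qed.

Lemma tangent_linear (a : R) u v : tangent x u -> tangent x v ->
  tangent x (a *: u + v).
Proof.
move=> tu tv; split=> [f nf|b f g sf sg|f g sf sg]; rewrite !vecP.
- by rewrite (tangent_nonsmooth tu)// (tangent_nonsmooth tv)// mulr0 addr0.
- by rewrite (tangentP _ tu)// (tangentP _ tv)//; ring.
- by rewrite (tangentM tu)// (tangentM tv)//; ring.
Qed.

Lemma tangent0 : tangent x 0.
Proof. by split=> *; rewrite /= ?mulr0 ?mul0r ?addr0. Qed.

Lemma tangentD u v : tangent x u -> tangent x v -> tangent x (u + v).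
Proof. by move=> tu tv; have := tangent_linear 1 tu tv; rewrite scale1r. Qed.

Lemma tangentZ a u : tangent x u -> tangent x (a *: u).
Proof. by move=> tu; have := tangent_linear a tu tangent0; rewrite addr0. Qed.

Lemma tangentB u v : tangent x u -> tangent x v -> tangent x (u - v).
Proof. by move=> tu tv; rewrite -scaleN1r; apply: tangentD => //; exact: tangentZ. Qed.

Lemma tangent_cst v a : tangent x v -> v (fun=> a) = 0.
Proof.
move=> tv; have s0 b := @smooth_at_cst M b x.
have v1 : v (fun=> 1) = 0.
  have := tangentM tv (s0 1) (s0 1); under eq_fun do rewrite mulr1.
  by rewrite mulr1 mul1r -[X in X = _]addr0 => /addrI.
have v0 : v (fun=> 0) = 0.
  have := tangentP 1 tv (s0 0) (s0 0); under eq_fun do rewrite mulr0 addr0.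
  by rewrite mul1r -[X in X = _]addr0 => /addrI.
have := tangentP a tv (s0 1) (s0 0); under eq_fun do rewrite mulr1 addr0.
by rewrite v1 v0 mulr0 addr0.
Qed.

(* Derivations act on arbitrary functions, so the cut-off chi below need not be
   smooth away from x. *)
Lemma tangent_eq v f g : tangent x v -> (\near x, f x = g x) -> v f = v g.
Proof.
move=> tv fg; have [sf|nf] := pselect (smooth_at f x); last first.
  rewrite (tangent_nonsmooth tv nf) (tangent_nonsmooth tv)// => sg; apply: nf.
  by apply: smooth_at_eq sg; apply: filterS fg => y ->.
have sg := smooth_at_eq fg sf.
pose d y := -1 * f y + g y.
have sd : smooth_at d x by apply: smooth_atD => //; exact: smooth_atZ.
pose chi y : R := if f y == g y then 0 else 1.
have schi : smooth_at chi x.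
  by apply: smooth_at_eq (@smooth_at_cst M 0 x); apply: filterS fg => y e; rewrite /chi e eqxx.
have dE : d = (fun y => d y * chi y).
  by apply/funext => y; rewrite /d /chi; case: eqP => [->|_]; ring.
have vd : v d = 0.
  rewrite dE (tangentM tv sd schi) /chi /d (nbhs_singleton fg) eqxx; ring.
by move: vd; rewrite (tangentP _ tv)// mulN1r addrC => /subr0_eq.
Qed.

Lemma tangent_sum v (I : finType) (f : I -> M -> R) : tangent x v ->
  (forall i, smooth_at (f i) x) -> v (fun y => \sum_i f i y) = \sum_i v (f i).
Proof.
move=> tv sf; rewrite /index_enum; elim: (locked_with _ _) => [|i s IH].
  by rewrite big_nil; under eq_fun do rewrite big_nil; exact: tangent_cst.
rewrite big_cons -IH.
have ss : smooth_at (fun y => \sum_(j <- s) f j y) x.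
  elim: s {IH} => [|j s IH].
    by under eq_fun do rewrite big_nil; exact: smooth_at_cst.
  by under eq_fun do rewrite big_cons; exact: smooth_atD.
have := tangentP 1 tv (sf i) ss; rewrite mul1r => <-.
by congr v; apply/funext => y; rewrite big_cons mul1r.
Qed.

End Tangent.

(** The tangent vector with coordinates [v] in the chart [c]; the value 0 on functions not smooth at
    x is imposed by the encoding of derivations. *)
Definition cvec M (c : chart R M (dim M)) (x : M) (v : 'rV[R]_(dim M)) : vec M :=
  fun f => if `[< smooth_at f x >] then 'D_v (f \o cinv c) (cmap c x) else 0.

Section ChartVectors.
Variables (M : manifold R) (x : M) (c : chart R M (dim M)).
Hypotheses (ac : atlas c) (cx : cdom c x).

Lemma cvecE v f : smooth_at f x -> cvec c x v f = 'D_v (f \o cinv c) (cmap c x).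
Proof. by move=> sf; rewrite /cvec asboolT. Qed.

Lemma cvec_linear a u v : cvec c x (a *: u + v) = a *: cvec c x u + cvec c x v.
Proof.
apply/funext => f; rewrite vecP /cvec; case: asboolP => [sf|_]; last first.
  by rewrite mulr0 addr0.
by rewrite derive_dir_linear//; exact: smooth_near_differentiable (sf c ac cx).
Qed.

Lemma cvec_tangent v : tangent x (cvec c x v).
Proof.
split=> [f nf|a f g sf sg|f g sf sg].
- by rewrite /cvec asboolF.
- rewrite !cvecE//; last by apply: smooth_atD => //; exact: smooth_atZ.
  have df := smooth_near_differentiable (sf c ac cx).
  have dg := smooth_near_differentiable (sg c ac cx).
  have H : 'D_v ((a *: (f \o cinv c)) + (g \o cinv c)) (cmap c x) =
      a * 'D_v (f \o cinv c) (cmap c x) + 'D_v (g \o cinv c) (cmap c x).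
    by rewrite deriveD ?deriveZ//; [exact: diff_derivable|
       apply: derivableZ; exact: diff_derivable|exact: diff_derivable].
  exact: H.
- rewrite !cvecE//; last exact: smooth_atM.
  have df := smooth_near_differentiable (sf c ac cx).
  have dg := smooth_near_differentiable (sg c ac cx).
  have H : 'D_v ((f \o cinv c) * (g \o cinv c)) (cmap c x) =
      'D_v (f \o cinv c) (cmap c x) * g x + f x * 'D_v (g \o cinv c) (cmap c x).
    rewrite deriveM; [|exact: diff_derivable..].
    rewrite /= cmapK// /GRing.scale/=.
    by move: ('D_v _ _) ('D_v _ _) => d e; rewrite addrC mulrC.
  exact: H.
Qed.

Lemma cvec_coord v i : cvec c x v (fun y => cmap c y 0 i) = v 0 i.
Proof.
rewrite cvecE; last exact: smooth_at_coord.
rewrite (near_eq_derive (g := fun u : 'rV[R]_(dim M) => u 0 i : R)); last first.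
  by apply: filterS (near_cinvK cx) => u /= ->.
by rewrite -(derive_row (G := id))// derive_id.
Qed.

Lemma cvec_inj u v : cvec c x u = cvec c x v -> u = v.
Proof. by move=> E; apply/rowP => i; rewrite -!cvec_coord E. Qed.

(** By Hadamard's lemma f is f(x) + sum_i (y_i - x_i) g_i near x, and the Leibniz rule leaves sum_i
    w(y_i) g_i(x), where g_i(x) is the i-th partial derivative. So a derivation is determined by its
    values on the coordinates. *)
Lemma tangent_cvec w : tangent x w ->
  w = cvec c x (\row_i w (fun y => cmap c y 0 i)).
Proof.
move=> tw; apply/funext => f; have [sf|nf] := pselect (smooth_at f x); last first.
  by rewrite (tangent_nonsmooth tw)// /cvec asboolF.
have [g [sg [fg gx]]] := hadamard (sf c ac cx).
rewrite cvecE// derive_coord_sum; last exact: smooth_near_differentiable (sf c ac cx).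
have sk i : smooth_at (fun y => cmap c y 0 i - cmap c x 0 i) x.
  by apply: smooth_atD; [exact: smooth_at_coord|exact: smooth_at_cst].
have sgc i : smooth_at (fun y => g i (cmap c y)) x by exact: smooth_at_of_coord.
pose F i y := (cmap c y 0 i - cmap c x 0 i) * g i (cmap c y).
have sF i : smooth_at (F i) x by exact: smooth_atM.
have -> : w f = w (fun y => 1 * (\sum_i F i y) + f x).
  apply: (tangent_eq tw); move: (near_cmap cx fg) (near_cdom cx); apply: filterS2 => y.
  move=> /= + cy; rewrite !cmapK// => ->; rewrite mul1r addrC; congr (_ + _).
  by apply: eq_bigr => i _; rewrite !mxE.
rewrite (tangentP _ tw); [|exact: smooth_at_sum|exact: smooth_at_cst].
rewrite (tangent_cst _ tw) mul1r addr0 (tangent_sum tw sF); apply: eq_bigr => i _.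
rewrite (tangentM tw (sk i) (sgc i)) subrr mul0r addr0 gx mxE; congr (_ * _).
have := tangentP 1 tw (smooth_at_coord i ac cx) (@smooth_at_cst M (- cmap c x 0 i) x).
rewrite (tangent_cst _ tw) mul1r addr0 => <-.
by congr w; apply/funext => y; rewrite mul1r.
Qed.

Lemma cvec_sum (v : 'rV[R]_(dim M)) : cvec c x v = \sum_i v 0 i *: cvec c x 'e_i.
Proof.
rewrite {1}(row_sum_delta v) /index_enum; elim: (locked_with _ _) => [|i s IH].
  rewrite !big_nil -(subrr (0 : 'rV[R]_(dim M))) -scaleN1r addrC cvec_linear scaleN1r.
  by rewrite addrC subrr.
by rewrite !big_cons cvec_linear IH.
Qed.

End ChartVectors.

Lemma tangent_dim M (x : M) : has_dim (tangent x) (dim M).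
Proof.
have [c ac cx] := atlas_cover x.
exists (fun i => cvec c x 'e_i); split.
  move=> a; set v := \row_i a i.
  have -> : \sum_i a i *: cvec c x 'e_i = \sum_i v 0 i *: cvec c x 'e_i.
    by apply: eq_bigr => i _; rewrite mxE.
  rewrite -(cvec_sum ac cx) => E i.
  by have := cvec_coord ac cx v i; rewrite E mxE => <-.
apply/seteqP; split=> [w tw|w [a ->]] /=.
  exists (fun i => w (fun y => cmap c y 0 i)).
  rewrite {1}(tangent_cvec ac cx tw) (cvec_sum ac cx).
  by apply: eq_bigr => i _; rewrite mxE.
rewrite /index_enum; elim: (locked_with _ _) => [|i s IH].
  by rewrite big_nil; exact: tangent0.
by rewrite big_cons; apply: tangent_linear => //; exact: cvec_tangent.
Qed.

Section TangentMap.
Variables (M N : manifold R).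
Implicit Types (f g : M -> N) (x : M).

Lemma TmapE f x v h : smooth_at h (f x) -> Tmap f x v h = v (h \o f).
Proof. by move=> sh; rewrite /Tmap asboolT. Qed.

Lemma Tmap_tangent f x v : smap_at f x -> tangent x v -> tangent (f x) (Tmap f x v).
Proof.
move=> /smap_atP[_ sf] tv; split=> [h nh|a h k sh sk|h k sh sk].
- by rewrite /Tmap asboolF.
- rewrite !TmapE//; last by apply: smooth_atD => //; exact: smooth_atZ.
  exact: (tangentP a tv (sf h sh) (sf k sk)).
- rewrite !TmapE//; last by exact: smooth_atM.
  exact: (tangentM tv (sf h sh) (sf k sk)).
Qed.

Lemma Tmap_linear f x a u v : Tmap f x (a *: u + v) = a *: Tmap f x u + Tmap f x v.
Proof.
apply/funext => h; rewrite vecP /Tmap; case: asboolP => // _.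
by rewrite mulr0 addr0.
Qed.

Lemma Tmap0 f x : Tmap f x 0 = 0.
Proof. by apply/funext => h; rewrite /Tmap; case: asboolP. Qed.

Lemma TmapD f x u v : Tmap f x (u + v) = Tmap f x u + Tmap f x v.
Proof. by rewrite -[u]scale1r Tmap_linear !scale1r. Qed.

Lemma TmapZ f x a u : Tmap f x (a *: u) = a *: Tmap f x u.
Proof. by rewrite -[a *: u]addr0 Tmap_linear Tmap0 addr0. Qed.

Lemma TmapB f x u v : Tmap f x (u - v) = Tmap f x u - Tmap f x v.
Proof. by rewrite TmapD -scaleN1r TmapZ scaleN1r. Qed.

Lemma Tmap_cvec f x c c' v : smap_at f x -> @atlas _ M c -> cdom c x ->
  @atlas _ N c' -> cdom c' (f x) ->
  Tmap f x (cvec c x v) =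
  cvec c' (f x) (v *m jac (fun u => cmap c' (f (cinv c u))) (cmap c x)).
Proof.
move=> sf ac cx ac' cx'.
rewrite [LHS](tangent_cvec ac' cx'); last first.
  by apply: Tmap_tangent => //; exact: cvec_tangent.
congr (cvec _ _ _); apply/rowP => i; rewrite mxE TmapE; last exact: smooth_at_coord.
rewrite cvecE; last by have /smap_atP[_] := sf; apply; exact: smooth_at_coord.
rewrite -derive_jac//; apply: smooth_near_differentiable.
by have [_] := sf; exact.
Qed.

End TangentMap.

Lemma Tmap_id M (x : M) v : tangent x v -> Tmap (fun y => y) x v = v.
Proof.
move=> tv; apply/funext => h; rewrite /Tmap; case: asboolP => // nh.
by rewrite (tangent_nonsmooth tv).
Qed.

Lemma Tmap_comp M N P (f : M -> N) (g : N -> P) x v : smap_at g (f x) ->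
  Tmap (g \o f) x v = Tmap g (f x) (Tmap f x v).
Proof.
move=> /smap_atP[_ sg]; apply/funext => h; rewrite /Tmap /=.
by case: asboolP => // sh; rewrite asboolT//; exact: sg.
Qed.

Section Euclidean.
Variable n : nat.

Lemma setT_image_open : open ((@id 'rV[R]_n) @` setT).
Proof. by rewrite image_id; exact: openT. Qed.

Definition euclid_chart : chart R 'rV[R]_n n.
Proof.
refine (@Chart R 'rV[R]_n n setT id id openT setT_image_open _ _ _) => //.
- by move=> x _; exact: cvg_id.
- by move=> x _; exact: cvg_id.
Defined.

Lemma euclid_cover (x : 'rV[R]_n) : exists2 c, [set euclid_chart] c & cdom c x.
Proof. by exists euclid_chart. Qed.

Lemma euclid_compat (c c' : chart R 'rV[R]_n n) x :
  [set euclid_chart] c -> [set euclid_chart] c' -> cdom c x -> cdom c' x ->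
  forall i, smooth_near (fun u => cmap c' (cinv c u) 0 i) (cmap c x).
Proof. by move=> -> -> _ _ i; exact: smooth_near_coord. Qed.

(** R^n as a manifold, so that parametrizations have a [Tmap] and can be tested against the fibre
    product property of [pairs]. *)
Definition euclid : manifold R := Manifold euclid_cover euclid_compat.

Definition evec (z v : 'rV[R]_n) : vec euclid := @cvec euclid euclid_chart z v.

Lemma evec_tangent (z v : 'rV[R]_n) : @tangent R euclid z (evec z v).
Proof. exact: (@cvec_tangent euclid z euclid_chart). Qed.

Lemma smooth_at_euclid (f : 'rV[R]_n -> R) z :
  @smooth_at R euclid f z <-> smooth_near f z.
Proof.
split=> [/(_ euclid_chart erefl I)//|sf].
exact: (@smooth_at_chart euclid f z euclid_chart).
Qed.

Lemma evecE (z v : 'rV[R]_n) (f : 'rV[R]_n -> R) : smooth_near f z -> evec z v f = 'D_v f z.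
Proof. by move=> /smooth_at_euclid sf; rewrite /evec cvecE. Qed.

Lemma smap_at_euclid N (P : 'rV[R]_n -> N) (z : 'rV[R]_n) c' :
  {for z, continuous P} -> atlas c' -> cdom c' (P z) ->
  (forall i, smooth_near (fun u => cmap c' (P u) 0 i) z) ->
  @smap_at euclid N P z.
Proof.
move=> cP ac' cz sP; apply/smap_atP; split=> // h sh.
apply/smooth_at_euclid.
apply: (@smooth_near_eq _ _ ((h \o cinv c') \o (fun u => cmap c' (P u)))).
  have : \forall y \near z, cdom c' (P y) by apply: cP; exact: near_cdom.
  by apply: filterS => u cu /=; rewrite cmapK.
by apply: smooth_near_comp => //; exact: sh.
Qed.

Lemma Tmap_evec N (P : 'rV[R]_n -> N) (z v : 'rV[R]_n) c' :
  @smap_at euclid N P z -> atlas c' -> cdom c' (P z) ->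
  @Tmap R euclid N P z (evec z v) =
  cvec c' (P z) (v *m jac (fun u => cmap c' (P u)) z).
Proof. by move=> sP ac' cz; rewrite /evec (@Tmap_cvec euclid N P z _ c'). Qed.

End Euclidean.

Lemma evec_linear n (z : 'rV[R]_n) a u v :
  evec z (a *: u + v) = a *: evec z u + evec z v.
Proof. exact: (@cvec_linear (euclid n) z (euclid_chart n)). Qed.

End ManifoldCalculus.

(** * Pullbacks of forms to R^p and their exterior derivative *)

Section PullbackOfForms.
Variable R : realType.

Section CoordinateFields.
Variables (M : manifold R) (c : chart R M (dim M)).
Hypothesis ac : atlas c.

Lemma smooth_at_cvec x (a : 'rV[R]_(dim M)) h : cdom c x -> smooth_at h x ->
  smooth_at (fun y => cvec c y a h) x.
Proof.
move=> cx sh; apply: (smooth_at_chart ac cx).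
apply: smooth_near_eq (smooth_near_derive a (sh c ac cx)).
have H : \forall y \near x, smooth_at h y := smooth_at_near sh.
move: (near_cinv cx H) (near_cinvK cx); apply: filterS2 => u su cu /=.
by rewrite cvecE// cu.
Qed.

Lemma smooth_vf_cvec x (a : 'rV[R]_(dim M)) : cdom c x ->
  smooth_vf (fun y => cvec c y a) x.
Proof.
move=> cx; apply: filterS (near_cdom cx) => y cy; split; first exact: cvec_tangent.
by move=> h sh; exact: smooth_at_cvec.
Qed.

(** This is the symmetry of second derivatives. *)
Lemma lie_cvec x (a b : 'rV[R]_(dim M)) : cdom c x ->
  lie (fun y => cvec c y a) (fun y => cvec c y b) x = 0.
Proof.
move=> cx; apply/funext => h; rewrite /lie; case: asboolP => // sh.
have E (a' b' : 'rV[R]_(dim M)) : cvec c x a' (fun y => cvec c y b' h) =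
    'D_a' ('D_b' (h \o cinv c)) (cmap c x).
  rewrite cvecE; last exact: smooth_at_cvec.
  apply: near_eq_derive.
  have H : \forall y \near x, smooth_at h y := smooth_at_near sh.
  move: (near_cinv cx H) (near_cinvK cx); apply: filterS2 => u su cu /=.
  by rewrite cvecE// cu.
by rewrite !E derive_sym ?subrr//; exact: sh.
Qed.

End CoordinateFields.

Section Form2.
Variables (M : manifold R) (w : form2 M).
Hypothesis fw : is_form2 w.

Lemma form2P x (a : R) u u' v : tangent x u -> tangent x u' -> tangent x v ->
  w x (a *: u + u') v = a * w x u v + w x u' v.
Proof. by case: fw => H _ _; exact: H. Qed.

Lemma form2N x u v : tangent x u -> tangent x v -> w x u v = - w x v u.
Proof. by case: fw => _ H _; exact: H. Qed.

Lemma form20l x v : tangent x v -> w x 0 v = 0.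
Proof.
move=> tv; have := form2P 1 (tangent0 x) (tangent0 x) tv.
by rewrite scaler0 addr0 mul1r -[X in X = _]addr0 => /addrI.
Qed.

Lemma form20r x v : tangent x v -> w x v 0 = 0.
Proof. by move=> tv; rewrite form2N ?form20l ?oppr0//; exact: tangent0. Qed.

Lemma form2Pr x (a : R) u u' v : tangent x u -> tangent x u' -> tangent x v ->
  w x v (a *: u + u') = a * w x v u + w x v u'.
Proof.
move=> tu tu' tv; rewrite form2N//; last exact: tangent_linear.
by rewrite form2P// (form2N tu tv) (form2N tu' tv); ring.
Qed.

Lemma form2Dr x u u' v : tangent x u -> tangent x u' -> tangent x v ->
  w x v (u + u') = w x v u + w x v u'.
Proof. by move=> tu tu' tv; rewrite -[u]scale1r form2Pr// mul1r scale1r. Qed.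

Variable c : chart R M (dim M).
Hypothesis ac : atlas c.

Lemma form2_cvec_sum x (a b : 'rV[R]_(dim M)) : cdom c x ->
  w x (cvec c x a) (cvec c x b) =
  \sum_i \sum_j a 0 i * b 0 j * w x (cvec c x 'e_i) (cvec c x 'e_j).
Proof.
move=> cx; have tc d : tangent x (cvec c x d) by exact: cvec_tangent.
have c0 : cvec c x 0 = 0.
  have := cvec_linear ac cx 1 0 0.
  by rewrite scaler0 addr0 scale1r -[X in X = _]addr0 => /addrI.
have suml (I : Type) (s : seq I) (k : I -> R) (t : I -> 'rV[R]_(dim M)) b' :
    w x (cvec c x (\sum_(i <- s) k i *: t i)) (cvec c x b') =
    \sum_(i <- s) k i * w x (cvec c x (t i)) (cvec c x b').
  elim: s => [|i s IH]; first by rewrite !big_nil c0 form20l.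
  by rewrite !big_cons cvec_linear// form2P// IH.
have sumr (I : Type) (s : seq I) (k : I -> R) (t : I -> 'rV[R]_(dim M)) b' :
    w x (cvec c x b') (cvec c x (\sum_(i <- s) k i *: t i)) =
    \sum_(i <- s) k i * w x (cvec c x b') (cvec c x (t i)).
  elim: s => [|i s IH]; first by rewrite !big_nil c0 form20r.
  by rewrite !big_cons cvec_linear// form2Pr// IH.
rewrite {1}(row_sum_delta a) suml; apply: eq_bigr => i _.
rewrite {1}(row_sum_delta b) sumr mulr_sumr; apply: eq_bigr => j _.
by rewrite mulrA.
Qed.

Lemma smooth_at_form2_cvec x (a b : 'rV[R]_(dim M)) : cdom c x ->
  smooth_at (fun y => w y (cvec c y a) (cvec c y b)) x.
Proof.
by move=> cx; case: fw => _ _; apply; exact: smooth_vf_cvec.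
Qed.

End Form2.

Lemma derive_sum_fun n (I : finType) (f : I -> 'rV[R]_n -> R) x v :
  (forall i, differentiable (f i) x) ->
  differentiable (fun y => \sum_i f i y) x /\
  'D_v (fun y => \sum_i f i y) x = \sum_i 'D_v (f i) x.
Proof.
move=> df; rewrite /index_enum; elim: (locked_with _ _) => [|i s [IH1 IH2]].
  have -> : (fun y => \sum_(i <- [::]) f i y) = (fun=> 0) by apply/funext => y; rewrite big_nil.
  by rewrite big_nil derive_cst; split=> //; exact: differentiable_cst.
have -> : (fun y => \sum_(j <- i :: s) f j y) = f i + (fun y => \sum_(j <- s) f j y).
  by apply/funext => y; rewrite big_cons.
split; first exact: differentiableD.
by rewrite deriveD ?IH2 ?big_cons//; exact: diff_derivable.
Qed.

Lemma derive_mul3 n (f g h : 'rV[R]_n -> R) x v :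
  differentiable f x -> differentiable g x -> differentiable h x ->
  differentiable (fun y => f y * g y * h y) x /\
  'D_v (fun y => f y * g y * h y) x =
    'D_v f x * g x * h x + f x * 'D_v g x * h x + f x * g x * 'D_v h x.
Proof.
move=> df dg dh.
have dfg : differentiable (f * g) x by exact: differentiableM.
split; first exact: (differentiableM dfg dh).
have -> : (fun y => f y * g y * h y) = (f * g) * h by [].
rewrite deriveM; [|exact: diff_derivable..].
rewrite deriveM; [|exact: diff_derivable..].
have -> : (f * g) x = f x * g x by [].
rewrite /GRing.scale/=.
by move: ('D_v f x) ('D_v g x) ('D_v h x) => a b d; ring.
Qed.

Section Pullback.
Variables (M : manifold R) (w : form2 M) (p : nat) (P : 'rV[R]_p -> M) (z0 : 'rV[R]_p).
Hypothesis fw : is_form2 w.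
Hypothesis sP : \forall z \near z0, @smap_at _ (euclid R p) M P z.

Definition push (z v : 'rV[R]_p) : vec M := @Tmap R (euclid R p) M P z (evec z v).

(** P^*w on two constant vectors, as a function of the point. Constant fields on R^p commute, so the
    exterior derivative of P^*w is an alternating sum of derivatives of such functions. *)
Definition pull (u v : 'rV[R]_p) (z : 'rV[R]_p) : R := w (P z) (push z u) (push z v).

Variable c : chart R M (dim M).
Hypotheses (ac : atlas c) (cz : cdom c (P z0)).

Let F (z : 'rV[R]_p) : 'rV[R]_(dim M) := cmap c (P z).
Let f i j (z : 'rV[R]_p) : R := w (P z) (cvec c (P z) 'e_i) (cvec c (P z) 'e_j).

Lemma near_chart : \forall z \near z0, cdom c (P z).
Proof.
by have [cP _] := nbhs_singleton sP; apply: cP; exact: near_cdom.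
Qed.

Lemma smooth_near_push_coord i : smooth_near (fun z => F z 0 i) z0.
Proof. by have [_] := nbhs_singleton sP; move/(_ (euclid_chart R p) c erefl ac I cz i). Qed.

Lemma pull_near u v : \forall z \near z0,
  pull u v z = \sum_i \sum_j 'D_u (fun y => F y 0 i) z * 'D_v (fun y => F y 0 j) z * f i j z.
Proof.
have H : \forall z \near z0, forall i, smooth_near (fun y => F y 0 i) z.
  by apply: near_forall => i; exact: smooth_near_nbhs (smooth_near_push_coord i).
have sP' := sP; have cP' := near_chart.
move: sP' cP' H; apply: filterS3 => z sz cz' sF.
rewrite /pull /push !(Tmap_evec _ sz ac cz') (form2_cvec_sum fw ac)//.
apply: eq_bigr => i _; apply: eq_bigr => j _.
by rewrite -!derive_jac//; exact: smooth_near_differentiable.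
Qed.

Lemma smooth_near_f i j : smooth_near (f i j) z0.
Proof.
have /smap_atP[_ H] := nbhs_singleton sP.
apply/smooth_at_euclid; apply: (H (fun q => w q (cvec c q 'e_i) (cvec c q 'e_j))).
exact: smooth_at_form2_cvec.
Qed.

Lemma smooth_near_pull u v : smooth_near (pull u v) z0.
Proof.
apply: (@smooth_near_eq _ _ (fun z => \sum_i \sum_j
  'D_u (fun y => F y 0 i) z * 'D_v (fun y => F y 0 j) z * f i j z)).
  by apply: filterS (pull_near u v) => z ->.
apply: smooth_near_sum => i; apply: smooth_near_sum => j; apply: smooth_nearM.
  by apply: smooth_nearM; apply: smooth_near_derive; exact: smooth_near_push_coord.
exact: smooth_near_f.
Qed.

(** The second derivative of P read in the chart [c]. It is not intrinsic, but it is symmetric in s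
    and u. *)
Definition hess (s u : 'rV[R]_p) : vec M :=
  cvec c (P z0) (\row_i 'D_s ('D_u (fun y => F y 0 i)) z0).

Lemma push_coord u : push z0 u = cvec c (P z0) (u *m jac F z0).
Proof. by rewrite /push (Tmap_evec _ (nbhs_singleton sP) ac cz). Qed.

(** Product rule for the coordinate expression of [pull]: the first term differentiates the
    coefficients of w along P, the pushed vectors being kept constant in the chart; the other two
    differentiate these vectors. *)
Lemma derive_pull s u v :
  'D_s (pull u v) z0 =
  push z0 s (fun q => w q (cvec c q (u *m jac F z0)) (cvec c q (v *m jac F z0))) +
  w (P z0) (hess s u) (push z0 v) + w (P z0) (push z0 u) (hess s v).
Proof.
rewrite (near_eq_derive _ (pull_near u v)).
have d1 u' i := smooth_near_differentiable (smooth_near_derive u' (smooth_near_push_coord i)).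
have d0 i := smooth_near_differentiable (smooth_near_push_coord i).
have df i j := smooth_near_differentiable (smooth_near_f i j).
have d3 i j := derive_mul3 s (d1 u i) (d1 v j) (df i j).
have d2 i := derive_sum_fun s (fun j => (d3 i j).1).
rewrite (derive_sum_fun s (fun i => (d2 i).1)).2.
have -> : push z0 s (fun q => w q (cvec c q (u *m jac F z0)) (cvec c q (v *m jac F z0))) =
    \sum_i \sum_j (u *m jac F z0) 0 i * (v *m jac F z0) 0 j * 'D_s (f i j) z0.
  rewrite /push TmapE; last exact: smooth_at_form2_cvec.
  have sq : smooth_near (fun z =>
      w (P z) (cvec c (P z) (u *m jac F z0)) (cvec c (P z) (v *m jac F z0))) z0.
    have /smap_atP[_ H] := nbhs_singleton sP.
    apply/smooth_at_euclid.
    exact: (H _ (smooth_at_form2_cvec fw ac (u *m jac F z0) (v *m jac F z0) cz)).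
  rewrite evecE; last exact: sq.
  rewrite (@near_eq_derive _ _ _ _ (fun z => \sum_i \sum_j
    (u *m jac F z0) 0 i * (v *m jac F z0) 0 j * f i j z)); last first.
    by apply: filterS near_chart => z cz' /=; rewrite (form2_cvec_sum fw ac).
  have dk (a b : R) i j : differentiable (fun z => a * b * f i j z) z0 /\
      'D_s (fun z => a * b * f i j z) z0 = a * b * 'D_s (f i j) z0.
    by split; [exact: (differentiableZ _ (df i j))|exact: (deriveZ _ (diff_derivable (df i j)))].
  have dk2 i := derive_sum_fun s (fun j => (dk ((u *m jac F z0) 0 i) ((v *m jac F z0) 0 j) i j).1).
  rewrite (derive_sum_fun s (fun i => (dk2 i).1)).2.
  apply: eq_bigr => i _; rewrite (dk2 i).2; apply: eq_bigr => j _.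
  exact: (dk _ _ i j).2.
have hessE s' u' : exists2 h : 'rV[R]_(dim M), hess s' u' = cvec c (P z0) h &
    forall i, h 0 i = 'D_s' ('D_u' (fun y => F y 0 i)) z0.
  by exists (\row_i 'D_s' ('D_u' (fun y => F y 0 i)) z0) => // i; rewrite mxE.
have jacE u' i : (u' *m jac F z0) 0 i = 'D_u' (fun y => F y 0 i) z0.
  by rewrite -derive_jac//; exact: d0.
have [hu -> huE] := hessE s u; have [hv -> hvE] := hessE s v.
rewrite !push_coord !(form2_cvec_sum fw ac)// -!big_split/=; apply: eq_bigr => i _.
rewrite (d2 i).2 -!big_split/=; apply: eq_bigr => j _.
rewrite (d3 i j).2 !jacE huE hvE -/(f i j z0).
move: (f i j z0) ('D_s (f i j) z0) ('D_s ('D_u (fun y => F y 0 i)) z0)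
  ('D_s ('D_v (fun y => F y 0 j)) z0) ('D_u (fun y => F y 0 i) z0)
  ('D_v (fun y => F y 0 j) z0) => a1 a2 a3 a4 a5 a6.
by ring.
Qed.

Lemma hess_sym s u : hess s u = hess u s.
Proof.
suff E : \row_i 'D_s ('D_u (fun y => F y 0 i)) z0 = \row_i 'D_u ('D_s (fun y => F y 0 i)) z0.
  exact: (f_equal (cvec c (P z0)) E).
apply/rowP => i; rewrite [LHS]mxE [RHS]mxE.
by apply: derive_sym; exact: smooth_near_push_coord.
Qed.

Lemma hess_tangent s u : tangent (P z0) (hess s u).
Proof. exact: cvec_tangent. Qed.

Lemma push_tangent u : tangent (P z0) (push z0 u).
Proof. by rewrite push_coord; exact: cvec_tangent. Qed.

(* The fields with constant coordinates that extend the pushed vectors at P z0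
   commute; what distinguishes P^*w from their pairing is the Hessian of P, which
   drops out by symmetry. *)
Lemma pull_d (e : form3 M) u v s : is_d2 w e ->
  'D_u (pull v s) z0 - 'D_v (pull u s) z0 + 'D_s (pull u v) z0 =
  e (P z0) (push z0 u) (push z0 v) (push z0 s).
Proof.
move=> we.
have [X XE] : exists X, X = (fun (a : 'rV[R]_p) q => cvec c q (a *m jac F z0)) by eexists.
have sX a : smooth_vf (X a) (P z0) by rewrite XE; exact: smooth_vf_cvec.
have lE a b : lie (X a) (X b) (P z0) = 0 by rewrite XE; exact: (lie_cvec ac _ _ cz).
have pE a : X a (P z0) = push z0 a by rewrite push_coord XE.
pose W a b := fun q => w q (X a q) (X b q).
have dE a b d : 'D_a (pull b d) z0 = push z0 a (W b d) +
    w (P z0) (hess a b) (push z0 d) + w (P z0) (push z0 b) (hess a d).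
  by rewrite derive_pull /W XE.
have tp := push_tangent; have th := hess_tangent.
have d2E : d2 w (X u) (X v) (X s) (P z0) =
    push z0 u (W v s) - push z0 v (W u s) + push z0 s (W u v).
  rewrite /d2 !lE.
  rewrite !pE.
  rewrite !(form20l fw (tp _)).
  by rewrite !subr0 addr0.
have K := we (P z0) (X u) (X v) (X s) (sX u) (sX v) (sX s).
rewrite d2E !pE in K; apply: etrans K.
rewrite (dE u v s) (dE v u s) (dE s u v).
rewrite (hess_sym v u) (hess_sym s u) (hess_sym s v) (form2N fw (tp v) (th u s)).
move: (push z0 u _) (push z0 v _) (push z0 s _) => a b d.
by ring.
Qed.

End Pullback.
End PullbackOfForms.

(** * Submersions in straightened coordinates *)

Section SubmersionCharts.
Variable R : realType.

Lemma near_and (T : topologicalType) (x : T) (P Q : T -> Prop) :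
  (\forall y \near x, P y) -> (\forall y \near x, Q y) ->
  \forall y \near x, P y /\ Q y.
Proof. exact: filterI. Qed.

Lemma derive_mulmx n p q (G : 'rV[R]_n -> 'rV[R]_p) (A : 'M[R]_(p, q)) x v j :
  (forall k, differentiable (fun u => G u 0 k : R) x) ->
  differentiable (fun u => (G u *m A) 0 j : R) x /\
  'D_v (fun u => (G u *m A) 0 j : R) x = (v *m jac G x *m A) 0 j.
Proof.
move=> dG.
have E : (fun u => (G u *m A) 0 j : R) = (fun u => \sum_k A k j * G u 0 k).
  by apply/funext => u; rewrite mxE; apply: eq_bigr => k _; rewrite mulrC.
have dk k : differentiable (fun u => A k j * G u 0 k : R) x.
  exact: (differentiableZ (A k j) (dG k)).
have [d1 d2] := derive_sum_fun v dk.
rewrite E; split; first exact: d1.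
rewrite d2 mxE; apply: eq_bigr => k _.
rewrite -derive_jac; last exact: dG.
rewrite [RHS]mulrC; exact: (deriveZ (A k j) (diff_derivable (dG k))).
Qed.

Lemma jac_comp n p q (G : 'rV[R]_n -> 'rV[R]_p) (F : 'rV[R]_p -> 'rV[R]_q) x :
  (forall k, differentiable (fun u => G u 0 k : R) x) ->
  (forall k, differentiable (fun u => F u 0 k : R) (G x)) ->
  jac (fun u => F (G u)) x = jac G x *m jac F (G x).
Proof.
move=> dG dF; apply/matrixP => i j; rewrite [LHS]mxE [RHS]mxE.
have := derive_comp_row_sum 'e_i dG (dF j); rewrite /comp => ->.
by apply: eq_bigr => k _; rewrite !mxE.
Qed.

Lemma jac_near_eq n p (F G : 'rV[R]_n -> 'rV[R]_p) x :
  (\near x, F x = G x) -> jac F x = jac G x.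
Proof.
move=> FG; apply/matrixP => i j; rewrite !mxE; apply: near_eq_derive.
by apply: filterS FG => y ->.
Qed.

Lemma jac_mulmx n p (A : 'M[R]_(n, p)) x : jac (fun u => u *m A) x = A.
Proof.
apply/matrixP => i j; rewrite mxE.
have dc k : differentiable (fun u : 'rV[R]_n => u 0 k : R) x by exact: differentiable_coord.
have [_ ->] := derive_mulmx A 'e_i j dc.
have -> : jac (fun u : 'rV[R]_n => u) x = 1%:M.
  apply/matrixP => a b; rewrite mxE -(derive_row (G := id))// derive_id.
  by rewrite !mxE eqxx eq_sym.
by rewrite mulmx1 -rowE mxE.
Qed.

(** Surjectivity of Ts lifts each basis vector of the target, and the lifts are the rows of Q. *)
Lemma submersion_section (H N : manifold R) (s : H -> N) g c c' :
  submersion s -> atlas c -> cdom c g -> atlas c' -> cdom c' (s g) ->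
  exists Q, Q *m jac (fun u => cmap c' (s (cinv c u))) (cmap c g) = 1%:M.
Proof.
move=> [sms surj] ac cg ac' cg'.
set J := jac _ _.
have ex j : exists a : 'rV[R]_(dim H), a *m J = 'e_j.
  have [v tv E] := surj g _ (cvec_tangent ac' cg' 'e_j).
  exists (\row_i v (fun y => cmap c y 0 i)).
  apply: (cvec_inj ac' cg'); rewrite -E [in RHS](tangent_cvec ac cg tv).
  by rewrite (Tmap_cvec _ (sms g) ac cg ac' cg').
have [a aJ] := choice ex.
exists (\matrix_j a j); apply/row_matrixP => j.
by rewrite row_mul rowK aJ row1.
Qed.

(* With J the Jacobian of s in charts and Q J = 1, straighten s by the map
   theta(u) = s(u) Q + (u - u0) (1 - J Q): its derivative at u0 is the identity
   and theta(u) J = s(u), so that s is linear in the coordinates theta. *)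
Lemma submersion_param (H N : manifold R) (s : H -> N) (g : H) : submersion s ->
  exists (P : 'rV[R]_(dim H) -> H) (J : 'M[R]_(dim H, dim N)) (Q : 'M[R]_(dim N, dim H))
    (z0 : 'rV[R]_(dim H)) (r : R),
  0 < r /\ P z0 = g /\ Q *m J = 1%:M /\
  (\forall h \near g, exists2 z, `|z - z0| < r & P z = h) /\
  forall z : 'rV[R]_(dim H), `|z - z0| < r ->
    [/\ @smap_at R (euclid R (dim H)) H P z,
      forall v, tangent (P z) v -> exists a, v = push P z a,
      forall z', `|z' - z0| < r -> s (P z) = s (P z') <-> z *m J = z' *m J
    & forall a, Tmap s (P z) (push P z a) = 0 <-> a *m J = 0].
Proof.
move=> ss; have [sms _] := ss.
have [c ac cg] := atlas_cover g; have [c' ac' cg'] := atlas_cover (s g).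
have [Q QJ] := submersion_section ss ac cg ac' cg'.
set u0 := cmap c g in QJ; pose S u := cmap c' (s (cinv c u)).
rewrite -/S in QJ; set J := jac S u0 in QJ.
pose K := 1%:M - J *m Q.
pose theta (u : 'rV[R]_(dim H)) := S u *m Q + (u - u0) *m K.
have thJ u : theta u *m J = S u.
  have KJ : K *m J = 0 by rewrite /K mulmxBl mul1mx -mulmxA QJ mulmx1 subrr.
  by rewrite /theta mulmxDl -!mulmxA QJ KJ mulmx1 mulmx0 addr0.
have sS i : smooth_near (fun u => S u 0 i) u0 by have [_] := sms g; exact.
have cS : \forall u \near u0, cdom c' (s (cinv c u)).
  have [cs _] := sms g.
  have : \forall y \near g, cdom c' (s y) by apply: cs; exact: near_cdom.
  exact: near_cinv.
have sth i : smooth_near (fun u => theta u 0 i) u0.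
  have -> : (fun u => theta u 0 i) =
      (fun u => \sum_k S u 0 k * Q k i + \sum_k (u 0 k + (- u0 0 k)) * K k i).
    apply/funext => u; rewrite mxE; congr (_ + _); rewrite mxE//.
    by apply: eq_bigr => k _; rewrite !mxE.
  apply: smooth_nearD; apply: smooth_near_sum => k; apply: smooth_nearM;
    try exact: smooth_near_cst; first exact: sS.
  by apply: smooth_nearD; [exact: smooth_near_coord|exact: smooth_near_cst].
have dth : jac theta u0 = 1%:M.
  have d1 i := smooth_near_differentiable (sS i).
  have d2 i : differentiable (fun u : 'rV[R]_(dim H) => (u - u0) 0 i : R) u0.
    apply: smooth_near_differentiable; under eq_fun do rewrite !mxE.
    by apply: smooth_nearD; [exact: smooth_near_coord|exact: smooth_near_cst].
  have jid : jac (fun u : 'rV[R]_(dim H) => u - u0) u0 = 1%:M.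
    apply/matrixP => i j; rewrite mxE.
    have -> : (fun u : 'rV[R]_(dim H) => (u - u0) 0 j : R) =
       (fun u => u 0 j : R) + (fun=> - u0 0 j).
      by apply/funext => u; rewrite !mxE.
    rewrite deriveD; [|by apply: diff_derivable; exact: differentiable_coord|exact: derivable_cst].
    rewrite derive_cst addr0 -(derive_row (G := id))// derive_id.
    by rewrite !mxE eqxx eq_sym.
  apply/matrixP => i j; rewrite mxE.
  have -> : (fun u => theta u 0 j : R) =
     (fun u => (S u *m Q) 0 j : R) + (fun u => ((u - u0) *m K) 0 j : R).
    by apply/funext => u; rewrite mxE.
  have [e1 e2] := derive_mulmx Q 'e_i j d1; have [e3 e4] := derive_mulmx K 'e_i j d2.
  rewrite deriveD; [|exact: diff_derivable..].
  rewrite e2 e4 jid mulmx1 -mulmxA -/J.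
  have -> (X Y : 'M[R]_(1, dim H)) : X 0 j + Y 0 j = (X + Y) 0 j by rewrite mxE.
  by rewrite -mulmxDr /K addrC subrK mulmx1 !mxE eqxx eq_sym.
have [G [sG Gu0 thG Gth]] := inverse_function sth dth.
pose z0 := theta u0; rewrite -/z0 in sG Gu0 thG.
pose P z := cinv c (G z).
have cG : {for z0, continuous G}.
  by apply: continuous_row => i; exact: smooth_near_continuous (sG i).
have toG (T : 'rV[R]_(dim H) -> Prop) : (\forall u \near u0, T u) -> \forall z \near z0, T (G z).
  by move=> HT; apply: cG; rewrite Gu0.
(* All these conditions hold at z0 and persist nearby; a ball where they hold has the radius r of
   the conclusion. *)
have near_all : \forall z \near z0,
    ((forall i, smooth_near (fun v => G v 0 i) z) /\ (\near z, theta (G z) = z)) /\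
    ((\forall u \near G z, (cmap c @` cdom c) u) /\
     (forall i, smooth_near (fun u => theta u 0 i) (G z))) /\
    (\forall u \near G z, cdom c' (s (cinv c u))).
  have n1 : \forall z \near z0, forall i, smooth_near (fun v => G v 0 i) z.
    by apply: near_forall => i; exact: smooth_near_nbhs (sG i).
  have n2 := near_join thG.
  have n3 := toG _ (near_join (near_cim cg)).
  have n4 : \forall z \near z0, forall i, smooth_near (fun u => theta u 0 i) (G z).
    apply: (toG (fun u => forall i, smooth_near (fun y => theta y 0 i) u)).
    by apply: near_forall => i; exact: smooth_near_nbhs (sth i).
  have n5 := toG _ (near_join cS).
  exact: near_and (near_and n1 n2) (near_and (near_and n3 n4) n5).
have [r r0 Hr] := nbhs_rV_ball near_all.
exists P, J, Q, z0, r; split=> //; split; first by rewrite /P Gu0 cmapK.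
split=> //; split.
  have cth : {for u0, continuous theta}.
    by apply: continuous_row => i; exact: smooth_near_continuous (sth i).
  have n0 : \forall v \near theta u0, `|v - z0| < r.
    by apply/nbhs_normP; exists r => // y; rewrite /ball_/= distrC.
  have n1 : \forall u \near u0, `|theta u - z0| < r := cth _ n0.
  move: (near_cmap cg n1) (near_cmap cg Gth) (near_cdom cg); apply: filterS3 => h h1 h2 ch.
  by exists (theta (cmap c h)) => //; rewrite /P h2 cmapK.
move=> z /Hr [[sGz thGz] [[imG sthG] cSz]].
have cGz : {for z, continuous G}.
  by apply: continuous_row => i; exact: smooth_near_continuous (sGz i).
have imz := nbhs_singleton imG.
have near_im : \forall y \near z, (cmap c @` cdom c) (G y) := cGz _ imG.
have near_cs : \forall y \near z, cdom c' (s (P y)) := cGz _ cSz.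
have PJ y : theta (G y) = y -> y *m J = cmap c' (s (P y)).
  by move=> e; rewrite -{1}e thJ.
have smP : @smap_at R (euclid R (dim H)) H P z.
  apply: (@smap_at_euclid _ _ _ _ _ c).
  - apply: (@continuous_comp _ _ _ G (cinv c)) => //.
    exact: cinv_cont.
  - by [].
  - exact: cdom_cinv.
  - move=> i; apply: smooth_near_eq (sGz i).
    by apply: filterS near_im => y imy; rewrite /P cinvK.
have csz : cdom c' (s (P z)) by exact: nbhs_singleton near_cs.
have cPz : cdom c (P z) by exact: cdom_cinv.
have jG : jac (fun y => cmap c (P y)) z = jac G z.
  by apply: jac_near_eq; apply: filterS near_im => y imy; rewrite /P cinvK.
split=> //.
(* theta \o G is the identity near z, so the Jacobian of G is invertible and the vectors
   [push P z a] fill the tangent space at P z. *)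
- have unitG : jac G z \in unitmx.
    have : jac G z *m jac theta (G z) = 1%:M.
      rewrite -jac_comp; [|by move=> k; exact: smooth_near_differentiable (sGz k)
        |by move=> k; exact: smooth_near_differentiable (sthG k)].
      rewrite (jac_near_eq (G := fun u => u *m 1%:M)) ?jac_mulmx//.
      by apply: filterS thGz => y ->; rewrite mulmx1.
    by case/mulmx1_unit.
  move=> v tv; exists ((\row_i v (fun y => cmap c y 0 i)) *m invmx (jac G z)).
  rewrite /push (Tmap_evec _ smP ac cPz) jG mulmxKV//.
  exact: (tangent_cvec ac cPz tv).
- move=> z' /Hr [[_ thGz'] [_ cSz']].
  have e1 := PJ _ (nbhs_singleton thGz); have e2 := PJ _ (nbhs_singleton thGz').
  rewrite e1 e2; split=> [-> //|E].
  by rewrite -(cmapK csz) E cmapK//; exact: nbhs_singleton cSz'.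
- move=> a.
  have smsP : @smap_at R (euclid R (dim H)) N (s \o P) z.
    exact: (@smap_at_comp R (euclid R (dim H)) H N P s z smP (sms (P z))).
  (* In the chart c' the map s \o P is y |-> y J near z, so its Jacobian is J. *)
  have -> : Tmap s (P z) (push P z a) = cvec c' (s (P z)) (a *m J).
    rewrite /push -(@Tmap_comp R (euclid R (dim H)) H N P s z); last exact: sms.
    rewrite (Tmap_evec _ smsP ac' csz).
    have -> // : jac (fun u => cmap c' ((s \o P) u)) z = J.
    rewrite -(jac_mulmx J z); apply: jac_near_eq.
    by apply: filterS thGz => y /PJ ->.
  split=> [E|->].
    apply: (cvec_inj ac' csz); rewrite E.
    have := cvec_linear ac' csz (-1) 0 0.
    by rewrite scaler0 addr0 scaleN1r addNr.
  have := cvec_linear ac' csz (-1) 0 0.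
  by rewrite scaler0 addr0 scaleN1r addNr.
Qed.

End SubmersionCharts.

(** * Multiplicative forms *)

Section Groupoids.
Variable R : realType.

Lemma restrE (V : lmodType R) (S : set V) a v : S v -> restr S a v = a v :> R.
Proof. by move=> Sv; rewrite /restr patchT// inE. Qed.

Lemma restrN (V : lmodType R) (S : set V) a v : ~ S v -> restr S a v = 0 :> R.
Proof. by move=> Sv; rewrite /restr patchN//; apply/negP; rewrite inE. Qed.

Section Pairs.
Variables (M : manifold R) (G : lie_groupoid M).

Lemma pairs_lift (Q : manifold R) (a b : Q -> G) :
  smooth_map a -> smooth_map b -> (forall q, src (a q) = tgt (b q)) ->
  exists r : Q -> pairs G, [/\ smooth_map r, (fun q => pr1 (r q)) = a & (fun q => pr2 (r q)) = b].
Proof.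
move=> sa sb ab; have [_ _ _ H] := pairs_fibre_product G.
have [r [[sr r1 r2] _]] := H Q a b sa sb ab.
by exists r; split=> //; apply/funext.
Qed.

(** Two points with equal projections are two constant lifts of one pair of constant maps, which
    uniqueness in the fibre product identifies. The constant maps are taken on [pairs G] itself,
    inhabited by z. *)
Lemma pairs_inj (z z' : pairs G) : pr1 z = pr1 z' -> pr2 z = pr2 z' -> z = z'.
Proof.
move=> e1 e2; have [_ _ st H] := pairs_fibre_product G.
have cst (Q : manifold R) (y : G) : smooth_map (fun _ : Q => y) := fun q => smap_at_cst y q.
have [r [_ ur]] := H (pairs G) _ _ (cst _ (pr1 z)) (cst _ (pr2 z)) (fun=> st z).
have u1 : r = (fun=> z) by apply: ur; split=> // q; exact: smap_at_cst.
have u2 : r = (fun=> z') by apply: ur; split=> // q; exact: smap_at_cst.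
by have := congr1 (@^~ z) u1; rewrite u2.
Qed.

Lemma smooth_mul (Q : manifold R) (a b : Q -> G) :
  smooth_map a -> smooth_map b -> (forall q, src (a q) = tgt (b q)) ->
  smooth_map (fun q => mul (a q) (b q)).
Proof.
move=> sa sb ab; have [r [sr <- <-]] := pairs_lift sa sb ab.
move=> q; apply: (@smap_at_comp _ _ _ _ r (@mult _ _ G) q (sr q)).
exact: mul_smooth.
Qed.

End Pairs.

(** Multiplicativity without the manifold [pairs], tested on composable pairs of maps from an
    arbitrary manifold; explicit families of arrows can be substituted. *)
Definition multiplicative (M : manifold R) (G : lie_groupoid M) (w : form2 G) :=
  forall (Q : manifold R) (a b : Q -> G),
    smooth_map a -> smooth_map b -> (forall q, src (a q) = tgt (b q)) ->
    forall q u v, tangent q u -> tangent q v ->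
    w (mul (a q) (b q)) (Tmap (fun y => mul (a y) (b y)) q u)
                        (Tmap (fun y => mul (a y) (b y)) q v) =
    w (a q) (Tmap a q u) (Tmap a q v) + w (b q) (Tmap b q u) (Tmap b q v).

Section OneGroupoid.
Variables (M : manifold R) (G : lie_groupoid M).

Lemma smap_src g : smap_at (@src _ _ G) g.
Proof. by have [+ _] := src_submersion G; exact. Qed.

Lemma smap_tgt g : smap_at (@tgt _ _ G) g.
Proof. by have [+ _] := tgt_submersion G; exact. Qed.

Lemma smap_unit x : smap_at (unit G) x.
Proof. exact: unit_smooth. Qed.

Lemma pr1_smooth z : smap_at (@pr1 _ _ G) z.
Proof. by have [+ _ _ _] := pairs_fibre_product G; exact. Qed.

Lemma pr2_smooth z : smap_at (@pr2 _ _ G) z.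
Proof. by have [_ + _ _] := pairs_fibre_product G; exact. Qed.

Lemma multiplicativeP (w : form2 G) :
  eq2 (pull2 (@mult _ _ G) w)
    (fun z u v => pull2 (@pr1 _ _ G) w z u v + pull2 (@pr2 _ _ G) w z u v) ->
  multiplicative w.
Proof.
move=> hw Q a b sa sb ab q u v tu tv.
have [r [sr ra rb]] := pairs_lift sa sb ab.
have := hw (r q) _ _ (Tmap_tangent (sr q) tu) (Tmap_tangent (sr q) tv).
have E (f : pairs G -> G) t : (forall z, smap_at f z) ->
    Tmap f (r q) (Tmap r q t) = Tmap (fun y => f (r y)) q t.
  by move=> sf; rewrite -Tmap_comp.
have mE : (fun y => mult (r y)) = (fun y => mul (a y) (b y)) by rewrite -ra -rb.
rewrite /pull2 !(E (@mult _ _ G)); [|exact: mul_smooth|exact: mul_smooth].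
rewrite !(E (@pr1 _ _ G)); [|exact: pr1_smooth|exact: pr1_smooth].
rewrite !(E (@pr2 _ _ G)); [|exact: pr2_smooth|exact: pr2_smooth].
rewrite mE ra rb -[mult _]/((fun y => mult (r y)) q) mE.
by rewrite -[pr1 _]/((fun y => pr1 (r y)) q) ra -[pr2 _]/((fun y => pr2 (r y)) q) rb.
Qed.

Lemma Tsrc_unit x X : tangent x X -> Tmap (@src _ _ G) (unit G x) (Tmap (unit G) x X) = X.
Proof.
move=> tX; rewrite -Tmap_comp; last exact: smap_src.
rewrite (_ : _ \o _ = fun y => y) ?Tmap_id//.
by apply/funext => y; exact: src_unit.
Qed.

Lemma Ttgt_unit x X : tangent x X -> Tmap (@tgt _ _ G) (unit G x) (Tmap (unit G) x X) = X.
Proof.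
move=> tX; rewrite -Tmap_comp; last exact: smap_tgt.
rewrite (_ : _ \o _ = fun y => y) ?Tmap_id//.
by apply/funext => y; exact: tgt_unit.
Qed.

Lemma tangent_unit x X : tangent x X -> tangent (unit G x) (Tmap (unit G) x X).
Proof. by move=> tX; apply: Tmap_tangent => //; exact: smap_unit. Qed.

Lemma tangent_tgt x u : tangent (unit G x) u -> tangent x (Tmap (@tgt _ _ G) (unit G x) u).
Proof.
by move=> tu; rewrite -{1}(tgt_unit G x); apply: Tmap_tangent => //; exact: smap_tgt.
Qed.

Lemma tangent_src x u : tangent (unit G x) u -> tangent x (Tmap (@src _ _ G) (unit G x) u).
Proof.
by move=> tu; rewrite -{1}(src_unit G x); apply: Tmap_tangent => //; exact: smap_src.
Qed.

Lemma split_src x v : tangent (unit G x) v ->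
  exists X v', [/\ tangent x X, @algd R _ G x v' & v = Tmap (unit G) x X + v'].
Proof.
move=> tv; have tX := tangent_src tv.
exists (Tmap (@src _ _ G) (unit G x) v), (v - Tmap (unit G) x (Tmap (@src _ _ G) (unit G x) v)).
split=> //; last by rewrite addrC subrK.
split; first by apply: tangentB => //; exact: tangent_unit.
by rewrite TmapB Tsrc_unit// subrr.
Qed.

Lemma split_tgt x v : tangent (unit G x) v ->
  exists v', [/\ tangent (unit G x) v', Tmap (@tgt _ _ G) (unit G x) v' = 0
   & v = Tmap (unit G) x (Tmap (@tgt _ _ G) (unit G x) v) + v'].
Proof.
move=> tv; have tX := tangent_tgt tv.
exists (v - Tmap (unit G) x (Tmap (@tgt _ _ G) (unit G x) v)).
split; last by rewrite addrC subrK.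
  by apply: tangentB => //; exact: tangent_unit.
by rewrite TmapB Ttgt_unit// subrr.
Qed.

Lemma algd0 x : @algd R _ G x 0.
Proof. by split; [exact: tangent0|exact: Tmap0]. Qed.

Lemma algd_linear x a u v : @algd R _ G x u -> @algd R _ G x v -> @algd R _ G x (a *: u + v).
Proof.
move=> [tu su] [tv sv]; split; first exact: tangent_linear.
by rewrite Tmap_linear su sv scaler0 addr0.
Qed.

Lemma anchor_tangent x u : @algd R _ G x u -> tangent x (anchor x u).
Proof. by move=> [tu _]; exact: tangent_tgt. Qed.

Section Form.
Variable w : form2 G.
Hypothesis fw : is_form2 w.
Hypothesis mw : eq2 (pull2 (@mult _ _ G) w)
    (fun z u v => pull2 (@pr1 _ _ G) w z u v + pull2 (@pr2 _ _ G) w z u v).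

(* u = Tm(u, 0) and v = Tm(0, v) with both pairs tangent at (1_x, 1_x). *)
Lemma form_src_tgt x u v : @algd R _ G x u -> tangent (unit G x) v ->
  Tmap (@tgt _ _ G) (unit G x) v = 0 -> w (unit G x) u v = 0.
Proof.
move=> [tu su] tv tgv.
have sid : smooth_map (fun g : G => g) by move=> g; exact: smap_at_id.
have sus : smooth_map (fun g : G => unit G (src g)).
  by move=> g; apply: (@smap_at_comp _ _ _ _ _ (unit G) g (smap_src g)); exact: smap_unit.
have sut : smooth_map (fun g : G => unit G (tgt g)).
  by move=> g; apply: (@smap_at_comp _ _ _ _ _ (unit G) g (smap_tgt g)); exact: smap_unit.
have [r [sr r1 r2]] := pairs_lift sid sus (fun g => esym (tgt_unit G (src g))).
have [r' [sr' r'1 r'2]] := pairs_lift sut sid (fun g => src_unit G (tgt g)).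
have e1 g : pr1 (r g) = g := congr1 (@^~ g) r1.
have e2 g : pr2 (r g) = unit G (src g) := congr1 (@^~ g) r2.
have e'1 g : pr1 (r' g) = unit G (tgt g) := congr1 (@^~ g) r'1.
have e'2 g : pr2 (r' g) = g := congr1 (@^~ g) r'2.
have rr' : r (unit G x) = r' (unit G x).
  by apply: pairs_inj; rewrite ?e1 ?e2 ?e'1 ?e'2 ?src_unit ?tgt_unit.
have mr : (@mult _ _ G) \o r = (fun g => g).
  by apply/funext => g; rewrite /= /mult e1 e2 mul_unitr.
have mr' : (@mult _ _ G) \o r' = (fun g => g).
  by apply/funext => g; rewrite /= /mult e'1 e'2 mul_unitl.
have tr' : tangent (r (unit G x)) (Tmap r' (unit G x) v).
  by rewrite rr'; exact: Tmap_tangent.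
have := mw (Tmap_tangent (sr _) tu) tr'.
have mE : mult (r (unit G x)) = unit G x := congr1 (@^~ (unit G x)) mr.
rewrite /pull2 mE e1 e2 src_unit.
rewrite -[Tmap _ _ (Tmap r _ u)]Tmap_comp; last exact: mul_smooth.
rewrite mr Tmap_id// rr'.
rewrite -[Tmap _ _ (Tmap r' _ v)]Tmap_comp; last exact: mul_smooth.
rewrite mr' Tmap_id// => ->.
have -> : Tmap (@pr1 _ _ G) (r' (unit G x)) (Tmap r' (unit G x) v) = 0.
  rewrite -Tmap_comp; last exact: pr1_smooth.
  rewrite (_ : _ \o _ = unit G \o (@tgt _ _ G)); last by apply/funext => g; exact: e'1.
  by rewrite Tmap_comp ?tgv ?Tmap0//; exact: smap_unit.
have -> : Tmap (@pr2 _ _ G) (r' (unit G x)) (Tmap r (unit G x) u) = 0.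
  rewrite -rr' -Tmap_comp; last exact: pr2_smooth.
  rewrite (_ : _ \o _ = unit G \o (@src _ _ G)); last by apply/funext => g; exact: e2.
  by rewrite Tmap_comp ?su ?Tmap0//; exact: smap_unit.
have -> : Tmap (@pr1 _ _ G) (r' (unit G x)) (Tmap r (unit G x) u) = u.
  rewrite -rr' -Tmap_comp; last exact: pr1_smooth.
  by rewrite (_ : _ \o _ = fun y => y) ?Tmap_id//; apply/funext => g; exact: e1.
have -> : Tmap (@pr2 _ _ G) (r' (unit G x)) (Tmap r' (unit G x) v) = v.
  rewrite -Tmap_comp; last exact: pr2_smooth.
  by rewrite (_ : _ \o _ = fun y => y) ?Tmap_id//; apply/funext => g; exact: e'2.
by rewrite form20r// form20l// addr0.
Qed.

Lemma lambdaE x u X : tangent x X -> lambda w x u X = w (unit G x) u (Tmap (unit G) x X).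
Proof. exact: restrE. Qed.

(** v differs from T1(Tt v) by a vector of ker Tt, which is w-orthogonal to A_G. Thus lambda(u)
    determines i_u w on the whole tangent space at the unit. *)
Lemma form_lambda x u v : @algd R _ G x u -> tangent (unit G x) v ->
  w (unit G x) u v = lambda w x u (Tmap (@tgt _ _ G) (unit G x) v).
Proof.
move=> Au tv; have tX := tangent_tgt tv; rewrite lambdaE//.
have [v' [tv' gv' {1}->]] := split_tgt tv.
rewrite (form2Dr fw)//; [|exact: tangent_unit|by case: Au].
by rewrite (form_src_tgt Au tv' gv') addr0.
Qed.

(** Isotropy of L for the canonical pairing, from the antisymmetry of the form. *)
Lemma lambda_isotropic x u v : @algd R _ G x u -> @algd R _ G x v ->
  lambda w x u (anchor x v) + lambda w x v (anchor x u) = 0.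
Proof.
move=> Au Av; have [tu _] := Au; have [tv _] := Av.
by rewrite -!form_lambda// (form2N fw tu tv) addNr.
Qed.

Lemma lambda_linear x a u v : @algd R _ G x u -> @algd R _ G x v ->
  lambda w x (a *: u + v) = (fun X => a * lambda w x u X + lambda w x v X).
Proof.
move=> [tu _] [tv _]; apply/funext => X; have [tX|nX] := pselect (tangent x X).
  by rewrite !lambdaE// (form2P fw)//; exact: tangent_unit.
by rewrite /lambda !restrN// mulr0 addr0.
Qed.

Lemma lambda_cotangent x u : @algd R _ G x u -> cotangent x (lambda w x u).
Proof.
move=> [tu _]; split=> [c X Y tX tY|X nX]; last by rewrite /lambda restrN.
rewrite !lambdaE//; last exact: tangent_linear.
by rewrite Tmap_linear (form2Pr fw)//; exact: tangent_unit.
Qed.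

(** By [form_lambda] the difference of u and v lies in the kernel of the form, and in those of Ts
    and Tt, so the nondegeneracy [nd] applies to it. *)
Lemma anchor_lambda_inj
  (nd : forall (x : M) (u : vec G), tangent (unit G x) u ->
        Tmap (@src _ _ G) (unit G x) u = 0 ->
        (forall v, tangent (unit G x) v -> w (unit G x) u v = 0) ->
        Tmap (@tgt _ _ G) (unit G x) u = 0 -> u = 0) x u v :
  @algd R _ G x u -> @algd R _ G x v -> anchor x u = anchor x v ->
  lambda w x u = lambda w x v -> u = v.
Proof.
move=> Au Av auv luv.
have Auv : @algd R _ G x (u - v).
  by rewrite addrC -scaleN1r; exact: algd_linear.
apply/eqP; rewrite -subr_eq0; apply/eqP; have [t s] := Auv.
apply: (nd x) => // [X tX|]; last by rewrite TmapB; apply/eqP; rewrite subr_eq0; exact/eqP.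
rewrite form_lambda// addrC -scaleN1r lambda_linear// luv; ring.
Qed.

End Form.
End OneGroupoid.

Lemma smap_euclid n p (K : 'rV[R]_n -> 'rV[R]_p) q :
  (forall i, smooth_near (fun y => K y 0 i) q) -> @smap_at R (euclid R n) (euclid R p) K q.
Proof.
move=> sK; apply: (@smap_at_euclid _ _ (euclid R p) K q (euclid_chart R p)) => //.
by apply: continuous_row => i; exact: smooth_near_continuous (sK i).
Qed.

Lemma push_comp n p (M' : manifold R) (K : 'rV[R]_n -> 'rV[R]_p) (P : 'rV[R]_p -> M') q a :
  (forall i, smooth_near (fun y => K y 0 i) q) -> @smap_at R (euclid R p) M' P (K q) ->
  push (fun y => P (K y)) q a = push P (K q) (a *m jac K q).
Proof.
move=> sK sP; rewrite /push.
rewrite (@Tmap_comp R (euclid R n) (euclid R p) M' K P q)//; congr Tmap.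
exact: (@Tmap_evec _ n (euclid R p) K q a (euclid_chart R p) (smap_euclid sK)).
Qed.

(** A rational function of each coordinate, bounded by e and with derivative e at 0: precomposition
    with it turns a map given on a ball into one on all of R^n, and multiplies its first derivatives
    at the centre by e. *)
Definition shrink n (e : R) (q : 'rV[R]_n) : 'rV[R]_n :=
  \row_i (e * (q 0 i / (1 + q 0 i * q 0 i))).

Lemma shrink_pos (t : R) : 0 < 1 + t * t.
Proof. by rewrite ltr_wpDr// -expr2 sqr_ge0. Qed.

Lemma shrink_bound n (e : R) (q : 'rV[R]_n) : 0 <= e -> `|shrink e q| <= e.
Proof.
move=> e0; apply: norm_le_coord => // i; rewrite mxE normrM ger0_norm//.
apply: ler_piMr => //; rewrite normrM normfV (gtr0_norm (shrink_pos _)).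
rewrite ler_pdivrMr ?shrink_pos// mul1r.
have := sqr_ge0 (`|q 0 i| - 1); have := normr_ge0 (q 0 i).
have -> : q 0 i * q 0 i = `|q 0 i| * `|q 0 i| by rewrite -normrM ger0_norm// -expr2 sqr_ge0.
by move: `|q 0 i| => t ? ?; nra.
Qed.

Lemma smooth_near_shrink n (e : R) (q : 'rV[R]_n) i : smooth_near (fun y => shrink e y 0 i) q.
Proof.
under eq_fun do rewrite mxE.
apply: smooth_nearM; first exact: smooth_near_cst.
apply: smooth_nearM; first exact: smooth_near_coord.
apply: smooth_nearV; first by rewrite gt_eqF// shrink_pos.
apply: smooth_nearD; first exact: smooth_near_cst.
by apply: smooth_nearM; exact: smooth_near_coord.
Qed.

Lemma shrink0 n (e : R) : shrink e (0 : 'rV[R]_n) = 0.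
Proof. by apply/rowP => i; rewrite !mxE mul0r mulr0. Qed.

(** e t / (1 + t^2) differs from e t by a term of third order in t. *)
Lemma jac_shrink0 n (e : R) : jac (shrink e) (0 : 'rV[R]_n) = e%:M.
Proof.
apply/matrixP => i j; rewrite mxE.
have [d1 d2] : differentiable (fun y : 'rV[R]_n => shrink e y 0 j : R) 0 /\
    forall v, 'D_v (fun y : 'rV[R]_n => shrink e y 0 j : R) 0 =
      \sum_k v 0 k * (if k == j then e else 0).
  apply: differentiable_bound => d d0.
  have m0 : 0 < Num.min 1 (d / (`|e| + 1)).
    by rewrite lt_min ltr01 divr_gt0// ltr_wpDl.
  apply/nbhs_normP; exists (Num.min 1 (d / (`|e| + 1))) => // h.
  rewrite /ball_/= sub0r normrN lt_min => /andP[h1 h2].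
  rewrite addr0 shrink0 [X in _ - (X + _)]mxE add0r (bigD1 j)//= eqxx big1 ?addr0; last first.
    by move=> k /negbTE ->; rewrite mulr0.
  rewrite mxE; set t := h 0 j.
  have -> : e * (t / (1 + t * t)) - t * e = - (e * t * (t * t / (1 + t * t))).
    by field; rewrite gt_eqF// shrink_pos.
  have th : `|t| <= `|h| := coord_le_norm h j.
  rewrite normrN !normrM normfV (gtr0_norm (shrink_pos t)).
  apply: (@le_trans _ _ (`|e| * `|t| * `|t|)).
    rewrite ler_wpM2l ?mulr_ge0// ler_pdivrMr ?shrink_pos//.
    have t1 : `|t| <= 1 by rewrite (le_trans th)// ltW.
    have -> : t * t = `|t| * `|t| by rewrite -normrM ger0_norm// -expr2 sqr_ge0.
    have := normr_ge0 t; move: `|t| t1 => s ? ?; nra.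
  apply: (@le_trans _ _ (`|e| * `|h| * `|h|)).
    by rewrite ler_pM// ?mulr_ge0// ler_wpM2l.
  rewrite ler_wpM2r// (@le_trans _ _ ((`|e| + 1) * `|h|))//.
    by rewrite ler_wpM2r// lerDl.
  by rewrite mulrC -ler_pdivlMr ?ltr_wpDl// ltW.
rewrite d2 (bigD1 j)//= eqxx big1 ?addr0; last by move=> k /negbTE ->; rewrite mulr0.
by rewrite !mxE eqxx/= mulr_natl eq_sym.
Qed.

End Groupoids.

(** * Closed multiplicative forms that vanish along the units *)

Section VanishingTheorem.
Variable R : realType.

Section Vanishing.
Variables (N : manifold R) (H : lie_groupoid N) (Om : form2 H).
Hypothesis Om_linear : forall g (c : R) u u' v, tangent g u -> tangent g u' ->
  tangent g v -> Om g (c *: u + u') v = c * Om g u v + Om g u' v.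
Hypothesis Om_anti : forall g u v, tangent g u -> tangent g v -> Om g u v = - Om g v u.
Hypothesis Om_mult : multiplicative Om.
Hypothesis Om_unit : forall y u v, @algd R _ H y u -> tangent (unit H y) v -> Om (unit H y) u v = 0.
Hypothesis Om_base : forall y X Y, tangent y X -> tangent y Y ->
  Om (unit H y) (Tmap (unit H) y X) (Tmap (unit H) y Y) = 0.
(** Closedness on maps from R^p and constant vectors; differentiability of the coefficients is
    included for the mean value theorem along segments. *)
Hypothesis Om_closed : forall p (P : 'rV[R]_p -> H) (z0 : 'rV[R]_p),
  (\forall z \near z0, @smap_at R (euclid R p) H P z) ->
  (forall u v, differentiable (pull Om P u v) z0) /\
  forall u v s, 'D_u (pull Om P v s) z0 - 'D_v (pull Om P u s) z0 + 'D_s (pull Om P u v) z0 = 0.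

Lemma Om0l g v : tangent g v -> Om g 0 v = 0.
Proof.
move=> tv; have := Om_linear 1 (tangent0 g) (tangent0 g) tv.
by rewrite scaler0 addr0 mul1r -[X in X = _]addr0 => /addrI.
Qed.


(* Let b be a local section of s through g. Writing k = (k b(s k)^-1) b(s k) for k
   near g shows that u = Tm(u', 0) with u' tangent to the s-fibre at the unit.
   The maps in Om_mult are defined on whole manifolds, hence the reparametrization
   of the chart by the bounded map shrink. *)
Lemma Om_vertical g u v : tangent g u -> Tmap (@src _ _ H) g u = 0 -> tangent g v ->
  Om g u v = 0.
Proof.
move=> tu su tv; set n := dim H.
have [P [J [Q [z0 [r [r0 [Pz0 [QJ [_ HP]]]]]]]]] := submersion_param g (src_submersion H).
have z00 : `|z0 - z0| < r by rewrite subrr normr0.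
have [smz surj _ vert] := HP z0 z00.
rewrite Pz0 in surj vert.
have [a' ua] := surj u tu; have [b' vb] := surj v tv.
have a'J : a' *m J = 0 by apply/vert; rewrite -ua.
pose C := \sum_i \sum_j `|(J *m Q) i j|.
have C0 : 0 <= C by apply: sumr_ge0 => i _; apply: sumr_ge0.
(* Small enough that [K1] and [K2], at distance at most e and e C from z0, take values in the ball
   of radius r. *)
pose e := r / (C + 2).
have e0 : 0 < e by rewrite divr_gt0// ltr_wpDl.
have eC : e * (C + 2) = r by rewrite /e divfK// gt_eqF// ltr_wpDl.
have er : e < r by rewrite -eC; nra.
have eCr : e * C < r by rewrite -eC; nra.
pose K1 (q : 'rV[R]_n) := z0 + shrink e q.
(* J Q is a projection with kernel ker J, and J Q J = J. Hence [P (K2 q)] has the source of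
   [P (K1 q)] and depends on q only through it: this is b(s k) for k = [P (K1 q)]. *)
pose K2 (q : 'rV[R]_n) := z0 + shrink e q *m (J *m Q).
have K1r q : `|K1 q - z0| < r.
  by rewrite /K1 addrC addKr; apply: le_lt_trans er; apply: shrink_bound; exact: ltW.
have K2r q : `|K2 q - z0| < r.
  rewrite /K2 addrC addKr; apply: le_lt_trans eCr.
  apply: (le_trans (norm_mulmx_le _ _)); apply: ler_wpM2r => //.
  by apply: shrink_bound; exact: ltW.
have sK1 q i : smooth_near (fun y => K1 y 0 i) q.
  under eq_fun do rewrite mxE.
  by apply: smooth_nearD; [exact: smooth_near_cst|exact: smooth_near_shrink].
have sK2 q i : smooth_near (fun y => K2 y 0 i) q.
  under eq_fun do rewrite mxE.
  apply: smooth_nearD; [exact: smooth_near_cst|].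
  by apply: smooth_near_mulmx => j; exact: smooth_near_shrink.
have jK1 : jac K1 0 = e%:M.
  rewrite -(jac_shrink0 n e); apply/matrixP => i j; rewrite !mxE.
  have -> : (fun y => K1 y 0 j : R) = (fun=> z0 0 j) + (fun y => shrink e y 0 j : R).
    by apply/funext => y; rewrite mxE.
  rewrite deriveD; [by rewrite derive_cst add0r|exact: derivable_cst|].
  by apply: diff_derivable; apply: smooth_near_differentiable; exact: smooth_near_shrink.
have jK2 : jac K2 0 = e%:M *m (J *m Q).
  have ds i := smooth_near_differentiable (smooth_near_shrink e (0 : 'rV[R]_n) i).
  rewrite -(jac_shrink0 n e); apply/matrixP => i j; rewrite mxE.
  have [d1 d2] := derive_mulmx (J *m Q) (delta_mx 0 i) j ds.
  have -> : (fun y => K2 y 0 j : R) =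
      (fun=> z0 0 j) + (fun y => (shrink e y *m (J *m Q)) 0 j : R).
    by apply/funext => y; rewrite mxE.
  rewrite deriveD; [rewrite derive_cst add0r d2|exact: derivable_cst|exact: diff_derivable].
  by rewrite -mulmxA -rowE mxE.
pose Pt (q : euclid R n) : H := P (K1 q).
pose b (q : euclid R n) : H := P (K2 q).
have sPt : smooth_map Pt.
  move=> q; have [smq _ _ _] := HP _ (K1r q).
  exact: (@smap_at_comp _ (euclid R n) (euclid R n) H K1 P q (smap_euclid (sK1 q)) smq).
have sb : smooth_map b.
  move=> q; have [smq _ _ _] := HP _ (K2r q).
  exact: (@smap_at_comp _ (euclid R n) (euclid R n) H K2 P q (smap_euclid (sK2 q)) smq).
have srcPb q : src (Pt q) = src (b q).
  have [_ _ H3 _] := HP _ (K1r q); apply/(H3 _ (K2r q)).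
  by rewrite /K1 /K2 !mulmxDl -!mulmxA QJ mulmx1.
have sib : smooth_map (fun q => inv (b q)).
  move=> q; apply: (@smap_at_comp _ _ _ _ b (@inv _ _ H) q (sb q)).
  exact: inv_smooth.
pose a (q : euclid R n) : H := mul (Pt q) (inv (b q)).
have abib q : src (Pt q) = tgt (inv (b q)) by rewrite tgt_inv.
have sa : smooth_map a := smooth_mul sPt sib abib.
have ab q : src (a q) = tgt (b q) by rewrite /a src_mul// src_inv.
have abP : (fun q => mul (a q) (b q)) = Pt.
  apply/funext => q; rewrite /a -mulA//; last by rewrite src_inv.
  by rewrite mulVg -srcPb mul_unitr.
have K10 : K1 0 = z0 by rewrite /K1 shrink0 addr0.
have K20 : K2 0 = z0 by rewrite /K2 shrink0 mul0mx addr0.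
have Pt0 : Pt 0 = g by rewrite /Pt K10.
have b0 : b 0 = g by rewrite /b K20.
have a0 : a 0 = unit H (tgt g) by rewrite /a Pt0 b0 mulgV.
have te (d : 'rV[R]_n) : @tangent R (euclid R n) 0 (evec 0 d) by exact: evec_tangent.
(* The factor e^-1 cancels the derivative e of [shrink] at 0. Along the vertical vector a' the map b
   is constant to first order, so the term at b(0) vanishes. *)
have := Om_mult sa sb ab (te (e^-1 *: a')) (te (e^-1 *: b')).
have en0 : e != 0 by rewrite gt_eqF.
have TPt d : Tmap Pt 0 (evec 0 (e^-1 *: d)) = push P z0 d.
  have := @push_comp _ _ _ H K1 P 0 (e^-1 *: d) (sK1 0).
  rewrite K10 => /(_ smz); rewrite jK1 mul_mx_scalar scalerA divff// scale1r; exact.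
have Tb d : Tmap b 0 (evec 0 (e^-1 *: d)) = push P z0 (d *m (J *m Q)).
  have := @push_comp _ _ _ H K2 P 0 (e^-1 *: d) (sK2 0).
  rewrite K20 => /(_ smz); rewrite jK2 mul_scalar_mx -scalemxAr -scalemxAl scalerA divff//.
  by rewrite scale1r.
have push0 : push P z0 0 = 0.
  rewrite /push; have := evec_linear z0 (-1) 0 0.
  by rewrite scaler0 addr0 scaleN1r addNr => ->; rewrite Tmap0.
have Tba : Tmap b 0 (evec 0 (e^-1 *: a')) = 0.
  by rewrite Tb mulmxA a'J mul0mx.
have mP0 : mul (a 0) (b 0) = g by rewrite -Pt0 -abP.
rewrite abP !TPt Tba mP0 -ua -vb => ->.
rewrite Om0l ?addr0; last by apply: Tmap_tangent.
have Ta d : tangent (unit H (tgt g)) (Tmap a 0 (evec 0 d)).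
  by rewrite -a0; exact: (Tmap_tangent (sa 0) (te d)).
rewrite a0; apply: Om_unit; last exact: Ta.
split; first exact: Ta.
(* The image under Ta is tangent to the s-fibre because s a = t b and Tb kills the vertical
   vector. *)
rewrite -a0 -(@Tmap_comp _ _ _ _ a (@src _ _ H)); last exact: smap_src.
rewrite (_ : _ \o _ = (@tgt _ _ H) \o b); last by apply/funext => q; exact: ab.
by rewrite Tmap_comp ?Tba ?Tmap0//; exact: smap_tgt.
Qed.

Definition Om_zero g := forall u v, tangent g u -> tangent g v -> Om g u v = 0.

(** At a unit, TH is the sum of TN and A_H; [Om_unit] covers the pairs that involve A_H and
    [Om_base] the remaining ones. *)
Lemma Om_zero_unit y : Om_zero (unit H y).
Proof.
move=> u v tu tv.
have [X [u' [tX Au' uE]]] := split_src tu; have [Y [v' [tY Av' vE]]] := split_src tv.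
have tX' := tangent_unit H tX; have tY' := tangent_unit H tY.
have [tu' _] := Au'; have [tv' _] := Av'.
rewrite uE -[Tmap _ _ X]scale1r Om_linear// (Om_unit Au' tv) addr0 mul1r.
rewrite Om_anti// vE -[Tmap _ _ Y]scale1r Om_linear// (Om_unit Av' tX') Om_base//.
by rewrite mulr0 addr0 oppr0.
Qed.

(** In coordinates where s is linear, two points of one s-fibre in the ball are joined by a segment
    that stays in the fibre and in the ball. *)
Lemma Om_zero_near (g : H) : exists U : set H, nbhs g U /\
  forall h h', U h -> U h' -> src h = src h' -> Om_zero h -> Om_zero h'.
Proof.
have [P [J [Q [z0 [r [r0 [Pz0 [_ [cov HP]]]]]]]]] := submersion_param g (src_submersion H).
exists [set h | exists2 z, `|z - z0| < r & P z = h]; split; first exact: cov.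
move=> _ _ [z zr <-] [z' z'r <-] szz' Z.
pose h := z' - z.
have hJ : h *m J = 0.
  by have [_ _ HJ _] := HP z zr; rewrite /h mulmxBl (HJ z' z'r).1 ?subrr.
have smn y : `|y - z0| < r -> \forall w \near y, @smap_at R (euclid R (dim H)) H P w.
  by move=> yr; apply: filterS (near_ball_rV yr) => w wr; have [] := HP w wr.
have tpush y a : `|y - z0| < r -> tangent (P y) (push P y a).
  by move=> yr; have [sm _ _ _] := HP y yr; apply: (Tmap_tangent sm); exact: evec_tangent.
have pull_h y a : `|y - z0| < r -> pull Om P h a y = 0.
  move=> yr; apply: Om_vertical; [exact: tpush| |exact: tpush].
  by have [_ _ _ vert] := HP y yr; apply/vert.
have Dh a b y : `|y - z0| < r -> 'D_h (pull Om P a b) y = 0.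
  move=> yr; have [_ cl] := Om_closed (smn y yr).
  have D0 a' b' : 'D_a' (pull Om P h b') y = 0.
    rewrite (@near_eq_derive _ _ _ _ (fun=> 0)) ?derive_cst//.
    by apply: filterS (near_ball_rV yr) => w wr; exact: pull_h.
  (* Two of the three terms are derivatives of coefficients with h as an entry, which are
     identically 0 near y. *)
  have := cl h a b; by rewrite (D0 a b) (D0 b a) subr0 addr0.
have const a b : pull Om P a b z' = pull Om P a b z.
  have zh : z + h = z' by rewrite /h addrC subrK.
  have seg (c : R) : 0 <= c <= 1 -> `|z + c *: h - z0| < r := ball_segment zr z'r.
  have [c c01 E] : exists2 c : R, 0 <= c <= 1 &
      pull Om P a b (z + h) - pull Om P a b z = 'D_h (pull Om P a b) (z + c *: h).
    apply: MVT_line => c c01.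
    by have [df _] := Om_closed (smn _ (seg c c01)); exact: df.
  rewrite (Dh a b _ (seg c c01)) zh in E.
  by apply/eqP; rewrite -subr_eq0; exact/eqP.
move=> u v tu tv.
have [_ surj _ _] := HP z' z'r; have [a ->] := surj u tu; have [b ->] := surj v tv.
rewrite -[LHS]/(pull Om P a b z') const; apply: Z; exact: tpush.
Qed.

(** Connectedness of [0, 1]: by [Om_zero_near], vanishing and non-vanishing of Om at y(t) are both
    open conditions on t. *)
Lemma Om_zero_path x (y : R -> H) : path_in [set g : H | src g = x] y ->
  Om_zero (y 0) -> Om_zero (y 1).
Proof.
move=> [cy sy] Z0.
have I01 (t : R) : `[0, 1]%classic t = (0 <= t <= 1) by rewrite /= in_itv.
have loc (t : R) : exists2 e : R, 0 < e &
    (0 <= t <= 1 -> forall t', 0 <= t' <= 1 -> `|t - t'| < e ->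
    (Om_zero (y t) <-> Om_zero (y t'))).
  (* Outside [0, 1] the condition is vacuous and 1 is a default, so that the radius can be chosen as
     a function on the whole line. *)
  have [t01|nt] := boolP (0 <= t <= 1); last by exists 1.
  have [U [Ut HU]] := Om_zero_near (y t).
  have /(_ t) := (subspace_continuousP _ _).1 cy; rewrite I01 => /(_ t01 U Ut).
  move=> /nbhs_ballP[e /= e0 He]; exists e => // _ t' t'01 tt'.
  have yU t'' : 0 <= t'' <= 1 -> `|t - t''| < e -> U (y t'').
    by move=> t''01 h; apply: He => //; rewrite I01.
  have Uyt : U (y t) by apply: yU => //; rewrite subrr normr0.
  have Uyt' : U (y t') := yU t' t'01 tt'.
  have s1 : src (y t) = x by apply: sy; rewrite I01.
  have s2 : src (y t') = x by apply: sy; rewrite I01.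
  by split; apply: HU => //; rewrite s1 s2.
pose near_t (t e : R) := 0 < e /\ (0 <= t <= 1 -> forall t', 0 <= t' <= 1 ->
    `|t - t'| < e -> (Om_zero (y t) <-> Om_zero (y t'))).
have ex t : exists e, near_t t e by have [e e0 h] := loc t; exists e.
have [e He] := choice ex.
pose B := [set t : R | 0 <= t <= 1 /\ Om_zero (y t)].
have BE : B = `[0, 1]%classic.
  apply: (@segment_connected R 0 1).
  - by exists 0; split=> //; rewrite lexx ler01.
  - exists (\bigcup_(t in B) ball t (e t)).
      by apply: bigcup_open => t _; apply: ball_open; have [] := He t.
    apply/seteqP; split=> [t Bt|t [t01 [s [s01 Zs] /= st]]].
      split; first by rewrite I01; have [] := Bt.
      by exists t => //; apply: ballxx; have [] := He t.
    rewrite I01 in t01; split=> //; have [_ H1] := He s.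
    by apply/(H1 s01 t t01 st).
  - pose B' := [set t : R | 0 <= t <= 1 /\ ~ Om_zero (y t)].
    exists (~` (\bigcup_(t in B') ball t (e t))).
      apply: open_closedC.
      by apply: bigcup_open => t _; apply: ball_open; have [] := He t.
    apply/seteqP; split=> [t [t01 Zt]|t [t01 nt]].
      split; first by rewrite I01.
      move=> [s [s01 nZs] /= st]; apply: nZs.
      by have [_ H1] := He s; apply/(H1 s01 t t01 st).
    rewrite I01 in t01; split=> //; apply: contrapT => nZ; apply: nt.
    by exists t => //; apply: ballxx; have [] := He t.
have : B 1 by rewrite BE I01 lexx ler01.
by case.
Qed.

Theorem multiplicative_form_vanishes : source_simply_connected H -> forall g, Om_zero g.
Proof.
move=> ssc g; have [_ conn _] := ssc (src g).
have [y [py y0 y1]] := conn (unit H (src g)) g (src_unit H (src g)) erefl.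
by rewrite -y1; apply: (Om_zero_path py); rewrite y0; exact: Om_zero_unit.
Qed.

End Vanishing.
End VanishingTheorem.

(** * Dimension counts *)

Section Frames.
Variable R : realType.

(** A basis given as a linear injection of row vectors onto S, so that linear maps become matrices
    and matrix rank can be used. *)
Definition frame (V : lmodType R) (S : set V) k (r : 'rV[R]_k -> V) : Prop :=
  [/\ forall c u v, r (c *: u + v) = c *: r u + r v,
      forall u, r u = 0 -> u = 0 & S = range r].

(** Forms, and with them [lambda], are linear only on tangent vectors, so linearity is asked on a
    subspace only. *)
Definition lin_on (V W : lmodType R) (S : set V) (f : V -> W) : Prop :=
  forall c u v, S u -> S v -> f (c *: u + v) = c *: f u + f v.

Lemma linear_fun0 (V W : lmodType R) (f : V -> W) :
  (forall c u v, f (c *: u + v) = c *: f u + f v) -> f 0 = 0.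
Proof. by move=> lf; have := lf (-1) 0 0; rewrite scaler0 addr0 scaleN1r addNr. Qed.

Lemma linear_rV (V : lmodType R) k (f : 'rV[R]_k -> V) u :
  (forall c u v, f (c *: u + v) = c *: f u + f v) ->
  f u = \sum_i u 0 i *: f 'e_i.
Proof.
move=> lf; rewrite {1}(row_sum_delta u) /index_enum; elim: (locked_with _ _) => [|i s IH].
  by rewrite !big_nil linear_fun0.
by rewrite !big_cons lf IH.
Qed.

Lemma has_dim_frame (V : lmodType R) (S : set V) k :
  has_dim S k <-> exists r, frame S r (k := k).
Proof.
split=> [[b [bfree SE]]|[r [lr ri SE]]].
  exists (fun c => \sum_i c 0 i *: b i); split.
  - move=> c u v; rewrite scaler_sumr -big_split/=; apply: eq_bigr => i _.
    by rewrite !mxE scalerDl scalerA.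
  - by move=> u /bfree u0; apply/rowP => i; rewrite u0 mxE.
  - rewrite SE; apply/seteqP; split=> v /= [c].
      by move=> ->; exists (\row_i c i) => //; apply: eq_bigr => i _; rewrite mxE.
    by move=> _ <-; exists (fun i => c 0 i).
exists (fun i => r 'e_i); split.
  move=> c; have -> : \sum_i c i *: r 'e_i = r (\row_i c i).
    by rewrite linear_rV//; apply: eq_bigr => i _; rewrite mxE.
  by move=> /ri/rowP E i; have := E i; rewrite !mxE.
rewrite SE; apply/seteqP; split=> v /= [c].
  by move=> _ <-; exists (fun i => c 0 i); rewrite linear_rV.
move=> ->; exists (\row_i c i) => //.
by rewrite linear_rV//; apply: eq_bigr => i _; rewrite mxE.
Qed.

Section OneFrame.
Variables (V : lmodType R) (S : set V) (k : nat) (r : 'rV[R]_k -> V).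
Hypothesis fr : frame S r.

Lemma frame_linear c u v : r (c *: u + v) = c *: r u + r v.
Proof. by case: fr. Qed.

Lemma frame_in u : S (r u).
Proof. by case: fr => _ _ ->; exists u. Qed.

Lemma frame_surj v : S v -> exists u, r u = v.
Proof. by case: fr => _ _ -> [u _ <-]; exists u. Qed.

Lemma frame_inj u v : r u = r v -> u = v.
Proof.
move=> E; apply/eqP; rewrite -subr_eq0; apply/eqP; case: fr => _ ri _; apply: ri.
by rewrite addrC -scaleN1r frame_linear E scaleN1r addNr.
Qed.

Lemma frame_coord : exists ka : V -> 'rV[R]_k, forall u, ka (r u) = u.
Proof.
have ex v : exists u, S v -> r u = v.
  have [Sv|nSv] := pselect (S v); last by exists 0.
  by have [u <-] := frame_surj Sv; exists u.
have [ka Hka] := choice ex; exists ka => u.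
by apply: frame_inj; apply: Hka; exact: frame_in.
Qed.

Lemma frame_matrix (W : lmodType R) (T : set W) l (r' : 'rV[R]_l -> W) (f : V -> W) :
  frame T r' -> lin_on S f -> (forall v, S v -> T (f v)) ->
  exists A : 'M[R]_(k, l), forall u, f (r u) = r' (u *m A).
Proof.
move=> fr' lf fT; have [lr' _ TE] := fr'.
have ex i : exists a, r' a = f (r 'e_i).
  by have := fT _ (frame_in 'e_i); rewrite TE => -[a _ <-]; exists a.
have [a Ha] := choice ex.
exists (\matrix_i a i) => u.
have l1 c u' v' : f (r (c *: u' + v')) = c *: f (r u') + f (r v').
  by rewrite frame_linear lf//; exact: frame_in.
have l2 c u' v' : r' ((c *: u' + v') *m \matrix_i a i) =
    c *: r' (u' *m \matrix_i a i) + r' (v' *m \matrix_i a i).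
  by rewrite mulmxDl -scalemxAl lr'.
rewrite (linear_rV u l1) (linear_rV u l2); apply: eq_bigr => i _.
by rewrite -rowE rowK Ha.
Qed.

Lemma frame_sub p (A : 'M[R]_(p, k)) : row_free A ->
  frame [set r (u *m A) | u in setT] (fun u => r (u *m A)).
Proof.
move=> fA; split=> // [c u v|u ru0].
  by rewrite mulmxDl -scalemxAl frame_linear.
have uA : u *m A = 0 by case: fr => _ ri _; exact: ri.
by apply/eqP; rewrite -(mulmx_free_eq0 _ fA) uA.
Qed.

End OneFrame.

Lemma has_dim_image_inj (V W : lmodType R) (S : set V) k (f : V -> W) :
  has_dim S k -> lin_on S f -> (forall v, S v -> f v = 0 -> v = 0) ->
  has_dim (f @` S) k.
Proof.
move=> /has_dim_frame[r fr] lf fi; apply/has_dim_frame; exists (f \o r); split.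
- by move=> c u v /=; rewrite (frame_linear fr) lf//; exact: (frame_in fr).
- move=> u /= /(fi _ (frame_in fr u)); by case: fr => _ ri _; exact: ri.
- case: fr => _ _ ->; apply/seteqP; split=> w /= [v].
    by move=> [u _ <-] <-; exists u.
  by move=> _ <-; exists (r v) => //; exists v.
Qed.

(** Rank-nullity: in a frame of the image the matrix of f is row full, so its [kermx] has rank n -
    m. *)
Lemma has_dim_ker (V W : lmodType R) (S : set V) n m (f : V -> W) :
  has_dim S n -> lin_on S f -> has_dim (f @` S) m ->
  has_dim [set v | S v /\ f v = 0] (n - m).
Proof.
move=> /has_dim_frame[r fr] lf /has_dim_frame[r' fr'].
have [A HA] := frame_matrix fr fr' lf (fun v Sv => ex_intro2 _ _ v Sv erefl).
have [lr' ri' _] := fr'.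
have fA : row_full A.
  have ex i : exists u, u *m A = 'e_i :> 'rV[R]_m.
    have [v Sv E] : (f @` S) (r' 'e_i) by exact: frame_in.
    have [u ru] := frame_surj fr Sv; exists u; apply: (frame_inj fr').
    by rewrite -HA ru.
  have [u Hu] := choice ex; apply/row_fullP; exists (\matrix_i u i).
  by apply/row_matrixP => i; rewrite row_mul rowK Hu row1.
have rk : \rank (kermx A) = (n - m)%N by rewrite mxrank_ker (eqP fA).
apply/has_dim_frame; rewrite -rk.
exists (fun u => r (u *m row_base (kermx A))).
have fb : row_free (row_base (kermx A)) by exact: row_base_free.
have [l1 l2 _] := frame_sub fr fb; split=> //.
apply/seteqP; split=> [v [Sv fv0]|_ [u _ <-]] /=; last first.
  split; first exact: (frame_in fr).
  rewrite HA -mulmxA; have -> : row_base (kermx A) *m A = 0.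
    by apply/sub_kermxP; rewrite eq_row_base.
  by rewrite mulmx0 linear_fun0.
have [u ru] := frame_surj fr Sv.
have uA : (u <= row_base (kermx A))%MS.
  by rewrite eq_row_base; apply/sub_kermxP; apply: ri'; rewrite -HA ru.
by have /submxP[d dE] := uA; exists d => //; rewrite -dE.
Qed.

(** f is injective on a complement of its kernel, which has dimension n - k and the same image as
    S. *)
Lemma has_dim_image_ker (V W : lmodType R) (S : set V) n k (f : V -> W) :
  has_dim S n -> lin_on S f -> has_dim [set v | S v /\ f v = 0] k ->
  has_dim (f @` S) (n - k).
Proof.
move=> /has_dim_frame[r fr] lf /has_dim_frame[r' fr'].
have ker_lin : lin_on [set v | S v /\ f v = 0] id by [].
have [A HA] := frame_matrix fr' fr ker_lin (fun v Kv => Kv.1).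
have fA : row_free A.
  apply: inj_row_free => u uA; have [_ ri' _] := fr'; apply: ri'.
  by rewrite -[r' u]/(id (r' u)) HA uA linear_fun0//; case: fr.
have rk : \rank A^C = (n - k)%N by rewrite mxrank_compl (eqP fA).
apply/has_dim_frame; rewrite -rk.
exists (fun u => f (r (u *m row_base A^C%MS))).
have lfr c u v : f (r (c *: u + v)) = c *: f (r u) + f (r v).
  by rewrite (frame_linear fr) lf//; exact: (frame_in fr).
split.
- by move=> c u v; rewrite mulmxDl -scalemxAl lfr.
- move=> u fu0.
  have [d rd] : exists d, r' d = r (u *m row_base A^C%MS).
    by apply: (frame_surj fr'); split=> //; exact: (frame_in fr).
  have E : d *m A = u *m row_base A^C%MS.
    by apply: (frame_inj fr); rewrite -HA.
  have : (u *m row_base A^C%MS <= A :&: A^C)%MS.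
    by rewrite sub_capmx -{1}E submxMl (submx_trans (submxMl _ _))// eq_row_base.
  rewrite capmx_compl submx0 mulmx_free_eq0 ?row_base_free//.
  by move/eqP.
- apply/seteqP; split=> [w [v Sv <-]|_ [u _ <-]] /=; last first.
    by exists (r (u *m row_base A^C%MS)) => //; exact: (frame_in fr).
  have [u ru] := frame_surj fr Sv.
  have : (u <= A + A^C)%MS by rewrite submx_full// addsmx_compl_full.
  move=> /sub_addsmxP[[d1 d2] /= uE].
  have : (d2 *m A^C <= row_base A^C)%MS by rewrite eq_row_base submxMl.
  move=> /submxP[d dE]; exists d => //; rewrite -dE -ru uE.
  have := lfr 1 (d1 *m A) (d2 *m A^C%MS); rewrite !scale1r => ->.
  rewrite -HA; have [_ ->] := frame_in fr' d1.
  by rewrite add0r.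
Qed.

Lemma has_dim_eq (V : lmodType R) (S T : set V) k :
  has_dim S k -> has_dim T k -> S `<=` T -> S = T.
Proof.
move=> /has_dim_frame[r fr] /has_dim_frame[r' fr'] ST.
have id_lin : lin_on S id by [].
have [A HA] := frame_matrix fr fr' id_lin ST.
have uA : A \in unitmx.
  apply: unitmx_inj => u uA; have [_ ri _] := fr; apply: ri.
  by rewrite -[r u]/(id (r u)) HA uA linear_fun0//; case: fr'.
apply/seteqP; split=> // v /(frame_surj fr')[u <-].
by rewrite -(mulmxKV uA u) -HA; exact: (frame_in fr).
Qed.

Lemma has_dim_setX (V W : lmodType R) (S : set V) (T : set W) n m :
  has_dim S n -> has_dim T m -> has_dim (S `*` T) (n + m).
Proof.
move=> /has_dim_frame[r [lr ri SE]] /has_dim_frame[r' [lr' ri' TE]].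
apply/has_dim_frame; exists (fun u => (r (lsubmx u), r' (rsubmx u))); split.
- by move=> c u v; rewrite !linearP lr lr'.
- move=> u [/ri u1 /ri' u2]; rewrite -[u]hsubmxK u1 u2.
  by rewrite row_mx0.
- rewrite SE TE; apply/seteqP; split=> [[v w] [[u _ /= <-] [u' _ /= <-]]|_ [u _ <-]].
    by exists (row_mx u u') => //; rewrite row_mxKl row_mxKr.
  by split; [exists (lsubmx u)|exists (rsubmx u)].
Qed.

Lemma frame_dual (V : lmodType R) (S : set V) k (r : 'rV[R]_k -> V) : frame S r ->
  forall y : 'cV[R]_k, exists2 a, lin_dual S a & forall u, a (r u) = (u *m y) 0 0.
Proof.
move=> fr y; have [ka Hka] := frame_coord fr.
exists (restr S (fun v => (ka v *m y) 0 0)); last first.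
  by move=> u; rewrite restrE ?Hka//; exact: (frame_in fr).
split=> [c v w Sv Sw|v nSv]; last exact: restrN.
have [u ru] := frame_surj fr Sv; have [u' ru'] := frame_surj fr Sw.
rewrite -ru -ru' -(frame_linear fr) !restrE ?Hka; [|exact: (frame_in fr)..].
by rewrite mulmxDl -scalemxAl !mxE.
Qed.

Lemma lin_dual_eq (V : lmodType R) (S : set V) (a b : V -> R) :
  lin_dual S a -> lin_dual S b -> (forall v, S v -> a v = b v) -> a = b.
Proof.
move=> [_ na] [_ nb] ab; apply/funext => v.
by have [Sv|nSv] := pselect (S v); [exact: ab|rewrite na// nb].
Qed.

Lemma lin_dual_sum (V : lmodType R) (S : set V) k (r : 'rV[R]_k -> V) a u :
  frame S r -> lin_dual S a -> a (r u) = \sum_i u 0 i * a (r 'e_i).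
Proof.
move=> fr [la _]; apply: (@linear_rV R^o k (fun u => a (r u))) => c v w.
by rewrite (frame_linear fr) la//; exact: (frame_in fr).
Qed.

Lemma lin_dual_linear (V : lmodType R) (S : set V) c (a b : V -> R) :
  lin_dual S a -> lin_dual S b -> lin_dual S (c *: a + b).
Proof.
move=> [la na] [lb nb]; split=> [e v w Sv Sw|v nSv].
  have E v' : (c *: a + b) v' = c * a v' + b v' by [].
  by rewrite !E la// lb//; ring.
by rewrite -[LHS]/(c * a v + b v) na// nb// mulr0 addr0.
Qed.

Lemma has_dim_lin_dual (V : lmodType R) (S : set V) k :
  has_dim S k -> has_dim (lin_dual S) k.
Proof.
move=> /has_dim_frame[r fr]; apply/has_dim_frame.
have ex (y : 'rV[R]_k) : exists a, lin_dual S a /\ forall u, a (r u) = (u *m y^T) 0 0.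
  by have [a Sa Ha] := frame_dual fr y^T; exists a.
have [d Hd] := choice ex; exists d.
split.
- move=> c u v; apply: (lin_dual_eq (Hd _).1); first by apply: lin_dual_linear; exact: (Hd _).1.
  move=> w Sw; have [z <-] := frame_surj fr Sw.
  rewrite -[RHS]/(c * d u (r z) + d v (r z)) !(Hd _).2.
  by rewrite linearP/= mulmxDr -scalemxAr mxE [X in X + _]mxE.
- move=> u du0; apply/rowP => i; have := (Hd u).2 'e_i.
  by rewrite du0 -rowE !mxE => <-.
- apply/seteqP; split=> [a Sa|_ [u _ <-]]; last exact: (Hd u).1.
  exists (\row_i a (r 'e_i)) => //; apply: (lin_dual_eq (Hd _).1 Sa) => w Sw.
  have [z <-] := frame_surj fr Sw; rewrite (Hd _).2 (lin_dual_sum z fr Sa) mxE.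
  by apply: eq_bigr => i _; rewrite !mxE.
Qed.

(* The transpose of the injection w |-> (b w, f w) of A into S^* + T is onto. *)
Lemma transpose_surjective (U V W : lmodType R) (A : set U) (S : set V) (T : set W)
    ka ks kt (b : U -> V -> R) (f : U -> W) :
  has_dim A ka -> has_dim S ks -> has_dim T kt ->
  (forall w, A w -> lin_dual S (b w)) ->
  (forall v, S v -> lin_on A (fun w => b w v : R^o)) ->
  lin_on A f -> (forall w, A w -> T (f w)) ->
  (forall w, A w -> (forall v, S v -> b w v = 0) -> f w = 0 -> w = 0) ->
  forall l, lin_dual A l -> exists v a, [/\ S v, lin_dual T a &
    forall w, A w -> l w = b w v + a (f w)].
Proof.
move=> /has_dim_frame[rA frA] /has_dim_frame[rS frS] /has_dim_frame[rT frT] bS bA fA fT inj l Al.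
have [F HF] := frame_matrix frA frT fA fT.
pose B : 'M[R]_(ka, ks) := \matrix_(i, j) b (rA 'e_i) (rS 'e_j).
have bE u x : b (rA u) (rS x) = (u *m B *m x^T) 0 0.
  have lb : forall c u v, (b (rA (c *: u + v)) (rS x) : R^o) =
      c *: (b (rA u) (rS x) : R^o) + b (rA v) (rS x).
    move=> c u' v'; rewrite (frame_linear frA).
    by rewrite (bA _ (frame_in frS x))//; exact: (frame_in frA).
  rewrite (linear_rV u lb) -mulmxA mxE; apply: eq_bigr => i _; congr (_ * _).
  rewrite (lin_dual_sum x frS (bS _ (frame_in frA _))) mxE.
  by apply: eq_bigr => j _; rewrite !mxE mulrC.
(* Row freeness of the block matrix expresses the injectivity of w |-> (b w, f w). *)
have free : row_free (row_mx B F).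
  apply: inj_row_free => u; rewrite mul_mx_row => /eqP.
  rewrite -row_mx0 => /eqP/eq_row_mx[uB uF].
  have [_ ri _] := frA; apply: ri; apply: inj.
  - exact: (frame_in frA).
  - by move=> v /(frame_surj frS)[x <-]; rewrite bE uB mul0mx mxE.
  - by rewrite HF uF linear_fun0//; case: frT.
pose lc : 'cV[R]_ka := \col_i l (rA 'e_i).
(* For a row-free matrix [pinvmx] is a right inverse, which solves the transposed system; the two
   blocks of [xy] are the coordinates of v and of a. *)
pose xy := pinvmx (row_mx B F) *m lc.
have xyE : B *m usubmx xy + F *m dsubmx xy = lc.
  by rewrite -mul_row_col vsubmxK /xy mulmxA mulmxVp// mul1mx.
have [a Ta Ha] := frame_dual frT (dsubmx xy).
exists (rS (usubmx xy)^T), a; split=> //; first exact: (frame_in frS).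
move=> w /(frame_surj frA)[u <-].
rewrite HF Ha bE trmxK -!mulmxA.
have -> (X Y : 'M[R]_1) : X 0 0 + Y 0 0 = (X + Y) 0 0 by rewrite mxE.
rewrite -mulmxDr xyE (lin_dual_sum u frA Al) mxE.
by apply: eq_bigr => i _; rewrite mxE.
Qed.

End Frames.

(** * Lagrangian morphisms *)

Section LagrangianMorphisms.
Variable R : realType.

(** The kernel of Ts at the unit, where Ts is onto T_xN. *)
Lemma algd_dim (N : manifold R) (H : lie_groupoid N) x :
  has_dim (@algd R _ H x) (dim H - dim N).
Proof.
apply: (@has_dim_ker R _ _ (tangent (unit H x)) _ _ (Tmap (@src _ _ H) (unit H x))).
- exact: tangent_dim.
- by move=> c u v _ _; exact: Tmap_linear.
rewrite (_ : _ @` _ = tangent x); first exact: tangent_dim.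
apply/seteqP; split=> [_ [u tu <-]|X tX]; first exact: tangent_src.
have [_ surj] := src_submersion H.
have [|u tu uX] := surj (unit H x) X; first by rewrite src_unit.
by exists u.
Qed.

(** From 1_x 1_x = 1_x the pullback of w by the unit map is twice itself. *)
Lemma form_base (M : manifold R) (G : lie_groupoid M) (w : form2 G) x X Y :
  eq2 (pull2 (@mult _ _ G) w)
    (fun z u v => pull2 (@pr1 _ _ G) w z u v + pull2 (@pr2 _ _ G) w z u v) ->
  tangent x X -> tangent x Y ->
  w (unit G x) (Tmap (unit G) x X) (Tmap (unit G) x Y) = 0.
Proof.
move=> mw tX tY; have su : smooth_map (unit G) := @unit_smooth _ _ G.
have st y : src (unit G y) = tgt (unit G y) by rewrite src_unit tgt_unit.
have := multiplicativeP mw su su st tX tY.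
have -> : (fun y => mul (unit G y) (unit G y)) = unit G.
  by apply/funext => y; rewrite -{1}(tgt_unit G y) mul_unitl.
have -> : mul (unit G x) (unit G x) = unit G x.
  by rewrite -{1}(tgt_unit G x) mul_unitl.
by rewrite -[X in X = _]addr0 => /addrI.
Qed.

Lemma Tmap_push p (M N : manifold R) (P : 'rV[R]_p -> M) (f : M -> N) z a :
  smap_at f (P z) -> Tmap f (P z) (push P z a) = push (fun y => f (P y)) z a.
Proof.
by move=> sf; rewrite /push -(@Tmap_comp R (euclid R p) M N P f z).
Qed.

Lemma derive_sub3 n (f g h : 'rV[R]_n -> R) x :
  differentiable f x -> differentiable g x -> differentiable h x ->
  differentiable (fun z => f z - (g z - h z)) x /\
  forall u, 'D_u (fun z => f z - (g z - h z)) x = 'D_u f x - ('D_u g x - 'D_u h x).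
Proof.
move=> df dg dh.
have dgh : differentiable (g - h) x by exact: differentiableB.
split; first exact: (differentiableB df dgh).
move=> u; have -> : (fun z => f z - (g z - h z)) = f - (g - h) by [].
rewrite deriveB; [|exact: diff_derivable|exact: diff_derivable].
by rewrite (deriveB (diff_derivable dg) (diff_derivable dh)).
Qed.

(** x, y, z stand for derivatives of the pullbacks of omega, s^*sigma and t^*sigma; [e2] and [e3]
    are the values of phi^*eta pulled back along s and t, which cancel. *)
Lemma sub3_zero (x1 x2 x3 y1 y2 y3 z1 z2 z3 e2 e3 t1 t2 t3 : R) :
  t1 = x1 - (y1 - z1) -> t2 = x2 - (y2 - z2) -> t3 = x3 - (y3 - z3) ->
  x1 - x2 + x3 = e2 - e3 -> y1 - y2 + y3 = e2 -> z1 - z2 + z3 = e3 ->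
  t1 - t2 + t3 = 0.
Proof. by move=> -> -> -> E1 E2 E3; lra. Qed.

Section Morphism.
Variables (M : manifold R) (G : lie_groupoid M) (omega : form2 G) (eta : form3 M).
Hypothesis hG : shifted_symplectic1 omega eta.
Variables (N : manifold R) (H : lie_groupoid N) (Phi : H -> G) (phi : N -> M).
Hypothesis hPhi : groupoid_morphism Phi phi.
Variable sigma : form2 N.
Hypothesis fsigma : is_form2 sigma.

Let fw : is_form2 omega.
Proof. by case: hG => -[]. Qed.

Let mw : eq2 (pull2 (@mult _ _ G) omega)
  (fun z u v => pull2 (@pr1 _ _ G) omega z u v + pull2 (@pr2 _ _ G) omega z u v).
Proof. by case: hG. Qed.

Let sPhi g : smap_at Phi g.
Proof. by case: hPhi => -[+ _] _ _ _ _; exact. Qed.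

Let sphi x : smap_at phi x.
Proof. by case: hPhi => -[_ +] _ _ _ _; exact. Qed.

Let srcPhi h : src (Phi h) = phi (src h).
Proof. by case: hPhi. Qed.

Let tgtPhi h : tgt (Phi h) = phi (tgt h).
Proof. by case: hPhi. Qed.

Let Phi_unit y : Phi (unit H y) = unit G (phi y).
Proof. by case: hPhi. Qed.

Let Phi_mul h k : src h = tgt k -> Phi (mul h k) = mul (Phi h) (Phi k).
Proof. by case: hPhi => _ _ _ _; exact. Qed.

Lemma Tsrc_Phi h u : Tmap (@src _ _ G) (Phi h) (Tmap Phi h u) =
  Tmap phi (src h) (Tmap (@src _ _ H) h u).
Proof.
rewrite -Tmap_comp; last exact: smap_src.
rewrite -Tmap_comp; last exact: sphi.
by congr Tmap; apply/funext => y; exact: srcPhi.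
Qed.

Lemma Ttgt_Phi h u : Tmap (@tgt _ _ G) (Phi h) (Tmap Phi h u) =
  Tmap phi (tgt h) (Tmap (@tgt _ _ H) h u).
Proof.
rewrite -Tmap_comp; last exact: smap_tgt.
rewrite -Tmap_comp; last exact: sphi.
by congr Tmap; apply/funext => y; exact: tgtPhi.
Qed.

Lemma algd_Phi x w : @algd R _ H x w -> @algd R _ G (phi x) (Tmap Phi (unit H x) w).
Proof.
move=> [tw sw]; split; first by rewrite -Phi_unit; exact: Tmap_tangent.
by rewrite -Phi_unit Tsrc_Phi sw Tmap0.
Qed.

Lemma anchor_Phi x w : anchor (phi x) (Tmap Phi (unit H x) w) = Tmap phi x (anchor x w).
Proof. by rewrite /anchor -Phi_unit Ttgt_Phi tgt_unit. Qed.

(** Its vanishing is the compatibility of sigma with omega in an isotropic morphism. *)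
Definition defect : form2 H := fun g u v =>
  omega (Phi g) (Tmap Phi g u) (Tmap Phi g v) -
  (sigma (src g) (Tmap (@src _ _ H) g u) (Tmap (@src _ _ H) g v) -
   sigma (tgt g) (Tmap (@tgt _ _ H) g u) (Tmap (@tgt _ _ H) g v)).

Lemma defect_linear g (c : R) u u' v : tangent g u -> tangent g u' ->
  tangent g v -> defect g (c *: u + u') v = c * defect g u v + defect g u' v.
Proof.
move=> tu tu' tv; rewrite /defect !Tmap_linear.
have tP t : tangent g t -> tangent (Phi g) (Tmap Phi g t) := Tmap_tangent (sPhi g).
have ts t : tangent g t -> tangent (src g) (Tmap (@src _ _ H) g t) := Tmap_tangent (smap_src g).
have tt t : tangent g t -> tangent (tgt g) (Tmap (@tgt _ _ H) g t) := Tmap_tangent (smap_tgt g).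
rewrite (form2P fw c (tP _ tu) (tP _ tu') (tP _ tv)).
rewrite (form2P fsigma c (ts _ tu) (ts _ tu') (ts _ tv)).
by rewrite (form2P fsigma c (tt _ tu) (tt _ tu') (tt _ tv)); ring.
Qed.

Lemma defect_anti g u v : tangent g u -> tangent g v -> defect g u v = - defect g v u.
Proof.
move=> tu tv; rewrite /defect.
have tP t : tangent g t -> tangent (Phi g) (Tmap Phi g t) := Tmap_tangent (sPhi g).
have ts t : tangent g t -> tangent (src g) (Tmap (@src _ _ H) g t) := Tmap_tangent (smap_src g).
have tt t : tangent g t -> tangent (tgt g) (Tmap (@tgt _ _ H) g t) := Tmap_tangent (smap_tgt g).
rewrite (form2N fw (tP _ tu) (tP _ tv)) (form2N fsigma (ts _ tu) (ts _ tv)).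
by rewrite (form2N fsigma (tt _ tu) (tt _ tv)); ring.
Qed.

(** s^*sigma - t^*sigma is multiplicative because s(ab) = s(b), t(ab) = t(a), and the contributions
    at s(a) = t(b) cancel; Phi^*omega is, because Phi preserves products. *)
Lemma defect_mult : multiplicative defect.
Proof.
move=> Q a b sa sb ab q u v tu tv.
have sm := smooth_mul sa sb ab.
have sPa : smooth_map (fun y => Phi (a y)).
  by move=> y; exact: (@smap_at_comp _ _ _ _ a Phi y (sa y) (sPhi _)).
have sPb : smooth_map (fun y => Phi (b y)).
  by move=> y; exact: (@smap_at_comp _ _ _ _ b Phi y (sb y) (sPhi _)).
have Pab y : src (Phi (a y)) = tgt (Phi (b y)) by rewrite srcPhi tgtPhi ab.
have TC (K : manifold R) (f : H -> K) (k : Q -> H) t : (forall h, smap_at f h) ->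
    Tmap f (k q) (Tmap k q t) = Tmap (fun y => f (k y)) q t.
  by move=> sf; rewrite -Tmap_comp.
have ss : forall h, smap_at (@src _ _ H) h := @smap_src _ _ H.
have st : forall h, smap_at (@tgt _ _ H) h := @smap_tgt _ _ H.
have eP : (fun y => Phi (mul (a y) (b y))) = (fun y => mul (Phi (a y)) (Phi (b y))).
  by apply/funext => y; exact: Phi_mul.
have es : (fun y => src (mul (a y) (b y))) = (fun y => src (b y)).
  by apply/funext => y; exact: src_mul.
have et : (fun y => tgt (mul (a y) (b y))) = (fun y => tgt (a y)).
  by apply/funext => y; exact: tgt_mul.
have em : (fun y => src (a y)) = (fun y => tgt (b y)) by exact/funext.
rewrite /defect.
have T1 t := TC _ Phi (fun y => mul (a y) (b y)) t sPhi.
have T2 t := TC _ (@src _ _ H) (fun y => mul (a y) (b y)) t ss.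
have T3 t := TC _ (@tgt _ _ H) (fun y => mul (a y) (b y)) t st.
rewrite !T1 !T2 !T3 eP es et.
rewrite (TC _ Phi a u sPhi) (TC _ Phi a v sPhi) (TC _ Phi b u sPhi) (TC _ Phi b v sPhi).
rewrite (TC _ _ a u ss) (TC _ _ a v ss) (TC _ _ b u ss) (TC _ _ b v ss).
rewrite (TC _ _ a u st) (TC _ _ a v st) (TC _ _ b u st) (TC _ _ b v st).
rewrite em (Phi_mul (ab q)) (multiplicativeP mw sPa sPb Pab tu tv) (src_mul (ab q)).
by rewrite (tgt_mul (ab q)) (ab q); ring.
Qed.

(** For u in A_H the term of s^*sigma is 0, and by [form_lambda] the rest is the covector of [hinf]
    evaluated on Tt(v). *)
Lemma defect_unit
  (hinf : forall x w, @algd R _ H x w ->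
     cTmap phi x (lambda omega (phi x) (Tmap Phi (unit H x) w)) + flat sigma x (anchor x w) = 0)
  y u v : @algd R _ H y u -> tangent (unit H y) v -> defect (unit H y) u v = 0.
Proof.
move=> Au tv; have [tu su] := Au.
have tX := tangent_tgt tv.
have tPv : tangent (unit G (phi y)) (Tmap Phi (unit H y) v).
  by rewrite -Phi_unit; exact: Tmap_tangent.
rewrite /defect su src_unit tgt_unit Phi_unit.
rewrite (form_lambda fw mw (algd_Phi Au) tPv) -{1}Phi_unit Ttgt_Phi tgt_unit.
rewrite (form20l fsigma); last exact: tangent_src.
have := congr1 (@^~ (Tmap (@tgt _ _ H) (unit H y) v)) (hinf y u Au).
rewrite -[LHS]/(cTmap phi y _ _ + flat sigma y _ _) /cTmap /flat !restrE//.
by rewrite sub0r opprK.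
Qed.

(** On vectors tangent to the units s^*sigma and t^*sigma agree; Phi maps units to units, so
    [form_base] disposes of omega. *)
Lemma defect_base y X Y : tangent y X -> tangent y Y ->
  defect (unit H y) (Tmap (unit H) y X) (Tmap (unit H) y Y) = 0.
Proof.
move=> tX tY; rewrite /defect !Tsrc_unit// !Ttgt_unit// src_unit tgt_unit subrr subr0.
have E t : Tmap Phi (unit H y) (Tmap (unit H) y t) = Tmap (unit G) (phi y) (Tmap phi y t).
  rewrite -Tmap_comp; last exact: sPhi.
  rewrite -Tmap_comp; last exact: smap_unit.
  by congr Tmap; apply/funext => z; exact: Phi_unit.
by rewrite !E Phi_unit; apply: form_base => //; exact: Tmap_tangent.
Qed.

(** d omega = s^*eta - t^*eta and d sigma = phi^*eta; the contributions of eta agree because Phi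
    covers phi. *)
Lemma defect_closed (dsigma : is_d2 sigma (pull3 phi eta)) p (P : 'rV[R]_p -> H)
    (z0 : 'rV[R]_p) :
  (\forall z \near z0, @smap_at R (euclid R p) H P z) ->
  (forall u v, differentiable (pull defect P u v) z0) /\
  forall u v s, 'D_u (pull defect P v s) z0 - 'D_v (pull defect P u s) z0 +
    'D_s (pull defect P u v) z0 = 0.
Proof.
move=> sP.
have sc (K : manifold R) (f : H -> K) : (forall h, smap_at f h) ->
    \forall z \near z0, @smap_at R (euclid R p) K (fun y => f (P y)) z.
  move=> sf; apply: filterS sP => z sz.
  exact: (@smap_at_comp R (euclid R p) H K P f z sz (sf _)).
have s1 := sc _ _ sPhi.
have s2 := sc _ _ (@smap_src _ _ H).
have s3 := sc _ _ (@smap_tgt _ _ H).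
have [c1 a1 d1] := atlas_cover (Phi (P z0)).
have [c2 a2 d2] := atlas_cover (src (P z0)).
have [c3 a3 d3] := atlas_cover (tgt (P z0)).
have pE a b : pull defect P a b = (fun z => pull omega (fun y => Phi (P y)) a b z -
    (pull sigma (fun y => src (P y)) a b z - pull sigma (fun y => tgt (P y)) a b z)).
  apply/funext => z; rewrite /pull /defect.
  rewrite !(Tmap_push _ (sPhi _)) !(Tmap_push _ (smap_src _)).
  by rewrite !(Tmap_push _ (smap_tgt _)).
have D1 a b := smooth_near_differentiable (smooth_near_pull fw s1 a1 d1 a b).
have D2 a b := smooth_near_differentiable (smooth_near_pull fsigma s2 a2 d2 a b).
have D3 a b := smooth_near_differentiable (smooth_near_pull fsigma s3 a3 d3 a b).
have DE a b := derive_sub3 (D1 a b) (D2 a b) (D3 a b).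
split=> [a b|u v s]; first by rewrite pE; exact: (DE a b).1.
have K a b d : 'D_d (pull defect P a b) z0 = 'D_d (pull omega (fun y => Phi (P y)) a b) z0 -
    ('D_d (pull sigma (fun y => src (P y)) a b) z0 - 'D_d (pull sigma (fun y => tgt (P y)) a b) z0).
  by rewrite pE; exact: (DE a b).2.
have dw : is_d2 omega (fun g u v w => pull3 (@src _ _ G) eta g u v w
                                  - pull3 (@tgt _ _ G) eta g u v w).
  by case: hG => _ _ [].
have K1 := pull_d fw s1 a1 d1 u v s dw.
have K2 := pull_d fsigma s2 a2 d2 u v s dsigma.
have K3 := pull_d fsigma s3 a3 d3 u v s dsigma.
have Es a : Tmap (@src _ _ G) (Phi (P z0)) (push (fun y => Phi (P y)) z0 a) =
    Tmap phi (src (P z0)) (push (fun y => src (P y)) z0 a).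
  by rewrite -(Tmap_push _ (sPhi _)) -(Tmap_push _ (smap_src _)) Tsrc_Phi.
have Et a : Tmap (@tgt _ _ G) (Phi (P z0)) (push (fun y => Phi (P y)) z0 a) =
    Tmap phi (tgt (P z0)) (push (fun y => tgt (P y)) z0 a).
  by rewrite -(Tmap_push _ (sPhi _)) -(Tmap_push _ (smap_tgt _)) Ttgt_Phi.
rewrite /pull3 in K2 K3; rewrite /pull3 srcPhi tgtPhi !Es !Et in K1.
exact: (sub3_zero (K v s u) (K u s v) (K u v s) K1 K2 K3).
Qed.

End Morphism.
End LagrangianMorphisms.

(** * From lagrangian to infinitesimal lagrangian morphisms, and back *)

Section Proposition.
Variable R : realType.
Variables (M : manifold R) (G : lie_groupoid M) (omega : form2 G) (eta : form3 M).
Hypothesis hG : shifted_symplectic1 omega eta.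

Let fw : is_form2 omega.
Proof. by case: hG => -[]. Qed.

Let mw : eq2 (pull2 (@mult _ _ G) omega)
  (fun z u v => pull2 (@pr1 _ _ G) omega z u v + pull2 (@pr2 _ _ G) omega z u v).
Proof. by case: hG. Qed.

Let AGL_inj x u v : @algd R _ G x u -> @algd R _ G x v -> anchor x u = anchor x v ->
  lambda omega x u = lambda omega x v -> u = v.
Proof. by apply: (anchor_lambda_inj fw mw); case: hG. Qed.

Lemma anchor_lambda_eq0 x u : @algd R _ G x u -> anchor x u = 0 -> lambda omega x u = 0 -> u = 0.
Proof.
move=> Au au lu; apply: (AGL_inj Au (algd0 G x)); first by rewrite au /anchor Tmap0.
rewrite lu; have := lambda_linear fw (-1) (algd0 G x) (algd0 G x).
rewrite scaler0 addr0 => ->; apply/funext => X.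
by rewrite mulN1r addNr.
Qed.

Lemma lambda_lin_on x : lin_on (@algd R _ G x) (lambda omega x).
Proof. by move=> c u v Au Av; rewrite (lambda_linear fw). Qed.

Lemma flat_cotangent (N : manifold R) (sigma : form2 N) x Y : is_form2 sigma ->
  tangent x Y -> cotangent x (flat sigma x Y).
Proof.
move=> fs tY; split=> [c u v tu tv|v nv]; last by rewrite /flat restrN.
by rewrite /flat !restrE ?(form2Pr fs)//; exact: tangent_linear.
Qed.

Lemma cTmap_cotangent (N K : manifold R) (f : N -> K) x a : smap_at f x ->
  cotangent (f x) a -> cotangent x (cTmap f x a).
Proof.
move=> sf [la _]; split=> [c u v tu tv|v nv]; last by rewrite /cTmap restrN.
rewrite /cTmap !restrE//; last exact: tangent_linear.
by rewrite Tmap_linear la//; exact: Tmap_tangent.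
Qed.

Lemma lagrangian_infinitesimal (N : manifold R) (H : lie_groupoid N) (Phi : H -> G)
    (phi : N -> M) (sigma : form2 N) :
  lagrangian_morphism omega eta Phi phi sigma ->
  inf_lagrangian_morphism eta (groupoid_dirac omega) phi sigma.
Proof.
move=> [[hPhi fs _ ds] ex5]; have [[_ sphi] _ _ _ _] := hPhi.
split=> //; exists (dim H - dim N)%N => x.
have [ker_f ker_g _ _] := ex5 x.
(* The isomorphism from A_H onto the intersection; TN x L forces the entry 0. *)
pose f w := (((anchor x w, 0), (anchor (phi x) (Tmap Phi (unit H x) w),
  lambda omega (phi x) (Tmap Phi (unit H x) w))) : bivec N M).
have -> : infalgd (groupoid_dirac omega) phi sigma x = f @` (@algd R _ H x).
  apply/seteqP; split=> [[[Y b] [X a]]|_ [w Aw <-]].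
    move=> [[/= tY XE ca bE] [/= _ b0 [u Au [aE lE]]]].
    (* With (X, a) = (a_G(u), lambda(u)), the equations of R_{phi,sigma} say that (Y, u) is in the
       kernel of the second map. *)
    have : [set v | (tangent x `*` @algd R _ G (phi x)) v /\
      (Tmap phi x v.1 - anchor (phi x) v.2,
       flat sigma x v.1 + cTmap phi x (lambda omega (phi x) v.2)) = 0] (Y, u).
      by split=> //=; rewrite aE -XE subrr lE addrC -bE b0.
    rewrite ker_g => -[w Aw [wY wu]]; exists w => //.
    by rewrite /f wu wY aE lE b0.
  have : ((fun w => (anchor x w, Tmap Phi (unit H x) w)) @` @algd R _ H x)
    (anchor x w, Tmap Phi (unit H x) w) by exists w.
  rewrite -ker_g => -[/= [/= tY Au] [gE1 gE2]].
  split; split=> //=.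
  - by apply/esym/eqP; rewrite -subr_eq0 gE1.
  - exact: lambda_cotangent.
  - by rewrite addrC gE2.
  - by exists (Tmap Phi (unit H x) w).
apply: has_dim_image_inj; first exact: algd_dim.
  move=> c u v Au Av; rewrite /f.
  have := lambda_lin_on c (algd_Phi hPhi Au) (algd_Phi hPhi Av).
  rewrite -!Tmap_linear => ->; rewrite /anchor !Tmap_linear.
  rewrite -[RHS]/((c *: anchor x u + anchor x v, c *: 0 + 0), _); congr ((_, _), _).
  by rewrite scaler0 addr0.
(* Phi(w) is 0 because (a_G, lambda) is injective, and then w is 0 by exactness at A_H. *)
move=> w Aw [aw aPw lPw].
have : [set u | @algd R _ H x u /\ (anchor x u, Tmap Phi (unit H x) u) = 0] w.
  by split=> //; rewrite aw (anchor_lambda_eq0 (algd_Phi hPhi Aw) aPw lPw).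
by rewrite ker_f.
Qed.

Lemma infinitesimal_lagrangian (N : manifold R) (phi : N -> M) (sigma : form2 N) :
  inf_lagrangian_morphism eta (groupoid_dirac omega) phi sigma ->
  forall (H : lie_groupoid N) (psi : N -> vec H -> bivec N M),
  source_simply_connected H ->
  integrates eta (groupoid_dirac omega) phi sigma psi ->
  forall Phi : H -> G, integrates_projection omega psi Phi phi ->
  lagrangian_morphism omega eta Phi phi sigma.
Proof.
move=> [sphi fs ds _] H psi ssc [bij psi_lin _ psi_anchor _] Phi [hPhi psiPhi].
have inf x w : @algd R _ H x w -> infalgd (groupoid_dirac omega) phi sigma x (psi x w).
  by move=> Aw; have [+ _ _] := bij x; exact.
(* psi is determined by its three prescribed parts: the anchor, the entry 0 of TN x L, and the
   projection to L. *)
have psiE x w : @algd R _ H x w -> psi x w = ((anchor x w, 0),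
    (anchor (phi x) (Tmap Phi (unit H x) w), lambda omega (phi x) (Tmap Phi (unit H x) w))).
  move=> Aw; have [_ [_ p0 _]] := inf x w Aw.
  rewrite (psiPhi x w Aw) -(psi_anchor x w Aw) -p0.
  by case: (psi x w) => -[].
(* The equation beta = 0 for an element of R_{phi,sigma} in TN x L. It feeds [defect_unit], and
   later gives g f = 0 and h g = 0. *)
have cond x w : @algd R _ H x w ->
    cTmap phi x (lambda omega (phi x) (Tmap Phi (unit H x) w)) + flat sigma x (anchor x w) = 0.
  move=> Aw; have [[_ _ _ +] _] := inf x w Aw.
  by rewrite (psiE x w Aw) /= => <-.
have psi0 x : psi x 0 = 0.
  have := psi_lin x (-1) 0 0 (algd0 H x) (algd0 H x).
  by rewrite scaler0 addr0 scaleN1r addNr.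
have psi_inj x w : @algd R _ H x w -> psi x w = 0 -> w = 0.
  move=> Aw pw; have [_ + _] := bij x; move=> /(_ w 0); rewrite !inE pw psi0.
  by apply=> //; exact: algd0.
split.
  split=> //.
  have V := multiplicative_form_vanishes (defect_linear hG hPhi fs)
    (defect_anti hG hPhi fs) (defect_mult hG hPhi sigma) (defect_unit hG hPhi fs cond)
    (defect_base hG hPhi sigma) (defect_closed hG hPhi fs ds) ssc.
  move=> g u v tu tv; have := V g u v tu tv.
  by move=> /eqP; rewrite subr_eq0 => /eqP; rewrite /pull2.
move=> x.
set A := @algd R _ H x; set AG := @algd R _ G (phi x).
set f := fun w => _; set g := fun p => _; set h := fun p => _.
have AGPhi w : A w -> AG (Tmap Phi (unit H x) w) by exact: algd_Phi.
have tanchor w : A w -> tangent x (anchor x w) by exact: anchor_tangent.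
have dimA : has_dim A (dim H - dim N) := algd_dim H x.
have dimG : dim G = (2 * dim M)%N by case: hG.
have dimAG : has_dim AG (dim M).
  by have := algd_dim G (phi x); rewrite dimG mul2n -addnn addnK.
have f_lin : lin_on A f by move=> c u v _ _; rewrite /f /anchor !Tmap_linear.
have ker_f : [set w | A w /\ f w = 0] = [set 0].
  apply/seteqP; split=> [w [Aw [aw Pw]]|_ ->] /=; last first.
    by split; [exact: algd0|rewrite /f /anchor !Tmap0].
  apply: (psi_inj x w Aw); rewrite (psiE x w Aw) aw Pw /anchor Tmap0.
  have := lambda_lin_on (-1) (algd0 G (phi x)) (algd0 G (phi x)).
  by rewrite scaler0 addr0 scaleN1r addNr => ->.
have f_inj w : A w -> f w = 0 -> w = 0.
  by move=> Aw fw0; have : [set w | A w /\ f w = 0] w by []; rewrite ker_f.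
have g_lin : lin_on (tangent x `*` AG) g.
  move=> c [Y u] [Y' u'] [/= tY Au] [/= tY' Au']; rewrite /g /=.
  congr (_, _).
    transitivity (c *: (Tmap phi x Y - anchor (phi x) u) +
      (Tmap phi x Y' - anchor (phi x) u')); last by [].
    by rewrite /anchor !Tmap_linear scalerBr addrACA opprD.
  apply/funext => Z; rewrite -[RHS]/(c * (flat sigma x Y Z + cTmap phi x (lambda omega (phi x) u) Z)
    + (flat sigma x Y' Z + cTmap phi x (lambda omega (phi x) u') Z)).
  rewrite -[LHS]/(flat sigma x (c *: Y + Y') Z +
    cTmap phi x (lambda omega (phi x) (c *: u + u')) Z).
  have [tZ|nZ] := pselect (tangent x Z).
    by rewrite /flat /cTmap !restrE// (form2P fs)// (lambda_linear fw)//; ring.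
  by rewrite /flat /cTmap !restrN//; ring.
have ker_g : [set v | (tangent x `*` AG) v /\ g v = 0] = f @` A.
  apply/seteqP; split=> [[Y u] [[/= tY Au] [g1 g2]]|_ [w Aw <-]] /=.
    have XE : anchor (phi x) u = Tmap phi x Y by apply/esym/eqP; rewrite -subr_eq0 g1.
    (* An element of ker g is an element of the intersection, and psi is onto. *)
    have I : infalgd (groupoid_dirac omega) phi sigma x
        ((Y, 0), (anchor (phi x) u, lambda omega (phi x) u)).
      split; split=> //=; last by exists u.
      - exact: lambda_cotangent.
      - by rewrite addrC g2.
    have [_ _ /(_ _ I)[w Aw wE]] := bij x.
    rewrite (psiE x w Aw) in wE; case: wE => wY wa wl.
    exists w => //; rewrite /f wY; congr (_, _).
    exact: (AGL_inj (AGPhi w Aw) Au wa wl).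
  split; first by split; [exact: tanchor|exact: AGPhi].
  by rewrite /g /f /= (anchor_Phi hPhi) subrr addrC cond.
have hE p w : A w -> h p w = - lambda omega (phi x) (Tmap Phi (unit H x) w) p.1 + p.2 (anchor x w).
  by move=> Aw; rewrite /h restrE.
have h_dual p : (tangent (phi x) `*` cotangent x) p -> lin_dual A (h p).
  move=> [tX [la _]]; split=> [c u v Au Av|v nA]; last by rewrite /h restrN.
  rewrite !hE//; last exact: algd_linear.
  rewrite Tmap_linear (lambda_linear fw)//; [|exact: AGPhi|exact: AGPhi].
  by rewrite /anchor Tmap_linear la; [ring|exact: tanchor|exact: tanchor].
have h_lin : lin_on (tangent (phi x) `*` cotangent x) h.
  move=> c [X a] [X' a'] [/= tX _] [/= tX' _]; apply/funext => w.
  rewrite -[RHS]/(c * h (X, a) w + h (X', a') w).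
  have [Aw|nA] := pselect (A w); last by rewrite /h !restrN// mulr0 addr0.
  rewrite !hE//=; have [ll _] := lambda_cotangent fw (AGPhi w Aw).
  rewrite ll//; set l := lambda _ _ _.
  rewrite -[X in - _ + X]/(c * a (anchor x w) + a' (anchor x w)); ring.
have h_surj : h @` (tangent (phi x) `*` cotangent x) = lin_dual A.
  apply/seteqP; split=> [_ [p Cp <-]|l Al]; first exact: h_dual.
  have := @transpose_surjective R _ _ _ A (tangent (phi x)) (tangent x) _ _ _
    (fun w => lambda omega (phi x) (Tmap Phi (unit H x) w)) (anchor x)
    dimA (tangent_dim (phi x)) (tangent_dim x) _ _ _ _ _ l Al.
  case.
  - by move=> w Aw; apply: lambda_cotangent => //; exact: AGPhi.
  - move=> X tX c u v Au Av; rewrite Tmap_linear (lambda_linear fw)//; exact: AGPhi.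
  - by move=> c u v _ _; rewrite /anchor Tmap_linear.
  - exact: tanchor.
  - move=> w Aw lw aw; apply: f_inj => //; rewrite /f aw.
    have -> // : Tmap Phi (unit H x) w = 0.
    apply: (anchor_lambda_eq0 (AGPhi w Aw)); first by rewrite (anchor_Phi hPhi) aw Tmap0.
    apply/funext => X; have [tX|nX] := pselect (tangent (phi x) X); first exact: lw.
    by rewrite /lambda restrN.
  (* The third map pairs X with minus lambda, hence the witness - X. *)
  - move=> X [a [tX ca E]]; exists (- X, a).
      by split=> //=; rewrite -scaleN1r; exact: tangentZ.
    apply: (@lin_dual_eq _ _ A) => // [|w Aw].
      by apply: h_dual; split=> //=; rewrite -scaleN1r; exact: tangentZ.
    rewrite hE// E//=; congr (_ + _).
    have [ll _] := lambda_cotangent fw (AGPhi w Aw).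
    have := ll (-1) X X tX tX; rewrite scaleN1r addNr mulN1r addNr => l0.
    have := ll (-1) X 0 tX (tangent0 _); rewrite scaleN1r addr0 l0 addr0 mulN1r => ->.
    by rewrite opprK.
split=> //.
have dimKg : has_dim [set v | (tangent x `*` AG) v /\ g v = 0] (dim H - dim N).
  by rewrite ker_g; apply: has_dim_image_inj.
have dimC : has_dim (tangent (phi x) `*` cotangent x) (dim M + dim N).
  by apply: has_dim_setX; [exact: tangent_dim|apply: has_dim_lin_dual; exact: tangent_dim].
have dimB : has_dim (tangent x `*` AG) (dim M + dim N).
  by rewrite addnC; apply: has_dim_setX => //; exact: tangent_dim.
(* The image of g and the kernel of h both have dimension dim M + dim N - (dim H - dim N), so h g =
   0 is all that is left. *)
apply/esym; apply: has_dim_eq.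
- exact: has_dim_image_ker dimB g_lin dimKg.
- apply: has_dim_ker dimC h_lin _; rewrite h_surj.
  exact: has_dim_lin_dual.
move=> _ [[Y u] [/= tY Au] <-]; split.
  split=> /=.
    by apply: tangentB; [exact: Tmap_tangent|exact: anchor_tangent].
  rewrite addrC -[X in X + _]scale1r; apply: lin_dual_linear.
    by apply: cTmap_cotangent => //; exact: lambda_cotangent.
  exact: flat_cotangent.
apply: (@lin_dual_eq _ _ A).
- apply: h_dual; split=> /=.
    by apply: tangentB; [exact: Tmap_tangent|exact: anchor_tangent].
  rewrite addrC -[X in X + _]scale1r; apply: lin_dual_linear.
    by apply: cTmap_cotangent => //; exact: lambda_cotangent.
  exact: flat_cotangent.
- by split=> [c v w _ _|//]; rewrite mulr0 addr0.
move=> w Aw; rewrite hE// /g /=.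
have Aw' := AGPhi w Aw; have tw := tanchor w Aw.
have [ll _] := lambda_cotangent fw Aw'.
have tTY : tangent (phi x) (Tmap phi x Y) by exact: Tmap_tangent.
rewrite addrC -[X in X - _]/(flat sigma x Y (anchor x w) +
  cTmap phi x (lambda omega (phi x) u) (anchor x w)).
have -> : Tmap phi x Y - anchor (phi x) u = (-1) *: anchor (phi x) u + Tmap phi x Y.
  by rewrite scaleN1r addrC.
rewrite ll//; last exact: anchor_tangent.
(* In h(g(Y, u))(w) the terms with Y cancel by [cond] evaluated at Y, those with u by the isotropy
   of L. *)
have := congr1 (@^~ Y) (cond x w Aw).
rewrite -[X in X = _ -> _]/(cTmap phi x (lambda omega (phi x) (Tmap Phi (unit H x) w)) Y +
  flat sigma x (anchor x w) Y) -[X in _ = X -> _]/(0 : R).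
rewrite /flat /cTmap !restrE// (form2N fs tw tY) => c1.
have := lambda_isotropic fw mw Au Aw'; rewrite (anchor_Phi hPhi) => c2.
rewrite -[RHS]/(0 : R).
move: c1 c2; move: (sigma _ _ _) (lambda _ _ _ _) (lambda _ _ _ _) (lambda _ _ _ _) => s1 s2 s3 s4.
move=> c1 c2; lra.
Qed.

End Proposition.

Theorem proposition2p29 (R : realType) (M : manifold R) (G : lie_groupoid M)
    (omega : form2 G) (eta : form3 M) (hG : shifted_symplectic1 omega eta) :
  (forall (N : manifold R) (H : lie_groupoid N) (Phi : H -> G) (phi : N -> M)
      (sigma : form2 N),
    lagrangian_morphism omega eta Phi phi sigma ->
    inf_lagrangian_morphism eta (groupoid_dirac omega) phi sigma)
  /\
  (forall (N : manifold R) (phi : N -> M) (sigma : form2 N),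
    inf_lagrangian_morphism eta (groupoid_dirac omega) phi sigma ->
    forall (H : lie_groupoid N)
      (psi : N -> vec H -> bivec N M),
    source_simply_connected H ->
    integrates eta (groupoid_dirac omega) phi sigma psi ->
    forall Phi : H -> G,
    integrates_projection omega psi Phi phi ->
    lagrangian_morphism omega eta Phi phi sigma).
Proof.
split; first exact: lagrangian_infinitesimal.
exact: infinitesimal_lagrangian.
Qed.
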